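(* Let $\varphi:\mathbb D\to\mathbb D$ be holomorphic, let $\sigma\in\partial\mathbb D$ be a repulsive fixed point of $\varphi$, and suppose there is a regular backward orbit of $\varphi$ converging to $\sigma$. Then the pre-model for $\varphi$ at $\sigma$ is regular if and only if $$\sum_{n=1}^\infty\big(\rho-\mathrm k_{\mathbb D}(z_n,z_{n+1})\big)<+\infty,\qquad \rho:=\lim_{n\to+\infty}\mathrm k_{\mathbb D}(z_n,z_{n+1})=2\operatorname{arctanh}\frac{\varphi'(\sigma)-1}{\big|e^{2i\theta}\varphi'(\sigma)+1\big|},$$ where $\theta:=\lim_{n\to+\infty}\arg(1-\overline\sigma z_n)$, for some (and hence any) regular backward orbit $(z_n)$ of $\varphi$ converging to $\sigma$.
   Context: $\mathbb D=\{z\in\mathbb C:|z|<1\}$, $\mathbb H=\{\zeta\in\mathbb C:\operatorname{Re}\zeta>0\}$. $\mathrm k_{\mathbb D}(z,w)=\log\frac{1+\varrho_{\mathbb D}(z,w)}{1-\varrho_{\mathbb D}(z,w)}$ with $\varrho_{\mathbb D}(z,w)=\left|\frac{z-w}{1-\overline wz}\right|$ is the hyperbolic distance. For $\sigma\in\partial\mathbb D$, $\angle\lim_{z\to\sigma}f(z)=\ell$ means that for every $M>1$, $f(z)\to\ell$ as $z\to\sigma$ with $|z-\sigma|<M(1-|z|)$. For functions on $\mathbb H$, $\angle\lim_{\zeta\to\infty}f(\zeta)=\ell$ means that for every $\theta\in(0,\pi/2)$, $f(\zeta)\to\ell$ as $\zeta\to\infty$ with $|\arg\zeta|<\theta$.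 A point $\sigma\in\partial\mathbb D$ is a boundary fixed point of $\varphi$ if $\angle\lim_{z\to\sigma}\varphi(z)=\sigma$; then $\varphi'(\sigma):=\angle\lim_{z\to\sigma}\frac{\varphi(z)-\sigma}{z-\sigma}$ exists in $(0,+\infty)\cup\{\infty\}$. It is a repulsive fixed point if $1<\varphi'(\sigma)<+\infty$. A backward orbit of $\varphi$ is a sequence $(z_n)_{n\ge0}\subset\mathbb D$ with $\varphi(z_n)=z_{n-1}$ for all $n\in\mathbb N$; it is regular if it has no accumulation point in $\mathbb D$ and $\sup_{n\in\mathbb N}\mathrm k_{\mathbb D}(z_n,z_{n+1})<+\infty$. Pre-model: let $\sigma$ be a repulsive fixed point of $\varphi$, let $T_\sigma:\mathbb H\to\mathbb D$, $T_\sigma(\zeta)=\sigma\frac{\zeta-1}{\zeta+1}$, and let $f:=T_\sigma^{-1}\circ\varphi\circ T_\sigma:\mathbb H\to\mathbb H$, which has a repulsive fixed point at $\infty$, with $f'(\infty):=\angle\lim_{\zeta\to\infty}f(\zeta)/\zeta=1/\varphi'(\sigma)\in(0,1)$. By a theorem of Poggi-Corradini there exists a holomorphic $F:\mathbb H\to\mathbb H$, unique up to precomposition with a map $\zeta\mapsto\alpha\zeta$, $\alpha>0$, such that $f(F(\zeta))=F(f'(\infty)\zeta)$ for all $\zeta\in\mathbb H$, $\angle\lim_{\zeta\to\infty}F(\zeta)=\infty$ and $\angle\lim_{\zeta\to\infty}\arg(F(\zeta)/\zeta)=0$. The triple $(\mathbb H,F,\zeta\mapsto f'(\infty)\zeta)$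 is the pre-model for $f$ at $\infty$ (for $\varphi$ at $\sigma$). The pre-model is called regular if $F'(\infty):=\angle\lim_{\zeta\to\infty}F(\zeta)/\zeta>0$ (this limit always exists in $[0,+\infty)$). *)

(* Defs.v *)
From Stdlib Require Export Reals.
From Coquelicot Require Export Coquelicot.
Open Scope R_scope.

Definition in_disk (z : C) : Prop := Cmod z < 1.
Definition in_half_plane (zeta : C) : Prop := 0 < Re zeta.

(* Functions on D or H are total functions C -> C, only constrained on the
   domain [U].  As [U] is always open, complex differentiability at each of its
   points depends only on the restriction to [U]. *)
Definition holomorphic_on (U : C -> Prop) (f : C -> C) : Prop :=
  forall z : C, U z -> ex_derive (K := C_AbsRing) (V := C_NormedModule) f z.

Definition maps_to (U V : C -> Prop) (f : C -> C) : Prop :=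
  forall z : C, U z -> V (f z).

(* Principal argument, with values in (-PI, PI] for z <> 0. *)
Definition Carg (z : C) : R :=
  if Rle_dec 0 (Im z) then acos (Re z / Cmod z) else - acos (Re z / Cmod z).

Definition arctanh (x : R) : R := / 2 * ln ((1 + x) / (1 - x)).

Definition Cexp_i (t : R) : C := (cos t, sin t).

Definition pseudo_hyp_dist (z w : C) : R :=
  Cmod ((z - w) / (1 - Cconj w * z))%C.

Definition hyp_dist (z w : C) : R :=
  ln ((1 + pseudo_hyp_dist z w) / (1 - pseudo_hyp_dist z w)).

(* The filter of neighbourhoods of the point at infinity of C. *)
Definition C_infty (P : C -> Prop) : Prop :=
  exists M : R, forall z : C, M < Cmod z -> P z.

(* Angular limits take the target filter as an argument: [locally l] for a
   finite limit l, [C_infty] for the limit infinity.  For M > 0, the condition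
   |z - sigma| < M (1 - |z|) forces |z| < 1. *)
Definition ang_lim (f : C -> C) (sigma : C) (G : (C -> Prop) -> Prop) : Prop :=
  forall M : R, 1 < M ->
    filterlim f
      (within (fun z => Cmod (z - sigma)%C < M * (1 - Cmod z)) (locally sigma))
      G.

Definition ang_lim_infty {T : Type} (f : C -> T) (G : (T -> Prop) -> Prop)
    : Prop :=
  forall theta : R, 0 < theta < PI / 2 ->
    filterlim f (within (fun zeta => Rabs (Carg zeta) < theta) C_infty) G.

Definition boundary_fixed_point (phi : C -> C) (sigma : C) : Prop :=
  Cmod sigma = 1 /\ ang_lim phi sigma (locally sigma).

(* [lam] is the (finite) angular derivative phi'(sigma). *)
Definition is_ang_derive (phi : C -> C) (sigma : C) (lam : R) : Prop :=
  ang_lim (fun z => ((phi z - sigma) / (z - sigma))%C) sigma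
    (locally (RtoC lam)).

Definition repulsive_fixed_point (phi : C -> C) (sigma : C) (lam : R) : Prop :=
  boundary_fixed_point phi sigma /\ is_ang_derive phi sigma lam /\ 1 < lam.

Definition backward_orbit (phi : C -> C) (z : nat -> C) : Prop :=
  (forall n : nat, in_disk (z n)) /\ (forall n : nat, phi (z (S n)) = z n).

Definition accumulation_point (z : nat -> C) (w : C) : Prop :=
  forall P : C -> Prop, locally w P ->
    forall N : nat, exists n : nat, (N <= n)%nat /\ P (z n).

Definition hyp_step (z : nat -> C) (n : nat) : R := hyp_dist (z n) (z (S n)).

Definition regular_backward_orbit (phi : C -> C) (z : nat -> C) : Prop :=
  backward_orbit phi z /\
  (forall w : C, in_disk w -> ~ accumulation_point z w) /\
  (exists B : R, forall n : nat, hyp_step z n <= B).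

Definition regular_backward_orbit_to
    (phi : C -> C) (sigma : C) (z : nat -> C) : Prop :=
  regular_backward_orbit phi z /\ filterlim z eventually (locally sigma).

(* The Cayley transform T_sigma : H -> D and its inverse. *)
Definition cayley (sigma zeta : C) : C :=
  (sigma * ((zeta - 1) / (zeta + 1)))%C.
Definition cayley_inv (sigma z : C) : C := ((sigma + z) / (sigma - z))%C.

Definition half_plane_conj (phi : C -> C) (sigma : C) : C -> C :=
  fun zeta => cayley_inv sigma (phi (cayley sigma zeta)).

(* [F] is the intertwining map of the pre-model (H, F, zeta |-> mu zeta) for
   f : H -> H at infinity, where mu = f'(infinity). *)
Definition is_pre_model_infty (f : C -> C) (mu : R) (F : C -> C) : Prop :=
  holomorphic_on in_half_plane F /\
  maps_to in_half_plane in_half_plane F /\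
  (forall zeta : C, in_half_plane zeta -> f (F zeta) = F (RtoC mu * zeta)%C) /\
  ang_lim_infty F C_infty /\
  ang_lim_infty (fun zeta => Carg (F zeta / zeta)%C) (locally 0).

(* Here f'(infinity) = 1 / phi'(sigma) = / lam. *)
Definition is_pre_model (phi : C -> C) (sigma : C) (lam : R) (F : C -> C)
    : Prop :=
  is_pre_model_infty (half_plane_conj phi sigma) (/ lam) F.

(* F'(infinity) > 0.  For a pre-model, F'(infinity) always exists in
   [0, +infinity). *)
Definition regular_pre_model (F : C -> C) : Prop :=
  exists c : R, 0 < c /\
    ang_lim_infty (fun zeta => (F zeta / zeta)%C) (locally (RtoC c)).

(* The sum over n >= 1 of rho - k_D(z_n, z_{n+1}), with rho the limit of
   k_D(z_n, z_{n+1}), is finite.  By the Schwarz-Pick lemma k_D(z_n, z_{n+1}) is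
   nondecreasing along a backward orbit, so the terms are nonnegative and a
   finite sum means convergence. *)
Definition summable_step_defect (z : nat -> C) : Prop :=
  exists rho : R, is_lim_seq (hyp_step z) rho /\
    ex_series (fun n : nat => rho - hyp_step z (S n)).

(* Main.v *)
Require Import Defs.
From Stdlib Require Import Lra Lia Classical ClassicalEpsilon Ranalysis5.

(* In the half plane, Schwarz-Pick forces a regular backward orbit to approach
   infinity nontangentially, and a compactness argument then shows that it is
   F (lam^n b) for a fixed b. Its hyperbolic steps are therefore the contractions
   by F of the constant distance rho between lam^n b and lam^(n+1) b, and
   rho - k(z_n, z_(n+1)) is comparable to the defect 1 - |e_n| of the hyperbolic
   difference quotient e_n of F. By the three-point Schwarz-Pick lemma the
   summability of these defects does not depend on b, so b may be taken real.
   There, Re F(t) / t is nonincreasing and its decrements bound the defects. If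
   conversely the defects are summable, the direction of F(lam^(n+1)) - F(lam^n)
   relative to the real axis obeys an expanding recursion up to a summable error
   and is therefore summable too, which keeps Re F(t) / t away from 0. *)

(** * Goursat's theorem and the maximum principle *)

(** The defect 1 - |e_n| records only lost hyperbolic length. By itself it does not bound the loss
    of radial growth, since F may preserve length and move sideways; this is why the direction is
    controlled separately. If no length were lost, the images of lam^n, lam^(n+1), lam^(n+2) would
    lie on one geodesic of the half plane, and a geodesic that does not head for infinity bends
    away, its slope being multiplied by lam at each step. Slopes that stay bounded can then only
    come from the errors.

    The three-point lemma is Schwarz-Pick for the difference quotient as a function of one point,
    singular at the other. The singularity is not removed: the maximum principle used here asks only
    for continuity at exceptional points, because the mean over a circle is computed in a
    logarithmic coordinate that puts the centre at infinity. As the lemma moves one point at a time,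
    comparing the pairs (a, lam a) and (b, lam b) takes the mixed pair (b, lam a). *)

(** The integral of u dy + v dx over the counterclockwise boundary of [a, b] x [c, d], that is, the
    imaginary part of the integral of (u + i v) dz. *)
Definition bdry_form (u v : R -> R -> R) (a b c d : R) : R :=
  RInt (fun y => u b y - u a y) c d - RInt (fun x => v x d - v x c) a b.

Lemma RInt_near_const (g : R -> R) a h l e : 0 <= h -> ex_RInt g a (a + h) ->
  (forall t, a <= t <= a + h -> Rabs (g t - l) <= e) -> Rabs (RInt g a (a + h) - h * l) <= h * e.
Proof.
  intros Hh Hg He.
  replace (h * l) with (RInt (fun _ => l) a (a + h)).
  2:{ rewrite RInt_const. unfold scal; simpl; unfold mult; simpl. ring. }
  assert (E : ex_RInt (fun _ : R => l) a (a + h)) by apply ex_RInt_const.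
  replace (RInt g a (a + h) - RInt (fun _ => l) a (a + h)) with (RInt (fun t => g t - l) a (a + h))
    by (apply (@RInt_minus R_CompleteNormedModule g (fun _ => l)); auto).
  replace (h * e) with ((a + h - a) * e) by ring.
  apply abs_RInt_le_const; auto. lra. apply (@ex_RInt_minus R_NormedModule g (fun _ => l)); auto.
Qed.

Section Green.

Variables (u v : R -> R -> R) (xmax : R).
(** Of the Cauchy-Riemann equations this records u_x = v_y, the closedness of u dy + v dx. The
    domain is a half plane because the form is integrated in the coordinate log (w - z0), with xmax
    the logarithm of a radius. *)
Hypothesis Huv : forall x y, x < xmax -> exists A B C,
  differentiable_pt_lim u x y A B /\ differentiable_pt_lim v x y C A.

Lemma green_ex_RInt_u x c d : x < xmax -> ex_RInt (u x) c d.
Proof.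
  intros Hx. apply (@ex_RInt_continuous R_CompleteNormedModule). intros z _.
  destruct (Huv x z Hx) as (A & B & C & H & _).
  apply (@ex_derive_continuous R_AbsRing R_NormedModule).
  exists (A * 0 + B * 1). apply is_derive_Reals.
  apply (derivable_pt_lim_comp_2d u (fun _ => x) (fun t => t)); auto.
  - apply derivable_pt_lim_const.
  - apply derivable_pt_lim_id.
Qed.

Lemma green_ex_RInt_v y a b : a < xmax -> b < xmax -> ex_RInt (fun x => v x y) a b.
Proof.
  intros Ha Hb. apply (@ex_RInt_continuous R_CompleteNormedModule). intros z Hz.
  assert (Hx : z < xmax) by (destruct Hz as [_ Hz]; apply Rle_lt_trans with (1 := Hz); apply Rmax_case; auto).
  destruct (Huv z y Hx) as (A & B & C & _ & H).
  apply (@ex_derive_continuous R_AbsRing R_NormedModule).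
  exists (C * 1 + A * 0). apply is_derive_Reals.
  apply (derivable_pt_lim_comp_2d v (fun t => t) (fun _ => y)); auto.
  - apply derivable_pt_lim_id.
  - apply derivable_pt_lim_const.
Qed.

Lemma bdry_form_alt a b c d : a < xmax -> b < xmax ->
  bdry_form u v a b c d =
  RInt (u b) c d - RInt (u a) c d - (RInt (fun x => v x d) a b - RInt (fun x => v x c) a b).
Proof.
  intros Ha Hb. unfold bdry_form. f_equal.
  - apply is_RInt_unique.
    apply (@is_RInt_minus R_NormedModule (u b) (u a)); apply (@RInt_correct R_CompleteNormedModule), green_ex_RInt_u; auto.
  - apply is_RInt_unique.
    apply (@is_RInt_minus R_NormedModule (fun x => v x d) (fun x => v x c)); apply (@RInt_correct R_CompleteNormedModule), green_ex_RInt_v; auto.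
Qed.

Lemma bdry_form_split a m b c n d : a < xmax -> m < xmax -> b < xmax ->
  bdry_form u v a b c d =
  bdry_form u v a m c n + bdry_form u v m b c n +
  bdry_form u v a m n d + bdry_form u v m b n d.
Proof.
  intros Ha Hm Hb. rewrite !bdry_form_alt by auto.
  assert (Eu : forall x, x < xmax -> RInt (u x) c d = RInt (u x) c n + RInt (u x) n d).
  { intros x Hx. symmetry. apply (@RInt_Chasles R_CompleteNormedModule); apply green_ex_RInt_u; auto. }
  assert (Ev : forall y, RInt (fun x => v x y) a b = RInt (fun x => v x y) a m + RInt (fun x => v x y) m b).
  { intros y. symmetry. apply (@RInt_Chasles R_CompleteNormedModule); apply green_ex_RInt_v; auto. }
  rewrite !Eu, !Ev by auto. ring.
Qed.

(** With A the common value of u_x and v_y, both integrals equal A h k up to errors of order eps M k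
    and eps M h, and the main terms cancel. *)
Lemma bdry_form_small x y eps : x < xmax -> 0 < eps ->
  exists delta, 0 < delta /\
  forall a h c k M, 0 <= h -> 0 <= k -> h <= M -> k <= M -> M < delta ->
    a <= x <= a + h -> c <= y <= c + k -> a + h < xmax ->
    Rabs (bdry_form u v a (a + h) c (c + k)) <= 2 * eps * M * (h + k).
Proof.
  intros Hx He.
  destruct (Huv x y Hx) as (A & B & C & Hu & Hv).
  destruct (Hu (mkposreal _ He)) as [d1 H1]. destruct (Hv (mkposreal _ He)) as [d2 H2].
  exists (Rmin d1 d2). split. { apply Rmin_pos; apply cond_pos. }
  simpl in H1, H2.
  intros a h c k M Hh Hk HhM HkM HM Hax Hcy HS.
  assert (Hd1 := Rmin_l d1 d2). assert (Hd2 := Rmin_r d1 d2).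
  assert (B1 : Rabs (RInt (fun y' => u (a+h) y' - u a y') c (c+k) - k * (A * h)) <= k * (2 * eps * M)).
  { apply RInt_near_const; auto.
    - apply (@ex_RInt_minus R_NormedModule (u (a+h)) (u a)); apply green_ex_RInt_u; lra.
    - intros t Ht. assert (Et : Rabs (t-y) <= M) by (apply Rabs_le; lra).
      assert (G : forall x', Rabs (x'-x) <= M -> Rabs (u x' t - u x y - (A * (x'-x) + B * (t-y))) <= eps * M).
      { intros x' Hx'. eapply Rle_trans. apply H1; lra. apply Rmult_le_compat_l. lra. apply Rmax_lub; auto. }
      assert (G1 := G (a+h) ltac:(apply Rabs_le; lra)). assert (G2 := G a ltac:(apply Rabs_le; lra)).
      apply Rabs_le_between in G1. apply Rabs_le_between in G2. apply Rabs_le. lra. }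
  assert (B2 : Rabs (RInt (fun x' => v x' (c+k) - v x' c) a (a+h) - h * (A * k)) <= h * (2 * eps * M)).
  { apply RInt_near_const; auto.
    - apply (@ex_RInt_minus R_NormedModule (fun x' => v x' (c+k)) (fun x' => v x' c)); apply green_ex_RInt_v; lra.
    - intros t Ht. assert (Et : Rabs (t-x) <= M) by (apply Rabs_le; lra).
      assert (G : forall y', Rabs (y'-y) <= M -> Rabs (v t y' - v x y - (C * (t-x) + A * (y'-y))) <= eps * M).
      { intros y' Hy'. eapply Rle_trans. apply H2; lra. apply Rmult_le_compat_l. lra. apply Rmax_lub; auto. }
      assert (G1 := G (c+k) ltac:(apply Rabs_le; lra)). assert (G2 := G c ltac:(apply Rabs_le; lra)).
      apply Rabs_le_between in G1. apply Rabs_le_between in G2. apply Rabs_le. lra. }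
  unfold bdry_form.
  apply Rabs_le_between in B1. apply Rabs_le_between in B2. apply Rabs_le. nra.
Qed.

(* Goursat's bisection argument: partial derivatives need not be continuous. *)
Lemma bdry_form_zero a b c d : a < b -> b < xmax -> c < d ->
  bdry_form u v a b c d = 0.
Proof.
  intros Hab HbS Hcd.
  apply NNPP; intros Hne.
  set (h := b - a). set (k := d - c).
  (* The assumed nonzero value per unit area; every bisection keeps a quarter with at least this
     density. *)
  set (eta := Rabs (bdry_form u v a b c d) / (h * k)).
  assert (Hhk : 0 < h * k) by (unfold h, k; apply Rmult_lt_0_compat; lra).
  assert (Heta : 0 < eta). { apply Rdiv_lt_0_compat; auto. apply Rabs_pos_lt; auto. }
  set (P := fun (n : nat) (p : R * R) =>
     a <= fst p /\ fst p + h / 2^n <= b /\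
     eta * (h * k) / 4^n <= Rabs (bdry_form u v (fst p) (fst p + h / 2^n) (snd p) (snd p + k / 2^n))).
  assert (P0 : P 0%nat (a, c)).
  { unfold P; simpl. unfold h, k. split; [lra|]. split; [lra|].
    replace (a + (b - a)/1) with b by field. replace (c + (d-c)/1) with d by field.
    unfold eta; fold h k. right. field. unfold h, k in Hhk. split; unfold h,k; lra. }
  assert (Step : forall n p, P n p -> exists q, P (S n) q /\
     fst p <= fst q <= fst p + h / 2^n - h / 2 ^ (S n) /\
     snd p <= snd q <= snd p + k / 2^n - k / 2 ^ (S n)).
  { intros n [x y] (H1 & H2 & H3). simpl fst in *; simpl snd in *.
    set (h' := h / 2 ^ S n). set (k' := k / 2 ^ S n).
    assert (Hpow : 0 < 2^n) by (apply pow_lt; lra).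
    assert (Hpow4 : 0 < 4^n) by (apply pow_lt; lra).
    assert (Eh : h / 2^n = h' + h') by (unfold h'; simpl; field; lra).
    assert (Ek : k / 2^n = k' + k') by (unfold k'; simpl; field; lra).
    assert (Hh' : 0 < h') by (unfold h', h; apply Rdiv_lt_0_compat; [lra|apply pow_lt; lra]).
    assert (Hk' : 0 < k') by (unfold k', k; apply Rdiv_lt_0_compat; [lra|apply pow_lt; lra]).
    set (T := eta * (h*k) / 4 ^ S n).
    assert (ET : eta * (h*k) / 4^n = 4 * T) by (unfold T; simpl; field; lra).
    rewrite Eh, Ek, ET in *.
    rewrite (bdry_form_split x (x+h') (x+(h'+h')) y (y+k') (y+(k'+k'))) in H3 by lra.
    assert (D : forall x' y', (x' = x \/ x' = x + h') -> (y' = y \/ y' = y + k') ->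
       T <= Rabs (bdry_form u v x' (x'+h') y' (y'+k')) ->
       exists q, P (S n) q /\ x <= fst q <= x + (h'+h') - h' /\ y <= snd q <= y + (k'+k') - k').
    { intros x' y' Hx' Hy' HT. exists (x', y'). unfold P; simpl fst; simpl snd. fold h' k' T.
      repeat split; auto; lra. }
    destruct (Rle_lt_dec T (Rabs (bdry_form u v x (x+h') y (y+k')))) as [L0|L1]; [apply (D x y); auto|].
    destruct (Rle_lt_dec T (Rabs (bdry_form u v (x+h') ((x+h')+h') y (y+k')))) as [L0|L2]; [apply (D (x+h') y); auto|].
    destruct (Rle_lt_dec T (Rabs (bdry_form u v x (x+h') (y+k') ((y+k')+k')))) as [L0|L3]; [apply (D x (y+k')); auto|].
    destruct (Rle_lt_dec T (Rabs (bdry_form u v (x+h') ((x+h')+h') (y+k') ((y+k')+k')))) as [L0|L4]; [apply (D (x+h') (y+k')); auto|].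
    exfalso. rewrite !Rplus_assoc in L2, L3. rewrite (Rplus_assoc x), (Rplus_assoc y) in L4.
    apply Rabs_def2 in L1. apply Rabs_def2 in L2. apply Rabs_def2 in L3. apply Rabs_def2 in L4.
    revert H3. apply Rlt_not_le. apply Rabs_def1; lra. }
  (* The implication from [P n p] inside the predicate lets the choice be defined before the
     invariant is known to hold. *)
  set (nxt := fun n p => epsilon (inhabits p) (fun q => P n p -> P (S n) q /\
     fst p <= fst q <= fst p + h / 2^n - h / 2 ^ (S n) /\
     snd p <= snd q <= snd p + k / 2^n - k / 2 ^ (S n))).
  set (s := fix s n := match n with 0%nat => (a,c) | S n => nxt n (s n) end).
  assert (Hs : forall n, P n (s n) /\ (fst (s n) <= fst (s (S n)) <= fst (s n) + h / 2^n - h / 2 ^ (S n) /\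
     snd (s n) <= snd (s (S n)) <= snd (s n) + k / 2^n - k / 2 ^ (S n))).
  { assert (Q : forall n, P n (s n) -> P (S n) (s (S n)) /\ (fst (s n) <= fst (s (S n)) <= fst (s n) + h / 2^n - h / 2 ^ (S n) /\
     snd (s n) <= snd (s (S n)) <= snd (s n) + k / 2^n - k / 2 ^ (S n))).
    { intros n Hn. simpl s. unfold nxt at 1 2 3 4 5.
      apply (epsilon_spec (inhabits (s n)) (fun q => P n (s n) -> P (S n) q /\
     fst (s n) <= fst q <= fst (s n) + h / 2^n - h / 2 ^ (S n) /\
     snd (s n) <= snd q <= snd (s n) + k / 2^n - k / 2 ^ (S n))); auto.
      destruct (Step n (s n) Hn) as [q Hq]. exists q. auto. }
    assert (Pn : forall n, P n (s n)). { induction n. exact P0. apply Q; auto. }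
    intros n. split; auto. apply Q; auto. }
  assert (Nest : forall (w : R) (X : nat -> R), 0 < w ->
     (forall n, X n <= X (S n) <= X n + w / 2^n - w / 2 ^ (S n)) ->
     exists l, forall n, X n <= l <= X n + w / 2^n).
  { intros w X Hw HX.
    assert (Hdec : forall n, X (S n) + w / 2 ^ (S n) <= X n + w / 2^n).
    { intros n. specialize (HX n). lra. }
    assert (Hinc : forall n, X n <= X (S n)) by (intros n; specialize (HX n); lra).
    assert (L0 : is_lim_seq (fun n => X n + w / 2^n - X n) 0).
    { apply is_lim_seq_ext with (fun n => w * (/2)^n).
      { intros n. rewrite pow_inv. field. apply pow_nonzero; lra. }
      replace (Finite 0) with (Rbar_mult w 0) by (simpl; f_equal; ring).
      apply is_lim_seq_scal_l. apply is_lim_seq_geom. rewrite Rabs_pos_eq; lra. }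
    destruct (ex_lim_seq_adj X (fun n => X n + w / 2^n) Hinc Hdec L0) as (E1 & E2 & E3).
    destruct E1 as [l Hl]. exists l. intros n. split.
    - apply (is_lim_seq_incr_compare X l); auto.
    - apply (is_lim_seq_decr_compare (fun n => X n + w / 2^n) l); auto.
      destruct E2 as [l' Hl']. apply is_lim_seq_unique in Hl as Hl1. apply is_lim_seq_unique in Hl' as Hl2.
      rewrite Hl1, Hl2 in E3. rewrite E3. exact Hl'. }
  destruct (Nest h (fun n => fst (s n))) as [x Hx]. { unfold h; lra. } { intros n; apply Hs. }
  destruct (Nest k (fun n => snd (s n))) as [y Hy]. { unfold k; lra. } { intros n; apply Hs. }
  assert (Hx0 := Hx 0%nat). simpl in Hx0.
  assert (HxS : x < xmax). { unfold h in Hx0; lra. }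
  set (M := h + k). assert (Hh : 0 < h) by (unfold h; lra). assert (Hk : 0 < k) by (unfold k; lra).
  (* With this eps the upper bound 2 eps M^2 / 4^n is half of the lower bound eta h k / 4^n. *)
  set (eps := eta * (h*k) / (4 * M * M)).
  assert (HM : 0 < M) by (unfold M; lra).
  assert (HMM : 0 < M * M) by nra.
  assert (Heps : 0 < eps). { apply Rdiv_lt_0_compat. apply Rmult_lt_0_compat; auto. nra. }
  destruct (bdry_form_small x y eps HxS Heps) as (delta & Hdel & Hsm).
  assert (exists n, M / 2^n < delta).
  { destruct (pow_lt_1_zero (/2)) with (y := delta / M) as [N HN].
    rewrite Rabs_pos_eq; lra. apply Rdiv_lt_0_compat; auto.
    exists N. specialize (HN N (le_n N)). rewrite Rabs_pos_eq in HN.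
    2:{ apply pow_le; lra. }
    rewrite pow_inv in HN. apply Rmult_lt_compat_l with (r := M) in HN; auto.
    replace (M * (delta/M)) with delta in HN by (field; lra). exact HN. }
  destruct H as [n Hn].
  destruct (Hs n) as ((Q1 & Q2 & Q3) & _).
  assert (Hpow : 0 < 2^n) by (apply pow_lt; lra).
  assert (Hpi : 0 < / 2^n) by (apply Rinv_0_lt_compat; auto).
  specialize (Hsm (fst (s n)) (h/2^n) (snd (s n)) (k/2^n) (M/2^n)).
  assert (Hle : Rabs (bdry_form u v (fst (s n)) (fst (s n) + h/2^n) (snd (s n)) (snd (s n) + k/2^n)) <= 2 * eps * (M/2^n) * (h/2^n + k/2^n)).
  { apply Hsm; auto; unfold Rdiv; try nra; try (apply Rmult_le_compat_r; unfold M; lra). }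
  assert (E4 : 4^n = 2^n * 2^n). { replace 4 with (2*2) by lra. apply Rpow_mult_distr. }
  assert (HH : eta * (h * k) / 4 ^ n <= 2 * eps * (M/2^n) * (h/2^n + k/2^n)) by lra.
  rewrite E4 in HH.
  replace (2 * eps * (M/2^n) * (h/2^n + k/2^n)) with (eta * (h*k) / (2^n*2^n) / 2) in HH.
  2:{ unfold eps, M. field. unfold M in *. split; lra. }
  assert (0 < eta * (h*k) / (2^n*2^n)). { apply Rdiv_lt_0_compat; apply Rmult_lt_0_compat; auto. }
  lra.
Qed.

End Green.

(** * Continuity and complex differentiability in terms of [Cmod] *)

Ltac C_coords := unfold Re, Im, Cconj, RtoC, Cmult, Cminus, Cplus, Copp; simpl.

Ltac C_coords_all := unfold Re, Im, Cconj, RtoC, Cmult, Cminus, Cplus, Copp in *; simpl in *.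

(** Neighbourhoods are disks of [Cmod], in which all later estimates are made; [locally_Cmod]
    compares them with the filter [locally]. *)
Definition near (z : C) (P : C -> Prop) : Prop :=
  exists d, 0 < d /\ forall w, Cmod (w - z)%C < d -> P w.

Definition ccont (f : C -> C) (z : C) : Prop :=
  forall eps, 0 < eps -> near z (fun w => Cmod (f w - f z)%C < eps).

(* Caratheodory's form of complex differentiability. *)
Definition cdiff (f : C -> C) (z : C) : Prop :=
  exists Q, ccont Q z /\ near z (fun w => f w = f z + Q w * (w - z))%C.

Lemma near_and z (P Q : C -> Prop) : near z P -> near z Q -> near z (fun w => P w /\ Q w).
Proof.
  intros (d1 & H1 & K1) (d2 & H2 & K2). exists (Rmin d1 d2).
  split. apply Rmin_pos; auto. intros w Hw.
  split; [apply K1|apply K2]; eapply Rlt_le_trans; eauto; [apply Rmin_l|apply Rmin_r].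
Qed.

Lemma near_imp z (P Q : C -> Prop) : (forall w, P w -> Q w) -> near z P -> near z Q.
Proof. intros H (d & H1 & K1). exists d; split; auto. Qed.
Lemma near_self z (P : C -> Prop) : near z P -> P z.
Proof.
  intros (d & H & K). apply K. replace (z - z)%C with (RtoC 0) by ring. rewrite Cmod_0. auto.
Qed.

Lemma near_ball z d : 0 < d -> near z (fun w => Cmod (w - z)%C < d).
Proof. intros; exists d; auto. Qed.
Lemma ccont_const c z : ccont (fun _ => c) z.
Proof.
  intros eps He. exists 1. split; [lra|]. intros w _.
  replace (c - c)%C with (RtoC 0) by ring. rewrite Cmod_0; auto.
Qed.

Lemma ccont_id z : ccont (fun w => w) z.
Proof. intros eps He. exists eps. auto. Qed.
Lemma ccont_comp f g z : ccont g z -> ccont f (g z) -> ccont (fun w => f (g w)) z.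
Proof.
  intros Hg Hf eps He. destruct (Hf eps He) as (d & Hd & K).
  apply (near_imp z (fun w => Cmod (g w - g z)%C < d)); auto.
Qed.

Lemma ccont_plus f g z : ccont f z -> ccont g z -> ccont (fun w => f w + g w)%C z.
Proof.
  intros Hf Hg eps He.
  apply (near_imp z (fun w => Cmod (f w - f z)%C < eps/2 /\ Cmod (g w - g z)%C < eps/2)).
  - intros w [H1 H2]. replace (f w + g w - (f z + g z))%C with ((f w - f z) + (g w - g z))%C by ring.
    eapply Rle_lt_trans. apply Cmod_triangle. lra.
  - apply near_and; [apply Hf|apply Hg]; lra.
Qed.

Lemma ccont_opp f z : ccont f z -> ccont (fun w => - f w)%C z.
Proof.
  intros Hf eps He. apply (near_imp z (fun w => Cmod (f w - f z)%C < eps)); [|auto].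
  intros w H. replace (- f w - - f z)%C with (- (f w - f z))%C by ring. rewrite Cmod_opp; auto.
Qed.

Lemma ccont_minus f g z : ccont f z -> ccont g z -> ccont (fun w => f w - g w)%C z.
Proof. intros Hf Hg. apply ccont_plus; auto. apply ccont_opp; auto. Qed.
Lemma ccont_mult f g z : ccont f z -> ccont g z -> ccont (fun w => f w * g w)%C z.
Proof.
  intros Hf Hg eps He.
  set (A := Cmod (f z)). set (B := Cmod (g z) + 1).
  assert (HA : 0 <= A) by apply Cmod_ge_0.
  assert (HB : 1 <= B) by (unfold B; assert (H := Cmod_ge_0 (g z)); lra).
  apply (near_imp z (fun w => Cmod (f w - f z)%C < eps / (2*B) /\ Cmod (g w - g z)%C < Rmin 1 (eps/(2*(A+1))))).
  - intros w [H1 H2].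
    assert (H3 := Rmin_l 1 (eps/(2*(A+1)))). assert (H4 := Rmin_r 1 (eps/(2*(A+1)))).
    replace (f w * g w - f z * g z)%C with ((f w - f z) * g w + f z * (g w - g z))%C by ring.
    eapply Rle_lt_trans. apply Cmod_triangle. rewrite !Cmod_mult.
    assert (Hgw : Cmod (g w) <= B).
    { replace (g w) with ((g w - g z) + g z)%C by ring.
      eapply Rle_trans. apply Cmod_triangle. unfold B. lra. }
    assert (Cmod (f w - f z)%C * Cmod (g w) <= Cmod (f w - f z)%C * B).
    { apply Rmult_le_compat_l; auto. apply Cmod_ge_0. }
    assert (Cmod (f w - f z)%C * B < eps / (2*B) * B) by (apply Rmult_lt_compat_r; lra).
    replace (eps / (2*B) * B) with (eps/2) in H0 by (field; lra).
    fold A. assert (A * Cmod (g w - g z)%C <= (A+1) * (eps/(2*(A+1)))).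
    { apply Rmult_le_compat; try lra. apply Cmod_ge_0. }
    replace ((A+1) * (eps/(2*(A+1)))) with (eps/2) in H5 by (field; lra). lra.
  - apply near_and.
    + apply Hf. apply Rdiv_lt_0_compat; lra.
    + apply Hg. apply Rmin_pos. lra. apply Rdiv_lt_0_compat; lra.
Qed.

Lemma near_nonzero f z : ccont f z -> f z <> 0 ->
  near z (fun w => Cmod (f z) / 2 < Cmod (f w) /\ f w <> 0).
Proof.
  intros Hf Hz. assert (H0 : 0 < Cmod (f z)) by (apply Cmod_gt_0; auto).
  apply (near_imp z (fun w => Cmod (f w - f z)%C < Cmod (f z) / 2)); [|apply Hf; lra].
  intros w Hw.
  assert (Cmod (f z) <= Cmod (f w) + Cmod (f w - f z)%C).
  { replace (f z) with (f w + - (f w - f z))%C at 1 by ring.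
    eapply Rle_trans. apply Cmod_triangle. rewrite Cmod_opp. lra. }
  split. lra. apply Cmod_gt_0. lra.
Qed.

Lemma ccont_inv f z : ccont f z -> f z <> 0 -> ccont (fun w => / f w)%C z.
Proof.
  intros Hf Hz eps He. assert (H0 : 0 < Cmod (f z)) by (apply Cmod_gt_0; auto).
  apply (near_imp z (fun w => (Cmod (f z) / 2 < Cmod (f w) /\ f w <> 0) /\ Cmod (f w - f z)%C < eps * (Cmod (f z) * Cmod (f z) / 2))).
  - intros w [[H1 H2] H3].
    replace (/ f w - / f z)%C with (- (f w - f z) * / (f w * f z))%C by (field; auto).
    rewrite Cmod_mult, Cmod_opp, Cmod_inv, Cmod_mult by (apply Cmult_neq_0; auto).
    assert (H4 : Cmod (f z) * Cmod (f z) / 2 < Cmod (f w) * Cmod (f z)).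
    { replace (Cmod (f z) * Cmod (f z) / 2) with (Cmod (f z) / 2 * Cmod (f z)) by field.
      apply Rmult_lt_compat_r; auto. }
    apply Rmult_lt_reg_r with (Cmod (f w) * Cmod (f z)). nra.
    rewrite Rmult_assoc, Rinv_l by nra. nra.
  - apply near_and. apply near_nonzero; auto. apply Hf. apply Rmult_lt_0_compat; nra.
Qed.

Lemma ccont_div f g z : ccont f z -> ccont g z -> g z <> 0 -> ccont (fun w => f w / g w)%C z.
Proof. intros Hf Hg H. apply ccont_mult; auto. apply ccont_inv; auto. Qed.
Lemma cdiff_ccont f z : cdiff f z -> ccont f z.
Proof.
  intros (Q & HQ & HE) eps He.
  assert (H : ccont (fun w => f z + Q w * (w - z))%C z).
  { apply ccont_plus. apply ccont_const. apply ccont_mult; auto.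
    apply ccont_minus. apply ccont_id. apply ccont_const. }
  apply (near_imp z (fun w => (f w = f z + Q w * (w - z))%C /\ Cmod ((f z + Q w * (w - z)) - (f z + Q z * (z - z)))%C < eps)).
  - intros w [H1 H2]. rewrite H1.
    replace (f z) with (f z + Q z * (z - z))%C at 2 by ring. auto.
  - apply near_and; auto.
Qed.

Lemma cdiff_const c z : cdiff (fun _ => c) z.
Proof. exists (fun _ => 0). split. apply ccont_const. exists 1. split. lra. intros; ring. Qed.
Lemma cdiff_id z : cdiff (fun w => w) z.
Proof. exists (fun _ => 1). split. apply ccont_const. exists 1. split. lra. intros; ring. Qed.
Lemma cdiff_plus f g z : cdiff f z -> cdiff g z -> cdiff (fun w => f w + g w)%C z.
Proof.
  intros (Q & HQ & HE) (Q' & HQ' & HE'). exists (fun w => Q w + Q' w)%C. split. apply ccont_plus; auto.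
  generalize (near_and _ _ _ HE HE'). apply near_imp. intros w [-> ->]. ring.
Qed.

Lemma cdiff_mult f g z : cdiff f z -> cdiff g z -> cdiff (fun w => f w * g w)%C z.
Proof.
  intros Hf (Q' & HQ' & HE'). destruct (Hf) as (Q & HQ & HE).
  exists (fun w => Q w * g z + f w * Q' w)%C. split.
  - apply ccont_plus; apply ccont_mult; auto. apply ccont_const. apply cdiff_ccont; auto.
  - generalize (near_and _ _ _ HE HE'). apply near_imp. intros w [-> ->]. ring.
Qed.

Lemma cdiff_opp f z : cdiff f z -> cdiff (fun w => - f w)%C z.
Proof.
  intros (Q & HQ & HE). exists (fun w => - Q w)%C. split. apply ccont_opp; auto.
  revert HE. apply near_imp. intros w ->. ring.
Qed.

Lemma cdiff_minus f g z : cdiff f z -> cdiff g z -> cdiff (fun w => f w - g w)%C z.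
Proof. intros. apply cdiff_plus; auto. apply cdiff_opp; auto. Qed.
Lemma cdiff_inv f z : cdiff f z -> f z <> 0 -> cdiff (fun w => / f w)%C z.
Proof.
  intros Hf Hz. destruct (Hf) as (Q & HQ & HE).
  assert (Hc := cdiff_ccont _ _ Hf).
  exists (fun w => - Q w * / (f w * f z))%C. split.
  - apply ccont_mult. apply ccont_opp; auto. apply (ccont_inv (fun w => f w * f z)%C).
    apply ccont_mult; auto. apply ccont_const. apply Cmult_neq_0; auto.
  - generalize (near_and _ _ _ HE (near_nonzero _ _ Hc Hz)). apply near_imp.
    intros w [H [_ H']]. replace (/ f w)%C with (/ f z - (f w - f z) * / (f w * f z))%C by (field; auto).
    rewrite H at 1. ring.
Qed.

Lemma cdiff_div f g z : cdiff f z -> cdiff g z -> g z <> 0 -> cdiff (fun w => f w / g w)%C z.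
Proof. intros Hf Hg H. apply cdiff_mult; auto. apply cdiff_inv; auto. Qed.
Lemma cdiff_comp f g z : cdiff g z -> cdiff f (g z) -> cdiff (fun w => f (g w)) z.
Proof.
  intros Hg (Q & HQ & HE). destruct (Hg) as (Q' & HQ' & HE').
  assert (Hc := cdiff_ccont _ _ Hg).
  exists (fun w => Q (g w) * Q' w)%C. split.
  - apply ccont_mult; auto. apply ccont_comp; auto.
  - destruct HE as (d & Hd & K).
    generalize (near_and _ _ _ HE' (Hc d Hd)). apply near_imp. intros w [H1 H2].
    rewrite (K _ H2). rewrite H1 at 2. ring.
Qed.

Lemma cdiff_near_eq f g z : near z (fun w => f w = g w) -> cdiff f z -> cdiff g z.
Proof.
  intros H (Q & HQ & HE). exists Q. split; auto. rewrite <- (near_self _ _ H).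
  generalize (near_and _ _ _ H HE). apply near_imp. intros w [<- ->]. auto.
Qed.

Lemma ccont_near_eq f g z : near z (fun w => f w = g w) -> ccont f z -> ccont g z.
Proof.
  intros H Hf eps He. generalize (near_and _ _ _ H (Hf eps He)). apply near_imp.
  rewrite (near_self _ _ H). intros w [<- ?]. auto.
Qed.

Lemma ex_derive_cdiff (f : C -> C) (z : C) : ex_derive (K := C_AbsRing) (V := C_NormedModule) f z -> cdiff f z.
Proof.
  intros [l0 [_ Hl0]]. set (l := l0 : C). assert (Hl := Hl0). change l0 with l in Hl. clearbody l. clear Hl0 l0.
  assert (Hd : forall eps, 0 < eps -> near z (fun w => Cmod (f w - f z - l * (w - z))%C <= eps * Cmod (w - z)%C)).
  { intros eps He. destruct (Hl z (fun P H => H) (mkposreal _ He)) as [d Hd].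
    exists d. split. apply cond_pos. intros w Hw.
    replace (f w - f z - l * (w - z))%C with (f w - f z - (w - z) * l)%C by ring. exact (Hd w Hw). }
  exists (fun w => if excluded_middle_informative (w = z) then l else (f w - f z) / (w - z))%C. split.
  - intros eps He. generalize (Hd (eps/2) ltac:(lra)). apply near_imp. intros w Hw.
    destruct (excluded_middle_informative (z = z)) as [_|]; [|congruence].
    destruct (excluded_middle_informative (w = z)) as [E|E].
    + unfold Cminus. rewrite Cplus_opp_r, Cmod_0; auto.
    + assert (Hne : (w - z)%C <> 0). { intros H. apply E. replace w with (w - z + z)%C by ring. rewrite H. ring. }
      replace ((f w - f z) / (w - z) - l)%C with ((f w - f z - l * (w - z)) / (w - z))%C by (field; auto).
      rewrite Cmod_div by auto. apply Cmod_gt_0 in Hne.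
      apply Rle_lt_trans with (eps/2); [|lra].
      apply Rmult_le_reg_r with (Cmod (w - z)%C); auto. unfold Rdiv at 1. rewrite Rmult_assoc, Rinv_l by lra. lra.
  - exists 1. split. lra. intros w _. destruct (excluded_middle_informative (w = z)) as [->|E].
    + ring.
    + field. intros H. apply E. replace w with (w - z + z)%C by ring. rewrite H. ring.
Qed.

(** The Cauchy-Riemann equations, with derivative a + i b: multiplication by this number has the
    real matrix with rows (a, -b) and (b, a). *)
Lemma cdiff_coords f z : cdiff f z -> exists a b,
  differentiable_pt_lim (fun x y => Re (f (x, y))) (Re z) (Im z) a (- b) /\
  differentiable_pt_lim (fun x y => Im (f (x, y))) (Re z) (Im z) b a.
Proof.
  intros (Q & HQ & HE). exists (Re (Q z)), (Im (Q z)).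
  assert (Hd : forall eps, 0 < eps -> near z (fun w => Cmod (f w - f z - Q z * (w - z))%C <= eps * Cmod (w - z)%C)).
  { intros eps He. generalize (near_and _ _ _ HE (HQ eps He)). apply near_imp. intros w [H1 H2].
    replace (f w - f z - Q z * (w - z))%C with ((Q w - Q z) * (w - z))%C by (rewrite H1; ring).
    rewrite Cmod_mult. apply Rmult_le_compat_r. apply Cmod_ge_0. lra. }
  assert (G : forall (eps : posreal), locally_2d (fun x y => Cmod (f (x,y) - f z - Q z * ((x,y) - z))%C <= eps * Rmax (Rabs (x - Re z)) (Rabs (y - Im z))) (Re z) (Im z)).
  { intros eps. assert (He := cond_pos eps).
    destruct (Hd (eps / 2) ltac:(lra)) as (d & Hd0 & K).
    assert (Hd2 : 0 < d / 2) by lra.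
    assert (S2 : sqrt 2 <= 2). { rewrite <- (sqrt_square 2) at 2 by lra. apply sqrt_le_1; lra. }
    exists (mkposreal _ Hd2). simpl. intros x y Hx Hy.
    assert (HC := Cmod_2Rmax ((x,y) - z)%C).
    replace (fst ((x,y) - z)%C) with (x - Re z) in HC by reflexivity.
    replace (snd ((x,y) - z)%C) with (y - Im z) in HC by reflexivity.
    set (M := Rmax (Rabs (x - Re z)) (Rabs (y - Im z))) in *.
    assert (HM : 0 <= M). { apply Rle_trans with (1 := Rabs_pos (x - Re z)). apply Rmax_l. }
    assert (HMd : M < d / 2) by (apply Rmax_lub_lt; auto).
    assert (sqrt 2 * M <= 2 * M) by (apply Rmult_le_compat_r; auto).
    eapply Rle_trans. apply K. lra. nra. }
  split; intros eps; destruct (G eps) as [d K]; exists d; intros x y Hx Hy; eapply Rle_trans; try (apply (K x y Hx Hy)).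
  - eapply Rle_trans; [|apply re_le_Cmod]. right. f_equal.
    destruct z as [z1 z2]. destruct (Q (z1,z2)) as [q1 q2]. C_coords. ring.
  - eapply Rle_trans; [|eapply Rle_trans; [apply Rmax_r|apply Rmax_Cmod]]. right. f_equal.
    destruct z as [z1 z2]. destruct (Q (z1,z2)) as [q1 q2]. C_coords. ring.
Qed.

(** Both coordinates of z0 + exp (s + i t) have this form, with k the cosine or the sine. *)
Lemma differentiable_exp_mult (a : R) (k : R -> R) (l s t : R) :
  derivable_pt_lim k t l ->
  differentiable_pt_lim (fun s t => a + exp s * k t) s t (exp s * k t) (exp s * l).
Proof.
  intros Hk.
  assert (H1 : differentiable_pt_lim (fun p q => a + p * q) (exp s) (k t) (k t) (exp s)).
  { intros eps. exists eps. intros p q Hp Hq.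
    replace (a + p * q - (a + exp s * k t) - (k t * (p - exp s) + exp s * (q - k t))) with ((p - exp s) * (q - k t)) by ring.
    rewrite Rabs_mult. apply Rmult_le_compat; try apply Rabs_pos. lra. apply Rmax_r. }
  assert (H2 : differentiable_pt_lim (fun s _ : R => exp s) s t (exp s) 0).
  { apply differentiable_pt_lim_proj1_0. apply derivable_pt_lim_exp. }
  assert (H3 : differentiable_pt_lim (fun _ t : R => k t) s t 0 l).
  { intros eps. destruct (differentiable_pt_lim_proj1_0 k t s l Hk eps) as [d K].
    exists d. intros p q Hp Hq. specialize (K q p Hq Hp). rewrite Rmax_comm.
    replace (0 * (p - s) + l * (q - t)) with (l * (q - t) + 0 * (p - s)) by ring. exact K. }
  assert (H := differentiable_pt_lim_comp _ _ _ _ _ _ _ _ _ _ _ H1 H2 H3). simpl in H.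
  replace (k t * exp s + exp s * 0) with (exp s * k t) in H by ring.
  replace (k t * 0 + exp s * l) with (exp s * l) in H by ring. exact H.
Qed.

(* In the coordinate s + i t = log (w - z0) the punctured disk becomes a half
   plane, so the mean over |w - z0| = e^s does not depend on s, and it tends to
   g z0 as s -> -oo; differentiability at z0 is not needed. *)
Lemma circle_mean (g : C -> C) (z0 : C) (t t' eta : R) :
  0 < t < t' -> ccont g z0 ->
  (forall w, 0 < Cmod (w - z0)%C < t' -> cdiff g w) -> 0 < eta ->
  ~ (forall w, Cmod (w - z0)%C = t -> Re (g w) <= Re (g z0) - eta).
Proof.
  intros Ht Hc Hd Heta Hle.
  set (P := fun s th : R => ((Re z0 + exp s * cos th, Im z0 + exp s * sin th) : C)).
  assert (HP : forall s th, Cmod (P s th - z0)%C = exp s).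
  { intros s th. unfold Cmod, P. simpl.
    replace ((Re z0 + exp s * cos th + - fst z0) * ((Re z0 + exp s * cos th + - fst z0) * 1) +
      (Im z0 + exp s * sin th + - snd z0) * ((Im z0 + exp s * sin th + - snd z0) * 1))
      with (exp s * exp s).
    apply sqrt_square. left; apply exp_pos.
    unfold Re, Im. replace (exp s * exp s) with (exp s * exp s * (Rsqr (sin th) + Rsqr (cos th))) by (rewrite sin2_cos2; ring).
    unfold Rsqr. ring. }
  set (u := fun s th => Re (g (P s th))). set (v := fun s th => Im (g (P s th))).
  assert (Huv : forall s th, s < ln t' -> exists A B C,
     differentiable_pt_lim u s th A B /\ differentiable_pt_lim v s th C A).
  { intros s th Hs.
    destruct (cdiff_coords g (P s th)) as (a & b & H1 & H2).
    { apply Hd. rewrite HP. split. apply exp_pos. rewrite <- (exp_ln t') by lra. apply exp_increasing; auto. }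
    assert (HX := differentiable_exp_mult (Re z0) cos _ s th (derivable_pt_lim_cos th)).
    assert (HY := differentiable_exp_mult (Im z0) sin _ s th (derivable_pt_lim_sin th)).
    assert (G1 := differentiable_pt_lim_comp _ _ _ _ _ _ _ _ _ _ _ H1 HX HY).
    assert (G2 := differentiable_pt_lim_comp _ _ _ _ _ _ _ _ _ _ _ H2 HX HY).
    eexists _, _, _. split. exact G1.
    (* The equation required by [Huv]: the derivative of u in s is the derivative of v in the
       angle. *)
    replace (a * (exp s * cos th) + - b * (exp s * sin th)) with (b * (exp s * - sin th) + a * (exp s * cos th)) by ring.
    exact G2. }
  destruct (Hc (eta/2) ltac:(lra)) as (d & Hd0 & K).
  (* The inner circle has radius below d, so there Re g exceeds Re (g z0) - eta/2, while on the
     outer circle it is at most Re (g z0) - eta. Equal means are then impossible. *)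
  set (S1 := ln t). set (s := Rmin (S1 - 1) (ln (d/2))).
  assert (HS1 : S1 < ln t') by (apply ln_increasing; lra).
  assert (Hs1 : s < S1) by (unfold s; assert (H := Rmin_l (S1-1) (ln (d/2))); lra).
  assert (Hsd : exp s < d).
  { apply Rle_lt_trans with (exp (ln (d/2))).
    destruct (Rmin_r (S1-1) (ln (d/2))) as [H|H]. left; apply exp_increasing; auto. right. unfold s. rewrite H; auto.
    rewrite exp_ln; lra. }
  assert (HPI := PI_RGT_0).
  assert (Z := bdry_form_zero u v (ln t') Huv s S1 0 (2*PI) Hs1 HS1 ltac:(lra)).
  unfold bdry_form in Z.
  (* Periodicity in the angle makes the two horizontal sides cancel. *)
  rewrite (RInt_ext (fun x => v x (2*PI) - v x 0) (fun _ => 0)) in Z.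
  2:{ intros x _. unfold v, P. rewrite cos_2PI, sin_2PI, cos_0, sin_0. simpl. ring. }
  rewrite RInt_const in Z. unfold scal in Z; simpl in Z; unfold mult in Z; simpl in Z.
  assert (E : RInt (fun y => u S1 y - u s y) 0 (2*PI) <= RInt (fun _ => - (eta/2)) 0 (2*PI)).
  { apply RInt_le. lra.
    - apply (@ex_RInt_minus R_NormedModule (u S1) (u s)); apply (green_ex_RInt_u u v (ln t')); auto; lra.
    - apply ex_RInt_const.
    - intros x _. unfold u.
      assert (Re (g (P S1 x)) <= Re (g z0) - eta). { apply Hle. rewrite HP. apply exp_ln; lra. }
      assert (Rabs (Re (g (P s x) - g z0)%C) < eta/2).
      { eapply Rle_lt_trans. apply re_le_Cmod. apply K. rewrite HP. auto. }
      assert (Re (g (P s x) - g z0)%C = Re (g (P s x)) - Re (g z0)) by reflexivity.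
      rewrite H1 in H0. apply Rabs_def2 in H0. lra. }
  rewrite RInt_const in E. unfold scal in E; simpl in E; unfold mult in E; simpl in E. nra.
Qed.

(** * Compactness of closed disks *)

(** The real theorem is used for the real parts, then for the imaginary parts along the selection
    phi found first. For phi the property k <= phi k suffices to get past any given N. *)
Lemma bolzano_weierstrass_C (u : nat -> C) (M : R) : (forall n, Cmod (u n) <= M) ->
  exists l, forall eps N, 0 < eps -> exists n, (N <= n)%nat /\ Cmod (u n - l)%C < eps.
Proof.
  intros HM.
  destruct (Bolzano_Weierstrass (fun n => Re (u n)) (fun c => -M <= c <= M)) as [x Hx].
  { apply compact_P3. }
  { intros n. apply Rabs_le_between. eapply Rle_trans. apply re_le_Cmod. auto. }
  assert (HN : forall y e, 0 < e -> neighbourhood (fun t => Rabs (t - y) < e) y).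
  { intros y e He. exists (mkposreal _ He). intros t Ht. exact Ht. }
  assert (Hphi : forall k : nat, exists n, (k <= n)%nat /\ Rabs (Re (u n) - x) < / (INR k + 1)).
  { intros k. destruct (Hx (fun t => Rabs (t - x) < / (INR k + 1)) k) as [n Hn]; [|exists n; auto].
    apply HN. apply Rinv_0_lt_compat. assert (H := pos_INR k). lra. }
  assert (exists phi : nat -> nat, forall k, (k <= phi k)%nat /\ Rabs (Re (u (phi k)) - x) < / (INR k + 1)).
  { exists (fun k => proj1_sig (constructive_indefinite_description _ (Hphi k))).
    intros k. exact (proj2_sig (constructive_indefinite_description _ (Hphi k))). }
  destruct H as [phi Hp].
  destruct (Bolzano_Weierstrass (fun n => Im (u (phi n))) (fun c => -M <= c <= M)) as [y Hy].
  { apply compact_P3. }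
  { intros n. apply Rabs_le_between. eapply Rle_trans. 2: apply HM.
    eapply Rle_trans. 2: apply Rmax_Cmod. apply Rmax_r. }
  exists (x, y). intros eps N He.
  destruct (archimed_cor1 (eps/2) ltac:(lra)) as (K & HK & HK0).
  destruct (Hy (fun t => Rabs (t - y) < eps/2) (N + K)%nat) as (k & Hk & Hky).
  { apply HN. lra. }
  exists (phi k). destruct (Hp k) as [Q1 Q2]. split. lia.
  assert (Hx2 : Rabs (Re (u (phi k)) - x) < eps/2).
  { apply Rlt_trans with (1 := Q2). apply Rlt_trans with (2 := HK).
    apply Rinv_lt_contravar.
    - apply Rmult_lt_0_compat. apply lt_0_INR; lia. assert (H := pos_INR k). lra.
    - apply Rle_lt_trans with (INR k). apply le_INR; lia. lra. }
  eapply Rle_lt_trans. apply Cmod_2Rmax.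
  assert (S2 : sqrt 2 < 2). { rewrite <- (sqrt_square 2) at 2 by lra. apply sqrt_lt_1; lra. }
  set (m := Rmax _ _). assert (m < eps/2).
  { apply Rmax_lub_lt; auto. }
  assert (0 <= m). { eapply Rle_trans. 2: apply Rmax_l. apply Rabs_pos. }
  assert (0 <= sqrt 2) by apply sqrt_pos. nra.
Qed.

Lemma disk_max (v : C -> R) (r : R) : 0 <= r ->
  (forall z, Cmod z <= r -> forall eps, 0 < eps -> near z (fun w => Rabs (v w - v z) < eps)) ->
  exists z, Cmod z <= r /\ forall w, Cmod w <= r -> v w <= v z.
Proof.
  intros Hr Hv.
  assert (Acc : forall (u : nat -> C), (forall n, Cmod (u n) <= r) -> exists l, Cmod l <= r /\
     forall eps N, 0 < eps -> exists n, (N <= n)%nat /\ Rabs (v (u n) - v l) < eps).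
  { intros u Hu. destruct (bolzano_weierstrass_C u r Hu) as [l Hl].
    assert (Hlr : Cmod l <= r).
    { apply le_epsilon. intros e He. destruct (Hl e 0%nat He) as (n & _ & Hn).
      replace l with (u n + - (u n - l))%C by ring. eapply Rle_trans. apply Cmod_triangle.
      rewrite Cmod_opp. specialize (Hu n). lra. }
    exists l. split; auto. intros eps N He. destruct (Hv l Hlr eps He) as (d & Hd & K).
    destruct (Hl d N Hd) as (n & Hn & Hn'). exists n. auto. }
  assert (Hb : bound (fun y => exists z, Cmod z <= r /\ y = v z)).
  { apply NNPP. intros Hnb.
    assert (forall n : nat, exists z, Cmod z <= r /\ INR n < v z).
    { intros n. apply NNPP. intros H. apply Hnb. exists (INR n). intros y (z & Hz & ->).
      apply Rnot_lt_le. intros H'. apply H. eauto. }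
    destruct (Acc (fun n => proj1_sig (constructive_indefinite_description _ (H n)))) as (l & Hl & Hl2).
    { intros n. apply (proj2_sig (constructive_indefinite_description _ (H n))). }
    destruct (INR_archimed 1 (v l + 1) ltac:(lra)) as [N HN].
    destruct (Hl2 1 N ltac:(lra)) as (n & Hn & Hn').
    assert (Hn2 := proj2 (proj2_sig (constructive_indefinite_description _ (H n)))). simpl in Hn2.
    apply Rabs_def2 in Hn'. apply le_INR in Hn. lra. }
  destruct (completeness _ Hb) as [m [Hm1 Hm2]].
  { exists (v 0), 0. rewrite Cmod_0. auto. }
  assert (forall n : nat, exists z, Cmod z <= r /\ m - / (INR n + 1) < v z).
  { intros n. assert (Hi : 0 < / (INR n + 1)). { apply Rinv_0_lt_compat. assert (H := pos_INR n). lra. }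
    apply NNPP. intros H. assert (m <= m - / (INR n + 1)). 2: lra.
    apply Hm2. intros y (z & Hz & ->). apply Rnot_lt_le. intros H'. apply H. eauto. }
  destruct (Acc (fun n => proj1_sig (constructive_indefinite_description _ (H n)))) as (l & Hl & Hl2).
  { intros n. apply (proj2_sig (constructive_indefinite_description _ (H n))). }
  exists l. split; auto. intros w Hw.
  apply Rle_trans with m. apply Hm1. eauto.
  apply le_epsilon. intros e He.
  destruct (archimed_cor1 (e/2) ltac:(lra)) as (K & HK & HK0).
  destruct (Hl2 (e/2) K ltac:(lra)) as (n & Hn & Hn').
  assert (Hn2 := proj2 (proj2_sig (constructive_indefinite_description _ (H n)))). simpl in Hn2.
  assert (/ (INR n + 1) < / INR K).
  { apply Rinv_lt_contravar.
    - apply Rmult_lt_0_compat. apply lt_0_INR; lia. assert (H' := pos_INR n). lra.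
    - apply Rle_lt_trans with (INR n). apply le_INR; lia. lra. }
  apply Rabs_def2 in Hn'. lra.
Qed.

(** * Schwarz-Pick lemmas *)

Lemma Cmod_sq z : Cmod z * Cmod z = Re z * Re z + Im z * Im z.
Proof. assert (H := Cmod2_alt z). nra. Qed.
Lemma Cmod_le_sq x y : Re x * Re x + Im x * Im x <= Re y * Re y + Im y * Im y -> Cmod x <= Cmod y.
Proof.
  rewrite <- !Cmod_sq. intros H. assert (H2 := Cmod_ge_0 y). nra.
Qed.

Lemma Cmod_minus_sym x y : Cmod (x - y)%C = Cmod (y - x)%C.
Proof. rewrite <- Cmod_opp. f_equal. ring. Qed.
Lemma Cmod_minus_ge x y : Cmod x - Cmod y <= Cmod (x - y)%C.
Proof.
  assert (H := Cmod_triangle (x - y) y). replace (x - y + y)%C with x in H by ring. lra.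
Qed.

Lemma Cmod_minus_le x y : Cmod (x - y)%C <= Cmod x + Cmod y.
Proof. unfold Cminus. rewrite <- (Cmod_opp y). apply Cmod_triangle. Qed.
Lemma Cminus_neq_0 (x y : C) : x <> y -> (x - y)%C <> 0.
Proof. intros H E. apply H. replace x with (x - y + y)%C by ring. rewrite E. ring. Qed.
Lemma Cmod_Re_le z : Re z <= Cmod z.
Proof. eapply Rle_trans. apply Rle_abs. apply re_le_Cmod. Qed.
Lemma ccont_Cmod g z : ccont g z -> ccont (fun w => RtoC (Cmod (g w))) z.
Proof.
  intros Hg eps He. generalize (Hg eps He). apply near_imp. intros w Hw.
  rewrite <- RtoC_minus, Cmod_R.
  assert (H1 := Cmod_minus_ge (g w) (g z)). assert (H2 := Cmod_minus_ge (g z) (g w)).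
  rewrite (Cmod_minus_sym (g z)) in H2. apply Rabs_def1; lra.
Qed.

(* Continuity at z and differentiability in a punctured neighbourhood: by
   Riemann's theorem this is holomorphy near z, but that is never needed. *)
Definition punctured_holo (g : C -> C) (z : C) : Prop :=
  ccont g z /\ near z (fun w => w <> z -> cdiff g w).

(** Injectivity of g near z keeps the image of a punctured neighbourhood away from g z, so that f is
    differentiable there. *)
Lemma punctured_holo_comp f g z :
  near z (cdiff g) -> near z (fun w => w <> z -> g w <> g z) ->
  punctured_holo f (g z) -> punctured_holo (fun w => f (g w)) z.
Proof.
  intros Hd Hi (Hc & d & Hd0 & K).
  assert (Hg := cdiff_ccont _ _ (near_self _ _ Hd)).
  split. apply ccont_comp; auto.
  generalize (near_and _ _ _ Hd (near_and _ _ _ Hi (Hg d Hd0))). apply near_imp.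
  intros w (H1 & H2 & H3) Hw. apply (cdiff_comp f g); auto.
Qed.

(** The term eps |w|^2 excludes an interior maximum point z of v = |g|^2 + eps |w|^2. Indeed, for
    h(w) = conj(g z) g(w) + eps conj(z) w, twice Re (h w) is at most v z + v w - eps |w - z|^2, so
    on a whole circle of radius t around z the value of Re h would be below Re (h z) by eps t^2 / 2,
    against [circle_mean]. Then eps tends to 0. *)
Lemma max_principle (g : C -> C) (r K : R) :
  0 < r -> (forall z, Cmod z <= r -> ccont g z) ->
  (forall z, Cmod z < r -> punctured_holo g z) ->
  (forall z, Cmod z = r -> Cmod (g z) <= K) ->
  forall z, Cmod z <= r -> Cmod (g z) <= K.
Proof.
  intros Hr Hc Hp HK.
  assert (HK0 : 0 <= K).
  { eapply Rle_trans. apply Cmod_ge_0. apply (HK r). rewrite Cmod_R. apply Rabs_pos_eq; lra. }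
  assert (Main : forall eps, 0 < eps -> forall z, Cmod z <= r -> Cmod (g z) * Cmod (g z) <= K * K + eps * (r * r)).
  { intros eps He.
    set (v := fun z => Cmod (g z) * Cmod (g z) + eps * (Cmod z * Cmod z)).
    destruct (disk_max v r) as (z & Hz & Hmax). lra.
    { intros z Hz e He'.
      assert (H : ccont (fun w => RtoC (v w)) z).
      { apply (ccont_near_eq (fun w => RtoC (Cmod (g w)) * RtoC (Cmod (g w)) + RtoC eps * (RtoC (Cmod w) * RtoC (Cmod w)))%C).
        - exists 1. split. lra. intros w _. unfold v. rewrite RtoC_plus, !RtoC_mult. ring.
        - assert (H1 := ccont_Cmod g z (Hc z Hz)). assert (H2 := ccont_Cmod (fun w => w) z (ccont_id z)).
          apply ccont_plus; apply ccont_mult; auto. apply ccont_const. apply ccont_mult; auto. }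
      generalize (H e He'). apply near_imp. intros w Hw. rewrite <- RtoC_minus, Cmod_R in Hw. auto. }
    destruct (Rle_lt_or_eq_dec _ _ Hz) as [Hlt|Heq].
    - exfalso. destruct (Hp z Hlt) as [Hcz (d & Hd & Hdiff)].
      set (t := Rmin (d/2) ((r - Cmod z) / 2)).
      assert (Ht1 := Rmin_l (d/2) ((r - Cmod z) / 2)). assert (Ht2 := Rmin_r (d/2) ((r - Cmod z) / 2)). fold t in Ht1, Ht2.
      assert (Ht : 0 < t) by (apply Rmin_pos; lra).
      set (h := fun w => (Cconj (g z) * g w + RtoC eps * Cconj z * w)%C).
      assert (Hh : forall w, cdiff g w -> cdiff h w).
      { intros w Hw. apply cdiff_plus; apply cdiff_mult; auto; try apply cdiff_const. apply cdiff_id. }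
      assert (Het : 0 < eps * (t * t)) by (apply Rmult_lt_0_compat; nra).
      apply (circle_mean h z t d (eps * (t * t) / 2)); [lra| | |lra|].
      + apply ccont_plus; apply ccont_mult; auto; try apply ccont_const. apply ccont_id.
      + intros w [Hw1 Hw2]. apply Hh. apply Hdiff; auto. intros ->.
        replace (z - z)%C with (RtoC 0) in Hw1 by ring. rewrite Cmod_0 in Hw1. lra.
      + intros w Hw.
        assert (Hwr : Cmod w <= r). { assert (H := Cmod_minus_ge w z). lra. }
        assert (Hm := Hmax w Hwr). unfold v in Hm.
        assert (Hsq := Cmod_sq (w - z)%C). rewrite Hw in Hsq.
        apply (f_equal (Rmult eps)) in Hsq.
        rewrite !Cmod_sq in Hm. unfold h.
        destruct w as [w1 w2]. destruct z as [z1 z2]. destruct (g (w1,w2)) as [a1 a2]. destruct (g (z1,z2)) as [b1 b2].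
        C_coords_all.
        assert (0 <= (a1 - b1) * (a1 - b1) + (a2-b2) * (a2-b2)).
        { apply Rplus_le_le_0_compat; [apply (Rle_0_sqr (a1-b1))|apply (Rle_0_sqr (a2-b2))]. }
        lra.
    - intros w Hw. assert (H := Hmax w Hw). unfold v in H. rewrite Heq in H.
      assert (H1 := HK z Heq). assert (H2 := Cmod_ge_0 (g z)). nra. }
  intros z Hz.
  assert (Cmod (g z) * Cmod (g z) <= K * K).
  { apply le_epsilon. intros e He. assert (H := Main (e / (r * r)) ltac:(apply Rdiv_lt_0_compat; nra) z Hz).
    replace (e / (r*r) * (r*r)) with e in H by (field; lra). lra. }
  assert (H1 := Cmod_ge_0 (g z)). nra.
Qed.

(** The maximum principle for f(w) / w on disks of radius r, with r tending to 1. Differentiability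
    at 0 supplies the continuous value of the quotient there; at other points [punctured_holo] is
    enough, so functions with a patched value are covered. *)
Lemma schwarz (f : C -> C) :
  (forall z, Cmod z < 1 -> punctured_holo f z) -> cdiff f 0 -> f 0 = 0 ->
  (forall z, Cmod z < 1 -> Cmod (f z) <= 1) ->
  forall z, Cmod z < 1 -> Cmod (f z) <= Cmod z.
Proof.
  intros Hp (Q & HQ & HE) H0 H1.
  set (q := fun w : C => if excluded_middle_informative (w = 0) then Q 0 else (f w / w)%C).
  assert (Hqn : forall z : C, z <> 0 -> near z (fun w => (f w / w)%C = q w)).
  { intros z Hz. generalize (near_nonzero (fun w => w) z (ccont_id z) Hz). apply near_imp.
    intros w [_ Hw]. unfold q. destruct (excluded_middle_informative (w = 0)); congruence. }
  assert (Hq0 : near 0 (fun w => Q w = q w)).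
  { revert HE. apply near_imp. intros w Hw. unfold q.
    destruct (excluded_middle_informative (w = 0)) as [->|Hne]; auto. rewrite Hw, H0. field; auto. }
  assert (Hq : forall z, Cmod z < 1 -> punctured_holo q z).
  { intros z Hz. destruct (Hp z Hz) as [Hc Hd]. destruct (excluded_middle_informative (z = 0)) as [->|Hne].
    - split. apply (ccont_near_eq Q); auto.
      revert Hd. apply near_imp. intros w Hw Hw0. apply (cdiff_near_eq (fun w => f w / w)%C); auto.
      apply cdiff_div; auto. apply cdiff_id.
    - split. apply (ccont_near_eq (fun w => f w / w)%C); auto. apply ccont_div; auto. apply ccont_id.
      generalize (near_and _ _ _ Hd (near_nonzero (fun w => w) z (ccont_id z) Hne)). apply near_imp.
      intros w (H2 & _ & H3) Hw. apply (cdiff_near_eq (fun w => f w / w)%C); auto. apply cdiff_div; auto. apply cdiff_id. }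
  assert (Hb : forall r, 0 < r < 1 -> forall z, Cmod z <= r -> Cmod (q z) <= / r).
  { intros r Hr. apply max_principle; [lra| | |].
    - intros z Hz. apply Hq. lra.
    - intros z Hz. apply Hq. lra.
    - intros z Hz. assert (Hne : z <> 0). { intros ->. rewrite Cmod_0 in Hz. lra. }
      rewrite <- (near_self _ _ (Hqn z Hne)). rewrite Cmod_div by auto. rewrite Hz.
      unfold Rdiv. assert (Hi : 0 < / r) by (apply Rinv_0_lt_compat; lra).
      assert (H := H1 z ltac:(lra)). nra. }
  intros z Hz. destruct (excluded_middle_informative (z = 0)) as [->|Hne].
  { rewrite H0. lra. }
  assert (Hz0 : 0 < Cmod z) by (apply Cmod_gt_0; auto).
  apply Rnot_lt_le. intros Hlt.
  set (s := Cmod (f z) / Cmod z).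
  assert (Hs : 1 < s). { apply Rmult_lt_reg_r with (Cmod z); auto. unfold s. field_simplify; lra. }
  assert (Hsi : / s < 1). { rewrite <- Rinv_1. apply Rinv_lt_contravar; lra. }
  assert (Hsi0 : 0 < / s) by (apply Rinv_0_lt_compat; lra).
  (* This r is at least |z| and exceeds 1/s, so the bound 1/r at z contradicts |f z| / |z| = s. *)
  set (r := Rmax (Cmod z) ((1 + / s) / 2)).
  assert (Hr1 := Rmax_l (Cmod z) ((1 + / s) / 2)). assert (Hr2 := Rmax_r (Cmod z) ((1 + / s) / 2)). fold r in Hr1, Hr2.
  assert (Hr3 : r < 1) by (apply Rmax_lub_lt; lra).
  assert (H := Hb r ltac:(lra) z Hr1).
  rewrite <- (near_self _ _ (Hqn z Hne)), Cmod_div in H by auto. fold s in H.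
  assert (/ r < s). { rewrite <- (Rinv_inv s). apply Rinv_lt_contravar. nra. lra. }
  lra.
Qed.

Lemma disk_denominator (a b : C) : Cmod a <= 1 -> Cmod b < 1 -> (1 - Cconj a * b)%C <> 0.
Proof.
  intros Ha Hb H. assert (E : (Cconj a * b)%C = 1).
  { replace (Cconj a * b)%C with (1 - (1 - Cconj a * b))%C by ring. rewrite H. ring. }
  apply (f_equal Cmod) in E. rewrite Cmod_mult, Cmod_conj, Cmod_1 in E.
  assert (H2 := Cmod_ge_0 b). nra.
Qed.

Lemma Cconj_denominator (a b : C) : Cmod (1 - Cconj a * b)%C = Cmod (1 - Cconj b * a)%C.
Proof.
  rewrite <- Cmod_conj. f_equal. destruct a, b. C_coords. f_equal; ring.
Qed.

Lemma disk_ratio_le (a b : C) : Cmod a <= 1 -> Cmod b <= 1 ->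
  Cmod (b - a)%C <= Cmod (1 - Cconj a * b)%C.
Proof.
  intros Ha Hb.
  assert (H1 := Cmod_sq a). assert (H2 := Cmod_sq b).
  assert (P1 := Cmod_ge_0 a). assert (P2 := Cmod_ge_0 b).
  assert (G1 : Cmod a * Cmod a <= 1) by nra. assert (G2 : Cmod b * Cmod b <= 1) by nra.
  rewrite H1 in G1. rewrite H2 in G2.
  apply Cmod_le_sq. destruct a as [a1 a2], b as [b1 b2]; C_coords_all. nra.
Qed.

Lemma disk_ratio_lt (a b : C) : Cmod a < 1 -> Cmod b < 1 ->
  Cmod ((b - a) / (1 - Cconj a * b))%C < 1.
Proof.
  intros Ha Hb. assert (Hne := disk_denominator a b ltac:(lra) Hb).
  rewrite Cmod_div by auto.
  assert (Hp : 0 < Cmod (1 - Cconj a * b)%C) by (apply Cmod_gt_0; auto).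
  apply Rmult_lt_reg_r with (1 := Hp). unfold Rdiv. rewrite Rmult_assoc, Rinv_l, Rmult_1_l, Rmult_1_r by lra.
  assert (H1 := Cmod_sq a). assert (H2 := Cmod_sq b).
  assert (P1 := Cmod_ge_0 a). assert (P2 := Cmod_ge_0 b).
  assert (G1 : Cmod a * Cmod a < 1) by nra. assert (G2 : Cmod b * Cmod b < 1) by nra.
  rewrite H1 in G1. rewrite H2 in G2.
  assert (Cmod (b - a)%C * Cmod (b - a)%C < Cmod (1 - Cconj a * b)%C * Cmod (1 - Cconj a * b)%C).
  { rewrite !Cmod_sq. destruct a as [a1 a2], b as [b1 b2]; C_coords_all. nra. }
  nra.
Qed.

Lemma cdiff_mobius a z : Cmod a < 1 -> Cmod z < 1 ->
  cdiff (fun u => (u + a) / (1 + Cconj a * u))%C z.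
Proof.
  intros Ha Hz. apply cdiff_div.
  - apply cdiff_plus. apply cdiff_id. apply cdiff_const.
  - apply cdiff_plus. apply cdiff_const. apply cdiff_mult. apply cdiff_const. apply cdiff_id.
  - assert (H := disk_denominator (-a)%C z). rewrite Cmod_opp in H.
    replace (1 + Cconj a * z)%C with (1 - Cconj (- a) * z)%C. apply H; lra.
    destruct a, z. C_coords. f_equal; ring.
Qed.

Lemma near_disk z : Cmod z < 1 -> near z (fun w => Cmod w < 1).
Proof.
  intros Hz. exists (1 - Cmod z). split. lra. intros w Hw. assert (H := Cmod_minus_ge w z). lra.
Qed.

(** Schwarz's lemma for the composite of m, f and T, where the disk automorphisms m and T send 0 to
    a and f a to 0. The hypothesis |f a| < 1 keeps the denominator of T away from 0 on the closed
    disk, where f takes its values. *)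
Lemma schwarz_pick_strict (f : C -> C) (a : C) :
  (forall z, Cmod z < 1 -> punctured_holo f z) ->
  (forall z, Cmod z < 1 -> Cmod (f z) <= 1) ->
  Cmod a < 1 -> cdiff f a -> Cmod (f a) < 1 ->
  forall z, Cmod z < 1 ->
  Cmod (f z - f a)%C * Cmod (1 - Cconj a * z)%C <= Cmod (z - a)%C * Cmod (1 - Cconj (f a) * f z)%C.
Proof.
  intros Hp H1 Ha Hda Hfa z Hz.
  set (m := fun u => ((u + a) / (1 + Cconj a * u))%C).
  set (c := f a). fold c in Hfa.
  set (T := fun v => ((v - c) / (1 - Cconj c * v))%C).
  assert (Dm : forall u, Cmod u < 1 -> (1 + Cconj a * u)%C <> 0).
  { intros u Hu. assert (H := disk_denominator (-a)%C u). rewrite Cmod_opp in H.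
    replace (1 + Cconj a * u)%C with (1 - Cconj (- a) * u)%C. apply H; lra.
    destruct a, u. C_coords. f_equal; ring. }
  assert (Hm : forall u, Cmod u < 1 -> Cmod (m u) < 1).
  { intros u Hu. unfold m. replace ((u + a) / (1 + Cconj a * u))%C with ((u - (-a)) / (1 - Cconj (- a) * u))%C.
    apply disk_ratio_lt; auto. rewrite Cmod_opp; auto.
    f_equal. ring. destruct a, u. C_coords. f_equal; ring. }
  assert (Em : m 0 = a). { unfold m. field. }
  assert (Hc2 : (1 - Cconj a * a)%C <> 0) by (apply disk_denominator; lra).
  assert (DT : forall v, Cmod v <= 1 -> (1 - Cconj c * v)%C <> 0).
  { intros v Hv H. apply (disk_denominator v c); auto. apply Cmod_eq_0.
    rewrite Cconj_denominator, H. apply Cmod_0. }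
  assert (cT : forall v, Cmod v <= 1 -> cdiff T v).
  { intros v Hv. apply cdiff_div; auto. apply cdiff_minus. apply cdiff_id. apply cdiff_const.
    apply cdiff_minus. apply cdiff_const. apply cdiff_mult. apply cdiff_const. apply cdiff_id. }
  assert (Hinj : forall u w, Cmod u < 1 -> Cmod w < 1 -> m u = m w -> u = w).
  { intros u w Hu Hw H.
    assert (E : (m u - m w = (u - w) * (1 - Cconj a * a) / ((1 + Cconj a * u) * (1 + Cconj a * w)))%C).
    { unfold m. field. split; apply Dm; auto. }
    apply NNPP. intros Hne. apply (Cmult_neq_0 ((u - w) * (1 - Cconj a * a))%C (/ ((1 + Cconj a * u) * (1 + Cconj a * w)))%C).
    - apply Cmult_neq_0; auto. apply Cminus_neq_0; auto.
    - intros H'. assert (Hne2 : ((1 + Cconj a * u) * (1 + Cconj a * w))%C <> 0) by (apply Cmult_neq_0; apply Dm; auto).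
      apply C1_nz. rewrite <- (Cinv_r _ Hne2), H'. ring.
    - change ((u - w) * (1 - Cconj a * a) / ((1 + Cconj a * u) * (1 + Cconj a * w)) = 0)%C. rewrite <- E, H. ring. }
  assert (HS : forall u, Cmod u < 1 -> Cmod (T (f (m u))) <= Cmod u).
  { apply (schwarz (fun u => T (f (m u)))).
    - intros u Hu.
      assert (Hfm : punctured_holo (fun u => f (m u)) u).
      { apply (punctured_holo_comp f m).
        - generalize (near_disk u Hu). apply near_imp. intros w Hw. apply cdiff_mobius; auto.
        - generalize (near_disk u Hu). apply near_imp. intros w Hw Hne H. apply Hne. apply Hinj; auto.
        - apply Hp. auto. }
      destruct Hfm as [Hc Hd]. split.
      + apply (ccont_comp T (fun u => f (m u))); auto. apply cdiff_ccont. auto.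
      + generalize (near_and _ _ _ Hd (near_disk u Hu)). apply near_imp. intros w [Hw Hw1] Hne.
        apply (cdiff_comp T (fun u => f (m u))); auto.
    - apply (cdiff_comp T (fun u => f (m u))).
      + apply (cdiff_comp f m). apply cdiff_mobius; auto. rewrite Cmod_0; lra. rewrite Em. auto.
      + apply cT. apply H1. apply Hm. rewrite Cmod_0; lra.
    - rewrite Em. unfold T. fold c. replace (c - c)%C with (RtoC 0) by ring. unfold Cdiv. ring.
    - intros u Hu. assert (Hu1 := H1 (m u) (Hm u Hu)).
      unfold T. rewrite Cmod_div by auto.
      assert (Hp0 : 0 < Cmod (1 - Cconj c * f (m u))%C) by (apply Cmod_gt_0; auto).
      apply Rmult_le_reg_r with (1 := Hp0). unfold Rdiv. rewrite Rmult_assoc, Rinv_l, Rmult_1_l, Rmult_1_r by lra.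
      apply disk_ratio_le; lra. }
  set (u := ((z - a) / (1 - Cconj a * z))%C).
  assert (Hu : Cmod u < 1) by (apply disk_ratio_lt; auto).
  assert (Hd := disk_denominator a z ltac:(lra) Hz).
  assert (Emu : m u = z).
  { unfold m, u. field. split; auto.
    replace (1 - Cconj a * z + Cconj a * (z - a))%C with (1 - Cconj a * a)%C by ring. auto. }
  assert (H := HS u Hu). rewrite Emu in H. unfold T, u in H.
  rewrite !Cmod_div in H by auto.
  assert (P1 : 0 < Cmod (1 - Cconj c * f z)%C) by (apply Cmod_gt_0; auto).
  assert (P2 : 0 < Cmod (1 - Cconj a * z)%C) by (apply Cmod_gt_0; auto).
  apply Rmult_le_compat_r with (r := Cmod (1 - Cconj c * f z)%C * Cmod (1 - Cconj a * z)%C) in H; [|nra].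
  field_simplify in H; lra.
Qed.

(** For |f a| = 1 the automorphism T of the strict case degenerates. That case is applied to s f
    instead, and s tends to 1; the loss 4 (1 - s) comes from |z - a| <= 2 and 1 - s^2 <= 2 (1 -
    s). *)
Lemma schwarz_pick_disk (f : C -> C) (a : C) :
  (forall z, Cmod z < 1 -> punctured_holo f z) ->
  (forall z, Cmod z < 1 -> Cmod (f z) <= 1) ->
  Cmod a < 1 -> cdiff f a ->
  forall z, Cmod z < 1 ->
  Cmod (f z - f a)%C * Cmod (1 - Cconj a * z)%C <= Cmod (z - a)%C * Cmod (1 - Cconj (f a) * f z)%C.
Proof.
  intros Hp H1 Ha Hda z Hz.
  set (X := Cmod (f z - f a)%C * Cmod (1 - Cconj a * z)%C).
  set (Y := Cmod (z - a)%C * Cmod (1 - Cconj (f a) * f z)%C).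
  assert (HX : 0 <= X) by (apply Rmult_le_pos; apply Cmod_ge_0).
  assert (Hs : forall s, 0 < s < 1 -> s * X <= Y + 4 * (1 - s)).
  { intros s Hs.
    assert (Hsm : forall z, Cmod (RtoC s * f z)%C = s * Cmod (f z)).
    { intros w. rewrite Cmod_mult, Cmod_R, Rabs_pos_eq; lra. }
    assert (H := schwarz_pick_strict (fun z => RtoC s * f z)%C a).
    assert (Hfa := H1 a Ha). assert (Hfz := H1 z Hz).
    assert (P1 := Cmod_ge_0 (f a)). assert (P2 := Cmod_ge_0 (f z)).
    assert (G : Cmod (RtoC s * f z - RtoC s * f a)%C * Cmod (1 - Cconj a * z)%C <= Cmod (z - a)%C * Cmod (1 - Cconj (RtoC s * f a) * (RtoC s * f z))%C).
    { apply H; auto.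
      - intros w Hw. destruct (Hp w Hw) as [Hc Hd]. split. apply ccont_mult; auto. apply ccont_const.
        revert Hd. apply near_imp. intros x Hx Hne. apply cdiff_mult; auto. apply cdiff_const.
      - intros w Hw. rewrite Hsm. assert (H2 := H1 w Hw). nra.
      - apply cdiff_mult; auto. apply cdiff_const.
      - rewrite Hsm. nra. }
    replace (RtoC s * f z - RtoC s * f a)%C with (RtoC s * (f z - f a))%C in G by ring.
    rewrite Cmod_mult, Cmod_R, (Rabs_pos_eq s) in G by lra.
    replace (1 - Cconj (RtoC s * f a) * (RtoC s * f z))%C with ((1 - Cconj (f a) * f z) + RtoC (1 - s * s) * (Cconj (f a) * f z))%C in G.
    2:{ destruct (f a), (f z). C_coords. f_equal; ring. }
    assert (T := Cmod_triangle (1 - Cconj (f a) * f z) (RtoC (1 - s * s) * (Cconj (f a) * f z))).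
    rewrite !Cmod_mult, Cmod_conj, Cmod_R, (Rabs_pos_eq (1 - s*s)) in T by nra.
    assert (Q2 : (1 - s*s) * (Cmod (f a) * Cmod (f z)) <= 2 * (1 - s)).
    { apply Rle_trans with ((1 - s*s) * 1); [apply Rmult_le_compat_l; nra|nra]. }
    assert (Z := Cmod_minus_le z a). assert (Z0 := Cmod_ge_0 (z - a)%C).
    unfold X, Y. rewrite <- Rmult_assoc.
    eapply Rle_trans. exact G.
    eapply Rle_trans. apply Rmult_le_compat_l. auto. apply T.
    rewrite Rmult_plus_distr_l. apply Rplus_le_compat_l.
    apply Rle_trans with (2 * (2 * (1 - s))); [|lra].
    apply Rmult_le_compat; [auto| |lra|auto].
    apply Rmult_le_pos. nra. apply Rmult_le_pos; auto. }
  apply le_epsilon. intros e He.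
  set (d := Rmin (1/2) (e / (X + 4))).
  assert (Hd1 := Rmin_l (1/2) (e / (X + 4))). assert (Hd2 := Rmin_r (1/2) (e / (X + 4))). fold d in Hd1, Hd2.
  assert (Hd : 0 < d). { apply Rmin_pos. lra. apply Rdiv_lt_0_compat; lra. }
  assert (H := Hs (1 - d) ltac:(lra)).
  apply Rmult_le_compat_r with (r := X + 4) in Hd2; [|lra].
  replace (e / (X+4) * (X+4)) with e in Hd2 by (field; lra). nra.
Qed.

(** * The right half plane and the Cayley transform *)

Lemma Cmod_half_pos a b : 0 < Re a -> 0 < Re b -> 0 < Cmod (a + Cconj b)%C.
Proof.
  intros Ha Hb. assert (H := Cmod_Re_le (a + Cconj b)%C).
  destruct a, b; C_coords_all. lra.
Qed.

Lemma half_neq_0 a : 0 < Re a -> a <> 0.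
Proof. intros H ->. unfold Re in H; simpl in H. lra. Qed.
Lemma half_plus_neq_0 a b : 0 < Re a -> 0 < Re b -> (a + Cconj b)%C <> 0.
Proof. intros Ha Hb. apply Cmod_gt_0. apply Cmod_half_pos; auto. Qed.
Lemma half_plus1 a : 0 < Re a -> (a + 1)%C <> 0.
Proof.
  intros Ha. apply half_neq_0. destruct a; C_coords_all. lra.
Qed.

Lemma Cmod_lt_sq x y : Re x * Re x + Im x * Im x < Re y * Re y + Im y * Im y -> Cmod x < Cmod y.
Proof.
  rewrite <- !Cmod_sq. intros H. assert (H2 := Cmod_ge_0 y). nra.
Qed.

Lemma half_to_disk a : 0 < Re a -> Cmod ((a - 1) / (a + 1))%C < 1.
Proof.
  intros Ha. assert (Hn := half_plus1 a Ha). rewrite Cmod_div by auto.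
  assert (Hp : 0 < Cmod (a + 1)%C) by (apply Cmod_gt_0; auto).
  apply Rmult_lt_reg_r with (1 := Hp). unfold Rdiv. rewrite Rmult_assoc, Rinv_l, Rmult_1_l, Rmult_1_r by lra.
  apply Cmod_lt_sq. destruct a; C_coords_all. nra.
Qed.

(** Invariance of the pseudo-hyperbolic distance, which is |a - b| / |a + conj b| in the half plane,
    with the denominators cleared. *)
Lemma half_cayley a b : 0 < Re a -> 0 < Re b ->
  Cmod ((a - 1) / (a + 1) - (b - 1) / (b + 1))%C * Cmod (a + Cconj b)%C =
  Cmod (a - b)%C * Cmod (1 - Cconj ((b - 1) / (b + 1)) * ((a - 1) / (a + 1)))%C.
Proof.
  intros Ha Hb. assert (Hna := half_plus1 a Ha). assert (Hnb := half_plus1 b Hb).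
  assert (Hnc : (Cconj b + 1)%C <> 0).
  { apply half_plus1. destruct b; C_coords_all; lra. }
  assert (Ec : Cconj ((b - 1) / (b + 1)) = ((Cconj b - 1) / (Cconj b + 1))%C).
  { rewrite Cdiv_conj by auto. f_equal; destruct b; C_coords; f_equal; ring. }
  assert (Em : Cmod (Cconj b + 1)%C = Cmod (b + 1)%C).
  { rewrite <- (Cmod_conj (b+1)%C). f_equal. destruct b; C_coords; f_equal; ring. }
  rewrite Ec.
  replace ((a - 1) / (a + 1) - (b - 1) / (b + 1))%C with (2 * (a - b) / ((a + 1) * (b + 1)))%C by (field; auto).
  replace (1 - (Cconj b - 1) / (Cconj b + 1) * ((a - 1) / (a + 1)))%C with (2 * (a + Cconj b) / ((a + 1) * (Cconj b + 1)))%C by (field; auto).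
  rewrite !Cmod_div, !Cmod_mult by (apply Cmult_neq_0; auto). rewrite Em.
  assert (0 < Cmod (a+1)%C) by (apply Cmod_gt_0; auto). assert (0 < Cmod (b+1)%C) by (apply Cmod_gt_0; auto).
  field. lra.
Qed.

Lemma half_cayley_pos a b : 0 < Re a -> 0 < Re b ->
  0 < Cmod (1 - Cconj ((b - 1) / (b + 1)) * ((a - 1) / (a + 1)))%C.
Proof.
  intros Ha Hb. apply Cmod_gt_0. apply disk_denominator. left. apply half_to_disk; auto. apply half_to_disk; auto.
Qed.

Lemma cdiff_to_disk f z : cdiff f z -> 0 < Re (f z) -> cdiff (fun w => (f w - 1) / (f w + 1))%C z.
Proof.
  intros Hf Hz. apply cdiff_div. apply cdiff_minus; auto. apply cdiff_const.
  apply cdiff_plus; auto. apply cdiff_const. apply half_plus1; auto.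
Qed.

Lemma schwarz_pick_disk_half (g : C -> C) :
  (forall z, Cmod z < 1 -> cdiff g z) -> (forall z, Cmod z < 1 -> 0 < Re (g z)) ->
  forall u v, Cmod u < 1 -> Cmod v < 1 ->
  Cmod (g u - g v)%C * Cmod (1 - Cconj v * u)%C <= Cmod (u - v)%C * Cmod (g u + Cconj (g v))%C.
Proof.
  intros Hd Hg u v Hu Hv.
  assert (H := schwarz_pick_disk (fun z => (g z - 1) / (g z + 1))%C v).
  assert (G := half_cayley (g u) (g v) (Hg u Hu) (Hg v Hv)).
  assert (P := half_cayley_pos (g u) (g v) (Hg u Hu) (Hg v Hv)).
  assert (P2 := Cmod_half_pos (g u) (g v) (Hg u Hu) (Hg v Hv)).
  assert (H' : forall z, Cmod z < 1 -> cdiff (fun z => (g z - 1) / (g z + 1))%C z).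
  { intros z Hz. apply cdiff_to_disk; auto. }
  specialize (H ltac:(intros z Hz; split; [apply cdiff_ccont; auto|generalize (near_disk z Hz); apply near_imp; auto])
    ltac:(intros z Hz; left; apply half_to_disk; auto) Hv (H' v Hv) u Hu). simpl in H.
  apply Rmult_le_reg_r with (1 := P).
  apply Rmult_le_compat_r with (r := Cmod (g u + Cconj (g v))%C) in H; [|lra].
  replace (Cmod (g u - g v)%C * Cmod (1 - Cconj v * u)%C * Cmod (1 - Cconj ((g v - 1) / (g v + 1)) * ((g u - 1) / (g u + 1)))%C)
   with ((Cmod (g u - g v)%C * Cmod (1 - Cconj ((g v - 1) / (g v + 1)) * ((g u - 1) / (g u + 1)))%C) * Cmod (1 - Cconj v * u)%C) by ring.
  rewrite <- G. lra.
Qed.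

Definition to_half (z : C) : C := ((1 + z) / (1 - z))%C.

Lemma one_minus_neq_0 z : Cmod z < 1 -> (1 - z)%C <> 0.
Proof.
  intros Hz. apply Cminus_neq_0. intros E. rewrite <- E, Cmod_1 in Hz. lra.
Qed.

Lemma to_half_pos z : Cmod z < 1 -> 0 < Re (to_half z).
Proof.
  intros Hz. assert (Hn := one_minus_neq_0 z Hz). assert (H := Cmod_sq z). assert (H0 := Cmod_ge_0 z).
  assert (H1 : Cmod z * Cmod z < 1) by nra. rewrite H in H1.
  assert (H2 : 0 < Cmod (1 - z)%C * Cmod (1 - z)%C). { apply Cmod_gt_0 in Hn. nra. }
  rewrite Cmod_sq in H2. unfold to_half.
  destruct z as [x y]. C_coords_all.
  match goal with |- 0 < ?e => replace e with ((1 - (x * x + y * y)) / ((1 + - x) * (1 + - x) + (0 + - y) * (0 + - y))) end.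
  apply Rdiv_lt_0_compat; lra. field; lra.
Qed.

Lemma cdiff_to_half z : Cmod z < 1 -> cdiff to_half z.
Proof.
  intros Hz. apply cdiff_div. apply cdiff_plus. apply cdiff_const. apply cdiff_id.
  apply cdiff_minus. apply cdiff_const. apply cdiff_id. apply one_minus_neq_0; auto.
Qed.

Lemma to_half_inv a : 0 < Re a -> to_half ((a - 1) / (a + 1))%C = a.
Proof.
  intros Ha. assert (H := half_plus1 a Ha). unfold to_half. field. split; auto.
  replace (a + 1 - (a - 1))%C with (RtoC 2) by ring. intros E. injection E. lra.
Qed.

Lemma to_half_inj u v : Cmod u < 1 -> Cmod v < 1 -> to_half u = to_half v -> u = v.
Proof.
  intros Hu Hv H. assert (Nu := one_minus_neq_0 u Hu). assert (Nv := one_minus_neq_0 v Hv).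
  apply (f_equal (fun w => w * (1 - u) * (1 - v) / 2)%C) in H. unfold to_half in H.
  assert (E1 : ((1 + u) / (1 - u) * (1 - u) * (1 - v) / 2 - (1 - u * v) / 2 = (u - v) / 2)%C) by (field; auto).
  assert (E2 : ((1 + v) / (1 - v) * (1 - u) * (1 - v) / 2 - (1 - u * v) / 2 = - ((u - v) / 2))%C) by (field; auto).
  rewrite H, E2 in E1.
  apply NNPP. intros Hne. apply (Cminus_neq_0 _ _ Hne).
  replace (u - v)%C with ((u - v) / 2 - - ((u - v) / 2))%C by (field; auto). rewrite E1. ring.
Qed.

Lemma near_half z : 0 < Re z -> near z (fun w => 0 < Re w).
Proof.
  intros Hz. exists (Re z). split; auto. intros w Hw.
  assert (H := re_le_Cmod (w - z)%C). assert (E : Re (w - z)%C = Re w - Re z) by reflexivity.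
  rewrite E in H. assert (H1 := Rle_lt_trans _ _ _ H Hw). apply Rabs_def2 in H1. lra.
Qed.

(** The form suited to difference quotients: these take values in the closed disk and are known to
    be [punctured_holo] at their base point. *)
Lemma schwarz_pick_half_disk (f : C -> C) (a : C) :
  (forall z, 0 < Re z -> punctured_holo f z) -> (forall z, 0 < Re z -> Cmod (f z) <= 1) ->
  0 < Re a -> cdiff f a -> forall z, 0 < Re z ->
  Cmod (f z - f a)%C * Cmod (z + Cconj a)%C <= Cmod (z - a)%C * Cmod (1 - Cconj (f a) * f z)%C.
Proof.
  intros Hp H1 Ha Hda z Hz.
  assert (H := schwarz_pick_disk (fun u => f (to_half u)) ((a-1)/(a+1))%C).
  specialize (H ltac:(intros u Hu; apply (punctured_holo_comp f to_half);
     [generalize (near_disk u Hu); apply near_imp; intros w Hw; apply cdiff_to_half; auto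
     |generalize (near_disk u Hu); apply near_imp; intros w Hw Hne E; apply Hne, to_half_inj; auto
     |apply Hp, to_half_pos; auto])
    ltac:(intros u Hu; apply H1, to_half_pos; auto) (half_to_disk a Ha)).
  assert (Hd : cdiff (fun u => f (to_half u)) ((a - 1) / (a + 1))%C).
  { apply (cdiff_comp f to_half). apply cdiff_to_half, half_to_disk; auto. rewrite to_half_inv; auto. }
  specialize (H Hd _ (half_to_disk z Hz)). cbv beta in H.
  rewrite !to_half_inv in H by auto.
  assert (G := half_cayley z a Hz Ha). assert (P := half_cayley_pos z a Hz Ha).
  apply Rmult_le_reg_r with (1 := P).
  apply Rmult_le_compat_r with (r := Cmod (z + Cconj a)%C) in H; [|apply Cmod_ge_0].
  replace (Cmod (z - a)%C * Cmod (1 - Cconj (f a) * f z)%C * Cmod (1 - Cconj ((a - 1) / (a + 1)) * ((z - 1) / (z + 1)))%C)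
   with ((Cmod (z - a)%C * Cmod (1 - Cconj ((a - 1) / (a + 1)) * ((z - 1) / (z + 1)))%C) * Cmod (1 - Cconj (f a) * f z)%C) by ring.
  rewrite <- G. lra.
Qed.

Lemma schwarz_pick_half (f : C -> C) :
  (forall z, 0 < Re z -> cdiff f z) -> (forall z, 0 < Re z -> 0 < Re (f z)) ->
  forall a b, 0 < Re a -> 0 < Re b ->
  Cmod (f a - f b)%C * Cmod (a + Cconj b)%C <= Cmod (a - b)%C * Cmod (f a + Cconj (f b))%C.
Proof.
  intros Hd Hf a b Ha Hb.
  assert (H := schwarz_pick_disk_half (fun u => f (to_half u))
    ltac:(intros u Hu; apply (cdiff_comp f to_half); [apply cdiff_to_half; auto|apply Hd, to_half_pos; auto])
    ltac:(intros u Hu; apply Hf, to_half_pos; auto) _ _ (half_to_disk a Ha) (half_to_disk b Hb)).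
  cbv beta in H. rewrite !to_half_inv in H by auto.
  assert (G := half_cayley a b Ha Hb). assert (P := half_cayley_pos a b Ha Hb).
  apply Rmult_le_reg_r with (1 := P).
  apply Rmult_le_compat_r with (r := Cmod (a + Cconj b)%C) in H; [|apply Cmod_ge_0].
  replace (Cmod (a - b)%C * Cmod (f a + Cconj (f b))%C * Cmod (1 - Cconj ((b - 1) / (b + 1)) * ((a - 1) / (a + 1)))%C)
   with ((Cmod (a - b)%C * Cmod (1 - Cconj ((b - 1) / (b + 1)) * ((a - 1) / (a + 1)))%C) * Cmod (f a + Cconj (f b))%C) by ring.
  rewrite <- G. lra.
Qed.

(** The hyperbolic difference quotient, base point [b] first. Its modulus is the ratio of the
    pseudo-hyperbolic distances of the images and of the points. At a = b the formula divides by
    zero and carries no meaning. *)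
Definition hyp_quot (f : C -> C) (b a : C) : C :=
  (((f a - f b) / (f a + Cconj (f b))) / ((a - b) / (a + Cconj b)))%C.

Lemma hyp_quot_alt f a b : (forall z, 0 < Re z -> 0 < Re (f z)) -> 0 < Re a -> 0 < Re b -> a <> b ->
  hyp_quot f b a = ((f a - f b) * (a + Cconj b) / ((f a + Cconj (f b)) * (a - b)))%C.
Proof.
  intros Hf Ha Hb Hab. unfold hyp_quot. field.
  repeat split; solve [apply half_plus_neq_0; auto | apply Cminus_neq_0; auto].
Qed.

Lemma hyp_quot_le_1 f a b : (forall z, 0 < Re z -> cdiff f z) -> (forall z, 0 < Re z -> 0 < Re (f z)) ->
  0 < Re a -> 0 < Re b -> a <> b -> Cmod (hyp_quot f b a) <= 1.
Proof.
  intros Hd Hf Ha Hb Hab. rewrite hyp_quot_alt by auto.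
  assert (H := schwarz_pick_half f Hd Hf a b Ha Hb).
  assert (P1 := Cmod_half_pos (f a) (f b) (Hf a Ha) (Hf b Hb)).
  assert (N := Cminus_neq_0 _ _ Hab). assert (P2 := proj1 (Cmod_gt_0 _) N).
  rewrite Cmod_div, !Cmod_mult.
  2:{ apply Cmult_neq_0; auto. apply half_plus_neq_0; auto. }
  apply Rmult_le_reg_r with (Cmod (f a + Cconj (f b))%C * Cmod (a - b)%C). nra.
  unfold Rdiv. rewrite Rmult_assoc, Rinv_l by nra. lra.
Qed.

(* Three-point Schwarz-Pick lemma of Beardon and Minda. *)
Lemma three_point (f : C -> C) :
  (forall z, 0 < Re z -> cdiff f z) -> (forall z, 0 < Re z -> 0 < Re (f z)) ->
  forall a a' b k, 0 < Re a -> 0 < Re a' -> 0 < Re b -> a <> b -> a' <> b ->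
  0 <= k < 1 -> Cmod (a' - a)%C <= k * Cmod (a' + Cconj a)%C ->
  Cmod (hyp_quot f b a' - hyp_quot f b a)%C <= 2 * k / (1 - k) * (1 - Cmod (hyp_quot f b a)).
Proof.
  intros Hd Hf a a' b k Ha Ha' Hb Hab Ha'b Hk Hka.
  destruct (Hd b Hb) as (Q & HQ & HE).
  (* Away from b but close to it, [chi] is the quotient, with the slope Q of f in place of (f w - f
     b) / (w - b). Taking its value at b makes [psi] continuous there. *)
  set (chi := fun w => (Q w * (w + Cconj b) / (f w + Cconj (f b)))%C).
  set (psi := fun w => if excluded_middle_informative (w = b) then chi b else hyp_quot f b w).
  assert (Epsi : forall w, w <> b -> psi w = hyp_quot f b w).
  { intros w Hw. unfold psi. destruct (excluded_middle_informative (w = b)); congruence. }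
  assert (Hchi : ccont chi b).
  { apply ccont_div.
    - apply ccont_mult; auto. apply ccont_plus. apply ccont_id. apply ccont_const.
    - apply ccont_plus. apply cdiff_ccont; auto. apply ccont_const.
    - apply half_plus_neq_0; auto. }
  assert (Eb : near b (fun w => chi w = psi w)).
  { generalize (near_and _ _ _ HE (near_half b Hb)). apply near_imp. intros w [H1 H2].
    unfold psi. destruct (excluded_middle_informative (w = b)) as [->|Hne]; auto.
    rewrite hyp_quot_alt by auto. unfold chi.
    replace (f w - f b)%C with (Q w * (w - b))%C by (rewrite H1; ring).
    field.
    repeat split; solve [apply half_plus_neq_0; auto | apply Cminus_neq_0; auto]. }
  assert (Hcd : forall w, 0 < Re w -> w <> b -> cdiff psi w).
  { intros w Hw Hne. apply (cdiff_near_eq (fun w => (f w - f b) * (w + Cconj b) / ((f w + Cconj (f b)) * (w - b)))%C).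
    - generalize (near_and _ _ _ (near_half w Hw) (near_ball w _ (proj1 (Cmod_gt_0 _) (Cminus_neq_0 _ _ (not_eq_sym Hne))))).
      apply near_imp. intros x [Hx Hxb]. assert (x <> b) by (intros ->; lra).
      rewrite Epsi by auto. rewrite hyp_quot_alt; auto.
    - apply cdiff_div.
      + apply cdiff_mult. apply cdiff_minus; auto. apply cdiff_const. apply cdiff_plus. apply cdiff_id. apply cdiff_const.
      + apply cdiff_mult. apply cdiff_plus; auto. apply cdiff_const. apply cdiff_minus. apply cdiff_id. apply cdiff_const.
      + apply Cmult_neq_0. apply half_plus_neq_0; auto. apply Cminus_neq_0; auto. }
  assert (Hph : forall w, 0 < Re w -> punctured_holo psi w).
  { intros w Hw. destruct (excluded_middle_informative (w = b)) as [->|Hne].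
    - split. apply (ccont_near_eq chi); auto.
      generalize (near_half b Hb). apply near_imp. auto.
    - split. apply cdiff_ccont; auto.
      generalize (near_and _ _ _ (near_half w Hw) (near_ball w _ (proj1 (Cmod_gt_0 _) (Cminus_neq_0 _ _ (not_eq_sym Hne))))).
      apply near_imp. intros x [Hx Hxb] _. assert (x <> b) by (intros ->; lra). auto. }
  assert (Hle1 : forall w, 0 < Re w -> w <> b -> Cmod (psi w) <= 1).
  { intros w Hw Hne. rewrite Epsi by auto. apply hyp_quot_le_1; auto. }
  assert (Hle : forall w, 0 < Re w -> Cmod (psi w) <= 1).
  { intros w Hw. destruct (excluded_middle_informative (w = b)) as [->|Hne]; auto.
    apply le_epsilon. intros e He. destruct (Hph b Hb) as [Hc _].
    destruct (near_and _ _ _ (Hc e He) (near_half b Hb)) as (d & Hd0 & K).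
    (* At b the bound is inherited by continuity from a nearby point. *)
    set (w := (b + RtoC (d/2))%C).
    assert (Ew : (w - b)%C = RtoC (d/2)) by (unfold w; ring).
    assert (Hwd : Cmod (w - b)%C = d/2) by (rewrite Ew, Cmod_R; apply Rabs_pos_eq; lra).
    assert (Hwb : w <> b). { intros E. rewrite E in Hwd. replace (b - b)%C with (RtoC 0) in Hwd by ring. rewrite Cmod_0 in Hwd. lra. }
    destruct (K w ltac:(lra)) as [K1 K2]. assert (K3 := Hle1 w K2 Hwb).
    assert (T := Cmod_minus_ge (psi b) (psi w)). rewrite Cmod_minus_sym in T. lra. }
  assert (S := schwarz_pick_half_disk psi a Hph Hle Ha (Hcd a Ha Hab) a' Ha').
  rewrite !Epsi in S by auto.
  set (e := hyp_quot f b a) in *. set (e' := hyp_quot f b a') in *.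
  assert (P := Cmod_half_pos a' a Ha' Ha).
  assert (S2 : Cmod (e' - e)%C <= k * Cmod (1 - Cconj e * e')%C).
  { apply Rmult_le_reg_r with (1 := P). eapply Rle_trans. exact S.
    apply Rle_trans with (k * Cmod (a' + Cconj a)%C * Cmod (1 - Cconj e * e')%C).
    apply Rmult_le_compat_r; auto. apply Cmod_ge_0. lra. }
  assert (He : Cmod e <= 1) by (unfold e; rewrite <- (Epsi a Hab); auto).
  assert (He0 := Cmod_ge_0 e).
  (* Writing 1 - conj(e) e' as 1 - |e|^2 - conj(e) (e' - e) puts |e' - e| on both sides of S2; since
     k < 1 it can be absorbed, whence the factor 1 / (1 - k). *)
  assert (S3 : Cmod (1 - Cconj e * e')%C <= (1 - Cmod e * Cmod e) + Cmod e * Cmod (e' - e)%C).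
  { replace (1 - Cconj e * e')%C with (RtoC (1 - Cmod e * Cmod e) - Cconj e * (e' - e))%C.
    - eapply Rle_trans. apply Cmod_minus_le. rewrite Cmod_mult, Cmod_conj, Cmod_R, Rabs_pos_eq by nra. lra.
    - rewrite Cmod_sq. destruct e as [x y], e' as [x' y']. C_coords. f_equal; ring. }
  assert (S0 := Cmod_ge_0 (e' - e)%C).
  assert (S4 : Cmod (e' - e)%C * (1 - k) <= 2 * k * (1 - Cmod e)).
  { assert (S5 : Cmod (1 - Cconj e * e')%C <= 2 * (1 - Cmod e) + Cmod (e' - e)%C) by nra.
    apply Rmult_le_compat_l with (r := k) in S5; lra. }
  apply Rmult_le_reg_r with (1 - k). lra.
  replace (2 * k / (1 - k) * (1 - Cmod e) * (1 - k)) with (2 * k * (1 - Cmod e)) by (field; lra). auto.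
Qed.

(** * Maps isogonal at infinity *)

(* Stolz angles at infinity are written k |z| <= Re z, and small arguments as
   |Im| <= eps Re, which avoids the argument function altogether. *)
Record isogonal_self_map (F : C -> C) : Prop := {
  iso_diff : forall z, 0 < Re z -> cdiff F z;
  iso_pos : forall z, 0 < Re z -> 0 < Re (F z);
  iso_infty : forall k M, 0 < k -> exists S, forall z, S < Cmod z -> k * Cmod z <= Re z -> M < Cmod (F z);
  iso_angle : forall k eps, 0 < k -> 0 < eps -> exists S, forall z, S < Cmod z -> k * Cmod z <= Re z ->
    0 < Re (F z / z)%C /\ Rabs (Im (F z / z)%C) <= eps * Re (F z / z)%C
}.

Lemma Cmod_plus_conj_le a b : 0 <= Re b -> Cmod (a + Cconj b)%C <= Cmod (a - b)%C + 2 * Re b.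
Proof.
  intros Hb. replace (a + Cconj b)%C with ((a - b) + RtoC (2 * Re b))%C.
  - eapply Rle_trans. apply Cmod_triangle. rewrite Cmod_R, Rabs_pos_eq; lra.
  - destruct a, b. C_coords. f_equal; ring.
Qed.

Lemma Cmod_plus_conj_ge a b : Re a + Re b <= Cmod (a + Cconj b)%C.
Proof.
  assert (H := Cmod_Re_le (a + Cconj b)%C). destruct a, b. C_coords_all. lra.
Qed.

Lemma Re_scal r z : Re (RtoC r * z)%C = r * Re z.
Proof. destruct z; unfold Re; simpl; ring. Qed.
Lemma Cmod_scal r z : 0 <= r -> Cmod (RtoC r * z)%C = r * Cmod z.
Proof. intros. rewrite Cmod_mult, Cmod_R, Rabs_pos_eq; auto. Qed.
(** A Harnack inequality. With X = |1 - conj(v) u| and Y = |u - v|, Schwarz-Pick gives |g u - g v|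
    (X - Y) <= 2 Y Re (g v). Here Y <= X <= 2 and X^2 - Y^2 = (1 - |u|^2) (1 - |v|^2) >= (1 -
    k^2)^2, so X - Y >= (1 - k^2)^2 / 4. *)
Lemma schwarz_pick_disk_half_compact (g : C -> C) (k : R) : 0 <= k < 1 ->
  (forall z, Cmod z < 1 -> cdiff g z) -> (forall z, Cmod z < 1 -> 0 < Re (g z)) ->
  forall u v, Cmod u <= k -> Cmod v <= k ->
  Cmod (g u - g v)%C <= 16 / ((1 - k*k) * (1 - k*k)) * Re (g v).
Proof.
  intros Hk Hd Hg u v Hu Hv.
  assert (H := schwarz_pick_disk_half g Hd Hg u v ltac:(lra) ltac:(lra)).
  assert (Hgv := Hg v ltac:(lra)).
  assert (H2 := Cmod_plus_conj_le (g u) (g v) ltac:(lra)).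
  set (D := Cmod (g u - g v)%C) in *. set (X := Cmod (1 - Cconj v * u)%C) in *. set (Y := Cmod (u - v)%C) in *.
  assert (HD : 0 <= D) by apply Cmod_ge_0. assert (HX : 0 <= X) by apply Cmod_ge_0.
  assert (HY : 0 <= Y) by apply Cmod_ge_0.
  assert (Pu := Cmod_ge_0 u). assert (Pv := Cmod_ge_0 v).
  assert (HX2 : X <= 2).
  { unfold X. eapply Rle_trans. apply Cmod_minus_le. rewrite Cmod_1, Cmod_mult, Cmod_conj. nra. }
  set (q := (1 - k*k) * (1 - k*k)).
  assert (Hkk : 0 < 1 - k * k) by nra.
  assert (Hq : 0 < q) by (unfold q; nra).
  assert (HXY : q <= X * X - Y * Y).
  { unfold X, Y. rewrite !Cmod_sq.
    assert (E : q <= (1 - Cmod u * Cmod u) * (1 - Cmod v * Cmod v)).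
    { unfold q. apply Rmult_le_compat; nra. }
    rewrite !Cmod_sq in E. destruct u as [u1 u2], v as [v1 v2]. C_coords_all. lra. }
  assert (HXY2 : q <= 4 * (X - Y)).
  { assert (Y <= X) by nra. nra. }
  apply Rmult_le_reg_r with q; auto.
  replace (16 / q * Re (g v) * q) with (16 * Re (g v)) by (field; lra).
  apply Rle_trans with (4 * (D * (X - Y))). nra. nra.
Qed.

(** An argument close to 0 forces F(z)/z to be nearly constant. In a Stolz angle g = (e0 + i) F(z)/z
    has positive real part, yet Re g is at most 2 e0 |F(z)/z|. Harnack bounds the oscillation of g,
    hence that of F(z)/z, by a multiple of Re g, which is small relative to |F(z)/z|. The pair (e0,
    1) is the number e0 + i. *)
Lemma isogonal_flat (F : C -> C) : isogonal_self_map F ->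
  forall R0 k eps, 0 < k <= 1 -> 1 <= R0 -> 0 < eps ->
  exists S, 0 < S /\ forall s z, S < s -> Cmod z <= R0 -> k <= Re z ->
    Cmod (F (RtoC s * z) / (RtoC s * z) - F s / RtoC s)%C <= eps * Cmod (F s / RtoC s)%C.
Proof.
  intros [Fd Fp _ Fa] R0 k eps Hk HR He.
  (* The disk of centre c and radius r contains the region |z| <= R0, Re z >= k, since there |z -
     c|^2 <= R0^2 - 2 c k + c^2 = c^2 - R0^2. The radius r' between r and c leaves room for Harnack
     and keeps the larger disk in the Stolz angle with constant k'. *)
  set (c := R0 * R0 / k).
  assert (Hc : c * k = R0 * R0) by (unfold c; field; lra).
  assert (HcR : R0 * R0 <= c) by nra.
  assert (HR2 : R0 <= R0 * R0) by nra.
  set (r := sqrt (c * c - R0 * R0)).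
  assert (Hr0 : 0 <= r) by apply sqrt_pos.
  assert (Hrr : r * r = c * c - R0 * R0). { apply sqrt_sqrt. nra. }
  assert (Hrc : r < c) by nra.
  set (r' := (r + c) / 2).
  assert (Hr' : r < r' < c) by (unfold r'; lra).
  set (kk := r / r').
  assert (Hkk : 0 <= kk < 1).
  { split. apply Rmult_le_pos; auto. left. apply Rinv_0_lt_compat. lra.
    apply Rmult_lt_reg_r with r'. lra. unfold kk. field_simplify; lra. }
  set (B := 16 / ((1 - kk*kk) * (1 - kk*kk))).
  assert (HB : 0 < B). { assert (0 < 1 - kk * kk) by nra. apply Rdiv_lt_0_compat. lra. apply Rmult_lt_0_compat; auto. }
  set (e0 := eps / (2 * B)).
  assert (He0 : 0 < e0) by (apply Rdiv_lt_0_compat; lra).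
  set (k' := (c - r') / (c + r')).
  assert (Hk' : 0 < k') by (apply Rdiv_lt_0_compat; lra).
  destruct (Fa k' (e0/2) Hk' ltac:(lra)) as [S HS].
  set (S' := Rmax 1 (S / (c - r'))).
  assert (HS1 := Rmax_l 1 (S / (c - r'))). assert (HS2 := Rmax_r 1 (S / (c - r'))). fold S' in HS1, HS2.
  exists S'. split. lra. intros s z Hs Hz Hzk.
  set (phi := fun u => (RtoC s * (RtoC c + RtoC r' * u))%C).
  assert (Hphi : forall u, Cmod u < 1 -> S < Cmod (phi u) /\ k' * Cmod (phi u) <= Re (phi u) /\ 0 < Re (phi u)).
  { intros u Hu. unfold phi. rewrite Re_scal, Cmod_scal by lra.
    set (y := (RtoC c + RtoC r' * u)%C).
    assert (Y1 : Cmod y <= c + r').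
    { unfold y. eapply Rle_trans. apply Cmod_triangle. rewrite Cmod_scal, Cmod_R, Rabs_pos_eq by lra. nra. }
    assert (Y2 : c - r' < Re y).
    { unfold y. assert (E : Re (RtoC c + RtoC r' * u)%C = c + r' * Re u) by (destruct u; unfold Re; simpl; ring).
      rewrite E. assert (H := re_le_Cmod u). apply Rabs_le_between in H. nra. }
    assert (Y3 := Cmod_Re_le y).
    repeat split.
    - apply Rle_lt_trans with (S / (c - r') * (c - r')). right; field; lra.
      apply Rlt_trans with (s * (c - r')). apply Rmult_lt_compat_r; lra. apply Rmult_lt_compat_l; lra.
    - replace (k' * (s * Cmod y)) with (s * (k' * Cmod y)) by ring. apply Rmult_le_compat_l. lra.
      apply Rle_trans with (k' * (c + r')). apply Rmult_le_compat_l; lra. unfold k'. field_simplify; lra.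
    - apply Rmult_lt_0_compat; lra. }
  set (g := fun u => ((e0, 1) * (F (phi u) / phi u))%C).
  assert (Hgre : forall u, Cmod u < 1 -> 0 < Re (g u) /\ Re (g u) <= 2 * e0 * Cmod (F (phi u) / phi u)%C).
  { intros u Hu. destruct (Hphi u Hu) as (Q1 & Q2 & Q3). destruct (HS _ Q1 Q2) as [Q4 Q5].
    assert (E : Re (g u) = e0 * Re (F (phi u) / phi u)%C - Im (F (phi u) / phi u)%C).
    { unfold g. destruct (F (phi u) / phi u)%C. C_coords. ring. }
    rewrite E. apply Rabs_le_between in Q5. assert (Q6 := Cmod_Re_le (F (phi u) / phi u)%C). split; nra. }
  assert (Hgd : forall u, Cmod u < 1 -> cdiff g u).
  { intros u Hu. destruct (Hphi u Hu) as (Q1 & Q2 & Q3).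
    assert (Hpd : cdiff phi u).
    { apply cdiff_mult. apply cdiff_const. apply cdiff_plus. apply cdiff_const. apply cdiff_mult. apply cdiff_const. apply cdiff_id. }
    apply cdiff_mult. apply cdiff_const. apply cdiff_div; auto.
    apply (cdiff_comp F phi); auto. apply half_neq_0; auto. }
  assert (Nr' : RtoC r' <> 0) by (intros E; injection E; lra).
  assert (Uz : forall z, Cmod z <= R0 -> k <= Re z -> Cmod ((z - RtoC c) / RtoC r')%C <= kk /\ phi ((z - RtoC c) / RtoC r')%C = (RtoC s * z)%C).
  { intros y Hy Hyk. split.
    - rewrite Cmod_div, Cmod_R, (Rabs_pos_eq r') by (auto; lra). unfold kk. apply Rmult_le_compat_r.
      left; apply Rinv_0_lt_compat; lra.
      assert (Hsq := Cmod_sq y). assert (0 <= Cmod y) by apply Cmod_ge_0.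
      assert (Cmod y * Cmod y <= R0 * R0) by nra.
      assert (Hsq2 := Cmod_sq (y - RtoC c)%C).
      assert (Cmod (y - RtoC c)%C * Cmod (y - RtoC c)%C <= r * r).
      { rewrite Hsq2, Hrr. destruct y as [y1 y2]. C_coords_all. nra. }
      nra.
    - unfold phi. field. auto. }
  destruct (Uz z Hz Hzk) as [U1 U2].
  destruct (Uz 1) as [V1 V2]. { rewrite Cmod_1; auto. } { unfold Re; simpl; lra. }
  assert (H := schwarz_pick_disk_half_compact g kk Hkk Hgd (fun u Hu => proj1 (Hgre u Hu)) _ _ U1 V1).
  assert (H2 := proj2 (Hgre _ ltac:(apply Rle_lt_trans with (1 := V1); lra))).
  fold B in H. unfold g in H at 1 2. rewrite U2, V2 in H. rewrite V2 in H2.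
  replace (RtoC s * 1)%C with (RtoC s) in * by ring.
  replace ((e0, 1) * (F (RtoC s * z) / (RtoC s * z)) - (e0, 1) * (F s / RtoC s))%C
    with ((e0, 1) * (F (RtoC s * z) / (RtoC s * z) - F s / RtoC s))%C in H by ring.
  rewrite Cmod_mult in H.
  set (D := Cmod (F (RtoC s * z) / (RtoC s * z) - F s / RtoC s)%C) in *.
  assert (HD : 0 <= D) by apply Cmod_ge_0.
  assert (H3 : 1 <= Cmod (e0, 1)).
  { assert (T := Rmax_Cmod (e0,1)). simpl in T. rewrite Rabs_R1 in T. eapply Rle_trans. 2: exact T. apply Rmax_r. }
  apply Rle_trans with (Cmod (e0, 1) * D). nra.
  eapply Rle_trans. exact H. eapply Rle_trans. apply Rmult_le_compat_l. lra. exact H2.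
  right. unfold e0. field. lra.
Qed.

Lemma isogonal_real (F : C -> C) : isogonal_self_map F ->
  forall eps, 0 < eps -> exists S, 0 < S /\ forall s, S < s ->
    Rabs (Im (F s)) <= eps * Re (F s).
Proof.
  intros [Fd Fp _ Fa] eps He. destruct (Fa 1 eps ltac:(lra) He) as [S HS].
  exists (Rmax 1 S). assert (H1 := Rmax_l 1 S). assert (H2 := Rmax_r 1 S). split. lra.
  intros s Hs. assert (Em : Cmod s = s) by (rewrite Cmod_R; apply Rabs_pos_eq; lra).
  destruct (HS (RtoC s)) as [_ H]. lra. rewrite Em. unfold Re; simpl; lra.
  replace (F s / RtoC s)%C with (RtoC (/ s) * F s)%C in H.
  2:{ rewrite RtoC_inv by lra. field. intros E; injection E; lra. }
  assert (Hi : 0 < / s) by (apply Rinv_0_lt_compat; lra).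
  rewrite Re_scal in H.
  replace (Im (RtoC (/ s) * F s)%C) with (/ s * Im (F s)) in H.
  2:{ destruct (F s); unfold Im; simpl; ring. }
  rewrite Rabs_mult, (Rabs_pos_eq (/ s)) in H by lra.
  apply Rmult_le_reg_l with (/ s); auto. lra.
Qed.

Lemma Cmod_le_Re_Im z : Cmod z <= Rabs (Re z) + Rabs (Im z).
Proof.
  assert (H := Cmod_sq z).
  assert (H1 := Rabs_pos (Re z)). assert (H2 := Rabs_pos (Im z)).
  assert (E1 := Rsqr_abs (Re z)). assert (E2 := Rsqr_abs (Im z)). unfold Rsqr in *. nra.
Qed.

(** [isogonal_flat] multiplied by s z: seen at scale s, F acts on compact sets like multiplication
    by F(s). *)
Lemma isogonal_scale (F : C -> C) : isogonal_self_map F ->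
  forall R0 k eps, 0 < k <= 1 -> 1 <= R0 -> 0 < eps ->
  exists S, 0 < S /\ forall s z, S < s -> Cmod z <= R0 -> k <= Re z ->
    Cmod (F (RtoC s * z) - z * F s)%C <= eps * Cmod (F s).
Proof.
  intros HF R0 k eps Hk HR He.
  destruct (isogonal_flat F HF R0 k (eps / R0) Hk HR) as (S & HS0 & HS). { apply Rdiv_lt_0_compat; lra. }
  exists S. split; auto. intros s z Hs Hz Hzk. assert (H := HS s z Hs Hz Hzk).
  assert (Ns : RtoC s <> 0) by (intros E; injection E; lra).
  assert (Nz : z <> 0) by (apply half_neq_0; lra).
  replace (F (RtoC s * z) - z * F s)%C with ((RtoC s * z) * (F (RtoC s * z) / (RtoC s * z) - F s / RtoC s))%C by (field; auto).
  rewrite Cmod_div, Cmod_R, (Rabs_pos_eq s) in H by (auto; lra).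
  rewrite Cmod_mult, Cmod_scal by lra.
  apply Rle_trans with (s * Cmod z * (eps / R0 * (Cmod (F s) / s))).
  apply Rmult_le_compat_l; auto. apply Rmult_le_pos. lra. apply Cmod_ge_0.
  replace (s * Cmod z * (eps / R0 * (Cmod (F s) / s))) with (Cmod z / R0 * (eps * Cmod (F s))) by (field; lra).
  replace (eps * Cmod (F s)) with (1 * (eps * Cmod (F s))) at 2 by ring.
  apply Rmult_le_compat_r. apply Rmult_le_pos. lra. apply Cmod_ge_0.
  apply Rmult_le_reg_r with R0. lra. unfold Rdiv. rewrite Rmult_assoc, Rinv_l by lra. lra.
Qed.

(** * Backward orbits in the half plane *)

(* A constant k < 1 is the pseudo-hyperbolic form of bounded hyperbolic steps. *)
Record half_orbit (f : C -> C) (k : R) (w : nat -> C) : Prop := {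
  orb_pos : forall n, 0 < Re (w n);
  orb_back : forall n, f (w (S n)) = w n;
  orb_step : forall n, Cmod (w n - w (S n))%C <= k * Cmod (w n + Cconj (w (S n)))%C;
  orb_infty : forall M, exists N, forall n, (N <= n)%nat -> M < Cmod (w n)
}.

Lemma incr_le_0 (e d : nat -> R) N :
  (forall n, (N <= n)%nat -> e n <= e (S n)) -> (forall n, (N <= n)%nat -> e n <= d n) ->
  (forall eps, 0 < eps -> exists M, forall n, (M <= n)%nat -> d n < eps) ->
  forall n, (N <= n)%nat -> e n <= 0.
Proof.
  intros He Hed Hd n Hn. apply le_epsilon. intros eps Heps.
  destruct (Hd eps Heps) as [M HM].
  assert (H : forall j, e n <= e (n + j)%nat).
  { induction j. rewrite Nat.add_0_r; lra. rewrite Nat.add_succ_r. eapply Rle_trans. exact IHj. apply He. lia. }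
  assert (H1 := H M). assert (H2 := Hed (n + M)%nat ltac:(lia)). assert (H3 := HM (n + M)%nat ltac:(lia)). lra.
Qed.

Lemma Cmod_minus_plus_sq a b :
  Cmod (a + Cconj b)%C * Cmod (a + Cconj b)%C - Cmod (a - b)%C * Cmod (a - b)%C = 4 * Re a * Re b.
Proof. rewrite !Cmod_sq. destruct a, b. C_coords. ring. Qed.
(** Schwarz-Pick for the complementary quantity 1 - rho^2 = 4 Re a Re b / |a + conj b|^2, rho being
    the pseudo-hyperbolic distance; here the real parts appear as factors. *)
Lemma schwarz_pick_half_Re (f : C -> C) :
  (forall z, 0 < Re z -> cdiff f z) -> (forall z, 0 < Re z -> 0 < Re (f z)) ->
  forall a b, 0 < Re a -> 0 < Re b ->
  Re a * Re b * (Cmod (f a + Cconj (f b))%C * Cmod (f a + Cconj (f b))%C) <=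
  Re (f a) * Re (f b) * (Cmod (a + Cconj b)%C * Cmod (a + Cconj b)%C).
Proof.
  intros Hd Hf a b Ha Hb.
  assert (H := schwarz_pick_half f Hd Hf a b Ha Hb).
  assert (E1 := Cmod_minus_plus_sq a b). assert (E2 := Cmod_minus_plus_sq (f a) (f b)).
  set (X := Cmod (a + Cconj b)%C) in *. set (Y := Cmod (a - b)%C) in *.
  set (X' := Cmod (f a + Cconj (f b))%C) in *. set (Y' := Cmod (f a - f b)%C) in *.
  assert (0 <= X) by apply Cmod_ge_0. assert (0 <= Y) by apply Cmod_ge_0.
  assert (0 <= X') by apply Cmod_ge_0. assert (0 <= Y') by apply Cmod_ge_0.
  assert (G : (Y' * X) * (Y' * X) <= (Y * X') * (Y * X')).
  { apply Rmult_le_compat; try (apply Rmult_le_pos); auto. }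
  assert (Re a * Re b = (X * X - Y * Y) / 4) by lra.
  assert (Re (f a) * Re (f b) = (X' * X' - Y' * Y') / 4) by lra.
  rewrite H4, H5. nra.
Qed.

(* In the coordinate 1/w, Schwarz-Pick with the base point v makes Re (1/w)
   decay geometrically, and it bounds the size of each step, hence |1/w|. *)
Lemma half_orbit_nontangential f k w v :
  (forall z, 0 < Re z -> cdiff f z) -> (forall z, 0 < Re z -> 0 < Re (f z)) ->
  0 <= k < 1 -> half_orbit f k w -> 0 < Re v -> Re (f v) < Re v ->
  exists kap N, 0 < kap <= 1 /\ forall n, (N <= n)%nat -> kap * Cmod (w n) <= Re (w n).
Proof.
  intros Hd Hf Hk [Hpos Hback Hstep Hinf] Hv Hfv.
  assert (Hfv0 := Hf v Hv).
  set (tau := Re (f v) / Re v).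
  assert (Htau : 0 < tau < 1).
  { split. apply Rdiv_lt_0_compat; auto. apply Rmult_lt_reg_r with (Re v); auto. unfold tau. field_simplify; lra. }
  assert (Etau : Re (f v) = tau * Re v) by (unfold tau; field; lra).
  (* Eventually |v| and |f v| are below del times the modulus of the orbit. Then |w + conj v| may be
     replaced by |w| at a cost that the gap between tau and c covers. *)
  set (c := (1 + tau) / 2). set (del := (1 - tau) / 16).
  assert (Hc : tau * ((1 + del) * (1 + del)) <= c * ((1 - del) * (1 - del))).
  { unfold c, del. nra. }
  assert (Hc1 : 0 < c < 1) by (unfold c; lra).
  assert (Hdel : 0 < del < 1/16) by (unfold del; lra).
  destruct (Hinf (Rmax (Cmod v) (Cmod (f v)) / del)) as [N HN].
  assert (Hw0 : forall n, 0 < Cmod (w n)). { intros n. apply Rlt_le_trans with (1 := Hpos n). apply Cmod_Re_le. }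
  (* [Q n] is Re (1 / w n) and [d n] is |1 / w n|; bounding d by a multiple of Q is nontangential
     approach. *)
  set (Q := fun n => Re (w n) / (Cmod (w n) * Cmod (w n))).
  set (d := fun n => / Cmod (w n)).
  assert (HQ0 : forall n, 0 < Q n).
  { intros n. apply Rdiv_lt_0_compat; auto. apply Rmult_lt_0_compat; auto. }
  assert (HQ : forall n, (N <= n)%nat -> Q (S n) <= c * Q n).
  { intros n Hn.
    assert (G := schwarz_pick_half_Re f Hd Hf (w (S n)) v (Hpos _) Hv). rewrite Hback in G.
    assert (N1 := HN n Hn). assert (N2 := HN (S n) ltac:(lia)).
    assert (M1 := Rmax_l (Cmod v) (Cmod (f v))). assert (M2 := Rmax_r (Cmod v) (Cmod (f v))).
    set (M := Rmax (Cmod v) (Cmod (f v))) in *.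
    assert (N1' : Cmod (f v) < del * Cmod (w n)).
    { apply Rmult_lt_compat_l with (r := del) in N1; [|lra]. replace (del * (M / del)) with M in N1 by (field; lra). lra. }
    assert (N2' : Cmod v < del * Cmod (w (S n))).
    { apply Rmult_lt_compat_l with (r := del) in N2; [|lra]. replace (del * (M / del)) with M in N2 by (field; lra). lra. }
    assert (L1 : (1 - del) * Cmod (w n) <= Cmod (w n + Cconj (f v))%C).
    { assert (H := Cmod_minus_ge (w n) (- Cconj (f v))%C). rewrite Cmod_opp, Cmod_conj in H.
      replace (w n - - Cconj (f v))%C with (w n + Cconj (f v))%C in H by ring. lra. }
    assert (L2 : Cmod (w (S n) + Cconj v)%C <= (1 + del) * Cmod (w (S n))).
    { eapply Rle_trans. apply Cmod_triangle. rewrite Cmod_conj. lra. }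
    set (A := Cmod (w n)) in *. set (B := Cmod (w (S n))) in *.
    assert (HA : 0 < A) by apply Hw0. assert (HB : 0 < B) by apply Hw0.
    set (x := Re (w n)) in *. set (y := Re (w (S n))) in *.
    assert (Hx : 0 < x) by apply Hpos. assert (Hy : 0 < y) by apply Hpos.
    assert (G2 : y * Re v * (((1 - del) * A) * ((1 - del) * A)) <= x * (tau * Re v) * (((1 + del) * B) * ((1 + del) * B))).
    { rewrite <- Etau. eapply Rle_trans; [|eapply Rle_trans; [exact G|]].
      - apply Rmult_le_compat_l. nra. apply Rmult_le_compat; auto; nra.
      - apply Rmult_le_compat_l. nra. apply Rmult_le_compat; auto; apply Cmod_ge_0. }
    assert (G3 : y * (A * A) * ((1 - del) * (1 - del)) <= x * (B * B) * (tau * ((1 + del) * (1 + del)))).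
    { apply Rmult_le_reg_r with (Re v); auto. lra. }
    assert (G4 : y * (A * A) <= c * x * (B * B)).
    { apply Rmult_le_reg_r with ((1 - del) * (1 - del)). nra.
      eapply Rle_trans. exact G3.
      apply Rle_trans with (x * (B * B) * (c * ((1 - del) * (1 - del)))).
      apply Rmult_le_compat_l; auto. apply Rmult_le_pos; nra. right; ring. }
    unfold Q. fold A B x y. apply Rmult_le_reg_r with ((A * A) * (B * B)). apply Rmult_lt_0_compat; nra.
    replace (y / (B*B) * (A*A*(B*B))) with (y * (A*A)) by (field; lra).
    replace (c * (x / (A*A)) * (A*A*(B*B))) with (c * x * (B*B)) by (field; lra). auto. }
  (* The step condition, read for 1/w, bounds |1 / w n - 1 / w (S n)| by K times Re (1 / w (S
     n)). *)
  set (K := 2 * k / (1 - k)).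
  assert (HK : 0 <= K). { apply Rdiv_le_0_compat; lra. }
  assert (HD : forall n, d n - d (S n) <= K * Q (S n)).
  { intros n.
    assert (Na : w n <> 0) by (apply half_neq_0; auto). assert (Nb : w (S n) <> 0) by (apply half_neq_0; auto).
    set (D := Cmod (/ w n - / w (S n))%C).
    assert (H1 : d n - d (S n) <= D).
    { unfold d, D. rewrite <- !Cmod_inv by auto. apply Cmod_minus_ge. }
    assert (E1 : D = Cmod (w n - w (S n))%C / (Cmod (w n) * Cmod (w (S n)))).
    { unfold D. rewrite Cmod_minus_sym. replace (/ w (S n) - / w n)%C with ((w n - w (S n)) / (w n * w (S n)))%C by (field; auto).
      rewrite Cmod_div, Cmod_mult; auto. apply Cmult_neq_0; auto. }
    assert (E2 : Cmod (w n + Cconj (w (S n)))%C / (Cmod (w n) * Cmod (w (S n))) <= D + 2 * Q (S n)).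
    { assert (P := Cmod_plus_conj_le (/ w n)%C (/ w (S n))%C).
      assert (EQ : Re (/ w (S n))%C = Q (S n)).
      { unfold Q. rewrite Cmod_sq. destruct (w (S n)) as [p q]. C_coords. f_equal. ring. }
      rewrite EQ in P. specialize (P ltac:(left; auto)). fold D in P.
      eapply Rle_trans. 2: exact P. right.
      rewrite Cinv_conj by auto.
      assert (Nc : Cconj (w (S n)) <> 0). { intros E. apply Nb. apply Cmod_eq_0. rewrite <- Cmod_conj, E. apply Cmod_0. }
      replace (/ w n + / Cconj (w (S n)))%C with ((w n + Cconj (w (S n))) / (w n * Cconj (w (S n))))%C by (field; auto).
      rewrite Cmod_div, Cmod_mult, Cmod_conj. auto. apply Cmult_neq_0; auto. }
    assert (E3 : D <= k * (D + 2 * Q (S n))).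
    { eapply Rle_trans. 2: apply Rmult_le_compat_l; [lra|exact E2].
      rewrite E1. unfold Rdiv. rewrite <- Rmult_assoc. apply Rmult_le_compat_r; auto.
      left; apply Rinv_0_lt_compat, Rmult_lt_0_compat; auto. }
    eapply Rle_trans. exact H1. apply Rmult_le_reg_r with (1 - k). lra.
    replace (K * Q (S n) * (1 - k)) with (2 * k * Q (S n)) by (unfold K; field; lra). lra. }
  (* K times the geometric sum c + c^2 + ...: this makes d - K2 Q nondecreasing from N on, and a
     nondecreasing sequence below the null sequence d is nonpositive. *)
  set (K2 := K * c / (1 - c)).
  assert (HK2 : 0 <= K2). { apply Rdiv_le_0_compat; nra. }
  assert (EK2 : K2 * (1 - c) = K * c) by (unfold K2; field; lra).
  assert (Main : forall n, (N <= n)%nat -> d n - K2 * Q n <= 0).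
  { apply (incr_le_0 (fun n => d n - K2 * Q n) d).
    - intros n Hn. assert (H1 := HD n).
      assert (K2 * Q (S n) <= K2 * (c * Q n)) by (apply Rmult_le_compat_l; auto).
      assert (G : K * Q (S n) <= K2 * (1 - c) * Q n).
      { rewrite EK2. replace (K * c * Q n) with (K * (c * Q n)) by ring. apply Rmult_le_compat_l; auto. }
      lra.
    - intros n _. assert (0 <= K2 * Q n). { apply Rmult_le_pos; auto. left; auto. } lra.
    - intros eps He. destruct (Hinf (/ eps)) as [M HM]. exists M. intros n Hn. unfold d.
      rewrite <- (Rinv_inv eps). apply Rinv_lt_contravar; auto.
      apply Rmult_lt_0_compat; auto. apply Rinv_0_lt_compat; auto. }
  exists (/ (K2 + 1)), N. split.
  { split. apply Rinv_0_lt_compat; lra. rewrite <- Rinv_1. apply Rinv_le_contravar; lra. }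
  intros n Hn. assert (H := Main n Hn). unfold d, Q in H.
  assert (H0 := Hw0 n). assert (Hx := Hpos n).
  apply Rmult_le_compat_r with (r := Cmod (w n) * Cmod (w n)) in H; [|nra].
  field_simplify in H; [|lra].
  apply Rmult_le_reg_l with (K2 + 1). lra. rewrite <- Rmult_assoc, Rinv_r by lra. nra.
Qed.

Local Notation dil lam n b := (RtoC (lam ^ n) * b)%C.

(** * Backward orbits as images under F of geometric sequences *)

Section Identification.

Variables (f F : C -> C) (lam : R).
Hypothesis f_diff : forall z, 0 < Re z -> cdiff f z.
Hypothesis f_pos : forall z, 0 < Re z -> 0 < Re (f z).
Hypothesis lam_gt_1 : 1 < lam.
Hypothesis F_iso : isogonal_self_map F.
Hypothesis fF : forall z, 0 < Re z -> f (F (RtoC lam * z)%C) = F z.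

(** The base point for [half_orbit_nontangential]. For v = F (lam s) with s large, f v = F s, and Re
    (F (lam s)) is close to lam Re (F s), hence larger than Re (F s). *)
Lemma exists_pulled_in : exists v, 0 < Re v /\ Re (f v) < Re v.
Proof.
  set (eps := (lam - 1) / 4).
  destruct (isogonal_scale F F_iso lam 1 eps) as (S1 & HS1 & H1); try (unfold eps; lra).
  destruct (isogonal_real F F_iso 1) as (S2 & HS2 & H2); [lra|].
  set (s := Rmax S1 S2 + 1).
  assert (G1 := Rmax_l S1 S2). assert (G2 := Rmax_r S1 S2).
  assert (Hs1 : S1 < s) by (unfold s; lra). assert (Hs2 : S2 < s) by (unfold s; lra).
  specialize (H2 s Hs2).
  assert (K := H1 s (RtoC lam) Hs1). rewrite Cmod_R, Rabs_pos_eq in K by lra.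
  specialize (K ltac:(lra) ltac:(unfold Re; simpl; lra)).
  assert (Ps : 0 < Re s) by (unfold Re; simpl; lra).
  assert (Pf := iso_pos F F_iso _ Ps).
  exists (F (RtoC lam * RtoC s)%C). split.
  - apply (iso_pos F F_iso). rewrite Re_scal. apply Rmult_lt_0_compat; lra.
  - rewrite fF by auto. rewrite (Cmult_comm (RtoC lam)).
    assert (L := Cmod_le_Re_Im (F s)). rewrite (Rabs_pos_eq (Re _)) in L by lra.
    assert (T := re_le_Cmod (F (RtoC s * RtoC lam) - RtoC lam * F s)%C).
    assert (E : Re (F (RtoC s * RtoC lam) - RtoC lam * F s)%C = Re (F (RtoC s * RtoC lam)%C) - lam * Re (F s)).
    { rewrite <- Re_scal. reflexivity. }
    rewrite E in T. apply Rabs_le_between in T. unfold eps in K. nra.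
Qed.

Lemma iterate_contract eps j a b : 0 < Re a -> 0 < Re b ->
  Cmod (a - b)%C <= eps * Cmod (a + Cconj b)%C ->
  Cmod (Nat.iter j f a - Nat.iter j f b)%C <= eps * Cmod (Nat.iter j f a + Cconj (Nat.iter j f b))%C
  /\ 0 < Re (Nat.iter j f a) /\ 0 < Re (Nat.iter j f b).
Proof.
  intros Ha Hb H. induction j; simpl; auto.
  destruct IHj as (I1 & I2 & I3). repeat split; auto.
  set (x := Nat.iter j f a) in *. set (y := Nat.iter j f b) in *.
  assert (G := schwarz_pick_half f f_diff f_pos x y I2 I3).
  assert (P := Cmod_half_pos x y I2 I3). assert (P' := Cmod_ge_0 (f x + Cconj (f y))%C).
  apply Rmult_le_reg_r with (1 := P). eapply Rle_trans. exact G.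
  apply Rle_trans with (eps * Cmod (x + Cconj y)%C * Cmod (f x + Cconj (f y))%C).
  apply Rmult_le_compat_r; auto. right; ring.
Qed.

Lemma RtoC_pow_scal m x : (dil lam (S m) x) = (RtoC lam * (dil lam m x))%C.
Proof. simpl. rewrite RtoC_mult. ring. Qed.
Lemma iterate_F j b : 0 < Re b -> Nat.iter j f (F (dil lam j b)) = F b.
Proof.
  intros Hb. assert (G : forall i x, 0 < Re x -> Nat.iter i f (F (dil lam i x)) = F x).
  { induction i; intros x Hx.
    - simpl. f_equal. ring.
    - rewrite Nat.iter_succ_r. rewrite RtoC_pow_scal, fF. apply IHi; auto.
      rewrite Re_scal. apply Rmult_lt_0_compat; auto. apply pow_lt; lra. }
  apply G; auto.
Qed.

Lemma iterate_orbit k w j n : half_orbit f k w -> Nat.iter j f (w (n + j)%nat) = w n.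
Proof.
  intros Hw. induction j. rewrite Nat.add_0_r; auto.
  rewrite Nat.iter_succ_r. rewrite Nat.add_succ_r, (orb_back f k w Hw). auto.
Qed.

Lemma real_value_IVT (s0 s1 y : R) : 0 < s0 < s1 -> Cmod (F s0) < y < Cmod (F s1) ->
  exists s, s0 <= s <= s1 /\ Cmod (F s) = y.
Proof.
  intros Hs Hy.
  destruct (IVT_interv (fun s => Cmod (F s) - y) s0 s1) as (s & H1 & H2); [| lra | lra | lra |].
  - intros a Ha.
    assert (Hc := ccont_Cmod F (RtoC a) (cdiff_ccont _ _ (iso_diff F F_iso (RtoC a) ltac:(unfold Re; simpl; lra)))).
    intros eps He. destruct (Hc eps He) as (d & Hd & K). exists d. split; auto.
    intros x [_ Hx]. simpl in *. unfold R_dist in *.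
    assert (Hx' : Cmod (RtoC x - RtoC a)%C < d) by (rewrite <- RtoC_minus, Cmod_R; auto).
    specialize (K _ Hx'). rewrite <- RtoC_minus, Cmod_R in K.
    replace (Cmod (F (RtoC x)) - y - (Cmod (F (RtoC a)) - y)) with (Cmod (F (RtoC x)) - Cmod (F (RtoC a))) by ring. auto.
  - exists s. split; auto. lra.
Qed.

(** Some s has |F s| = |w n| by the intermediate value theorem. As F s has small argument, z = w n /
    F s is a unit vector in a Stolz angle, and F (s z) is close to z F s = w n. *)
Lemma orbit_shadow kap N0 k w : half_orbit f k w -> 0 < kap <= 1 ->
  (forall n, (N0 <= n)%nat -> kap * Cmod (w n) <= Re (w n)) ->
  forall eps, 0 < eps -> exists N, forall n, (N <= n)%nat -> exists a,
    kap / 2 * Cmod a <= Re a /\ 1 <= Cmod a /\ Cmod (F a - w n)%C <= eps * Cmod (F a + Cconj (w n))%C.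
Proof.
  intros Hw Hkap HN0 eps He.
  (* The factor kap pays for measuring the error against |F a + conj (w n)| >= Re (w n) >= kap |w
     n|. *)
  set (e1 := eps * kap).
  assert (He1 : 0 < e1) by (apply Rmult_lt_0_compat; lra).
  destruct (isogonal_scale F F_iso 1 (kap/2) e1) as (S1 & HS1 & H1); [lra|lra|auto|].
  destruct (isogonal_real F F_iso (kap / 4)) as (S2 & HS2 & H2); [lra|].
  set (s0 := Rmax 1 (Rmax S1 S2) + 1).
  assert (G0 := Rmax_l 1 (Rmax S1 S2)). assert (G0' := Rmax_r 1 (Rmax S1 S2)).
  assert (G1 := Rmax_l S1 S2). assert (G2 := Rmax_r S1 S2).
  assert (Hs00 : 1 < s0) by (unfold s0; lra).
  destruct (orb_infty f k w Hw (Cmod (F s0))) as [N1 HN1].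
  exists (N0 + N1)%nat. intros n Hn.
  specialize (HN0 n ltac:(lia)). specialize (HN1 n ltac:(lia)).
  destruct (iso_infty F F_iso 1 (Cmod (w n)) ltac:(lra)) as [S3 HS3].
  set (s1 := Rmax s0 S3 + 1). assert (G3 := Rmax_l s0 S3). assert (G4 := Rmax_r s0 S3).
  assert (Hs1 : Cmod (w n) < Cmod (F s1)).
  { assert (Ps1 : 0 < s1) by (unfold s1; lra).
    assert (Em : Cmod s1 = s1) by (rewrite Cmod_R; apply Rabs_pos_eq; lra).
    apply HS3; rewrite Em. unfold s1; lra. unfold Re; simpl; lra. }
  destruct (real_value_IVT s0 s1 (Cmod (w n))) as (s & Hs & Es).
  { unfold s1; lra. } { lra. }
  assert (Hs0 : s0 <= s) by lra. unfold s0 in Hs0.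
  specialize (H2 s ltac:(lra)).
  assert (Pw := orb_pos f k w Hw n).
  assert (Ps : 0 < Re (F s)) by (apply (iso_pos F F_iso); unfold Re; simpl; lra).
  assert (NF : F s <> 0) by (apply half_neq_0; auto).
  set (z := (w n / F s)%C).
  assert (PA : 0 < Cmod (F s)) by (apply Cmod_gt_0; auto).
  assert (Ez : Cmod z = 1) by (unfold z; rewrite Cmod_div, Es by auto; field; lra).
  assert (Rez : kap / 2 <= Re z).
  { assert (E : Re z = (Re (w n) * Re (F s) + Im (w n) * Im (F s)) / (Cmod (F s) * Cmod (F s))).
    { unfold z. rewrite Cmod_sq.
      assert (X := PA). apply (Rmult_lt_0_compat _ _ PA) in X. rewrite Cmod_sq in X.
      destruct (w n) as [p q]. destruct (F s) as [p' q']. C_coords_all. field. lra. }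
    rewrite E.
    set (A := Cmod (F s)) in *.
    assert (L := Cmod_le_Re_Im (F s)). rewrite (Rabs_pos_eq (Re _)) in L by lra. fold A in L.
    assert (L2 : Rabs (Im (w n)) <= A). { rewrite Es. eapply Rle_trans; [|apply Rmax_Cmod]. apply Rmax_r. }
    assert (L3 : Rabs (Im (w n) * Im (F s)) <= A * (kap/4 * Re (F s))).
    { rewrite Rabs_mult. apply Rmult_le_compat; auto; apply Rabs_pos. }
    apply Rabs_le_between in L3. rewrite <- Es in HN0.
    set (X := Re (F s)) in *.
    apply Rmult_le_reg_r with (A * A). nra. unfold Rdiv at 2. rewrite Rmult_assoc, Rinv_l, Rmult_1_r by nra.
    assert (L4 : kap * A * X <= Re (w n) * X) by (apply Rmult_le_compat_r; lra).
    assert (L5 : A * A <= A * ((1 + kap/4) * X)) by (apply Rmult_le_compat_l; lra).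
    assert (0 < A * X) by nra. nra. }
  exists (RtoC s * z)%C. rewrite Re_scal, Cmod_scal by lra. rewrite Ez.
  split. nra. split. lra.
  assert (K := H1 s z ltac:(lra) ltac:(lra) Rez).
  replace (z * F s)%C with (w n) in K by (unfold z; field; auto).
  eapply Rle_trans. exact K. rewrite Es.
  assert (T := Cmod_plus_conj_ge (F (RtoC s * z)%C) (w n)).
  assert (Pz : 0 < Re (F (RtoC s * z)%C)).
  { apply (iso_pos F F_iso). rewrite Re_scal. apply Rmult_lt_0_compat; lra. }
  unfold e1. rewrite Rmult_assoc. apply Rmult_le_compat_l; lra.
Qed.

Lemma Cmod_le_of_pseudo x y : Cmod (x - y)%C <= / 2 * Cmod (x + Cconj y)%C -> Cmod x <= 3 * Cmod y /\ Cmod y <= 3 * Cmod x.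
Proof.
  intros H. assert (T := Cmod_triangle x (Cconj y)). rewrite Cmod_conj in T.
  assert (T1 := Cmod_minus_ge x y). assert (T2 := Cmod_minus_ge y x). rewrite Cmod_minus_sym in T2.
  split; lra.
Qed.

(** Schwarz-Pick with base point 1 gives |F z| (X - Y) <= |F 1| (X + Y) for X = |z + 1| and Y = |z -
    1|, and (X - Y) (X + Y) = 4 Re z >= 4 kap. *)
Lemma iso_bounded_on_sector kap R0 : 0 < kap -> 1 <= R0 ->
  exists K, forall z, 1 <= Cmod z <= R0 -> kap * Cmod z <= Re z -> Cmod (F z) <= K.
Proof.
  intros Hk HR. exists (Cmod (F 1) * ((2 * (R0 + 1)) * (2 * (R0+1)) / (4 * kap))).
  intros z Hz Hzk.
  assert (Pz : 0 < Re z) by nra. assert (P1 : 0 < Re 1) by (unfold Re; simpl; lra).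
  assert (G := schwarz_pick_half F (iso_diff F F_iso) (iso_pos F F_iso) z 1 Pz P1).
  assert (E := Cmod_minus_plus_sq z 1).
  set (X := Cmod (z + Cconj 1)%C) in *. set (Y := Cmod (z - 1)%C) in *.
  assert (HX : 0 <= X) by apply Cmod_ge_0. assert (HY : 0 <= Y) by apply Cmod_ge_0.
  assert (T1 := Cmod_minus_ge (F z) (F 1)). assert (T2 := Cmod_triangle (F z) (Cconj (F 1))). rewrite Cmod_conj in T2.
  assert (HX2 : X <= R0 + 1). { unfold X. eapply Rle_trans. apply Cmod_triangle. rewrite Cmod_conj, Cmod_1. lra. }
  assert (HY2 : Y <= R0 + 1). { unfold Y. eapply Rle_trans. apply Cmod_minus_le. rewrite Cmod_1. lra. }
  assert (PF1 := Cmod_ge_0 (F 1)). assert (PFz := Cmod_ge_0 (F z)).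
  unfold Re at 2 in E; simpl in E.
  assert (E2 : 4 * kap <= (X - Y) * (X + Y)) by nra.
  assert (G2 : Cmod (F z) * (X - Y) <= Cmod (F 1) * (X + Y)) by nra.
  assert (HXY : 0 < X + Y) by nra.
  assert (G3 : Cmod (F z) * (4 * kap) <= Cmod (F 1) * ((2 * (R0 + 1)) * (2 * (R0+1)))).
  { apply Rle_trans with (Cmod (F z) * ((X - Y) * (X + Y))). apply Rmult_le_compat_l; auto.
    apply Rle_trans with (Cmod (F 1) * ((X + Y) * (X + Y))).
    - rewrite <- !Rmult_assoc. apply Rmult_le_compat_r; lra.
    - apply Rmult_le_compat_l; auto. apply Rmult_le_compat; lra. }
  apply Rmult_le_reg_r with (4 * kap). lra. eapply Rle_trans. exact G3. right. field. lra.
Qed.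

(** Here b is the shadow a of w n divided by lam^n. Iterates of f do not increase pseudo-hyperbolic
    distance, so F (lam^m b) is as close to w m, for every m <= n, as F a is to w n. That r0 and R0
    depend neither on n nor on eps prepares the extraction of a limit. *)
Lemma orbit_shadow_base kap N0 k w : half_orbit f k w -> 0 < kap <= 1 ->
  (forall n, (N0 <= n)%nat -> kap * Cmod (w n) <= Re (w n)) ->
  exists r0 R0, 0 < r0 /\ forall eps, 0 < eps <= / 2 -> exists N, forall n, (N <= n)%nat -> exists b,
    kap / 2 * Cmod b <= Re b /\ r0 <= Cmod b <= R0 /\
    forall m, (m <= n)%nat -> Cmod (F (dil lam m b) - w m)%C <= eps * (4 * Cmod (w m)).
Proof.
  intros Hw Hkap HN0.
  set (k1 := kap / 2). assert (Hk1 : 0 < k1) by (unfold k1; lra).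
  destruct (iso_infty F F_iso k1 (3 * Cmod (w 0%nat)) Hk1) as [R0 HR0].
  destruct (iso_bounded_on_sector k1 lam Hk1 ltac:(lra)) as [K HK].
  destruct (orb_infty f k w Hw (3 * K)) as [M0 HM0].
  assert (Hpow : forall j, 0 < lam ^ j) by (intros j; apply pow_lt; lra).
  exists (/ lam ^ M0), R0. split. { apply Rinv_0_lt_compat; auto. }
  intros eps He.
  destruct (orbit_shadow kap N0 k w Hw Hkap HN0 eps ltac:(lra)) as [N HN].
  exists (N + M0)%nat. intros n Hn. destruct (HN n ltac:(lia)) as (a & Ha1 & Ha2 & Ha3). fold k1 in Ha1.
  assert (Pa : 0 < Re a) by nra.
  set (b := (RtoC (/ lam ^ n) * a)%C).
  assert (Hin : 0 < / lam ^ n) by (apply Rinv_0_lt_compat; auto).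
  assert (Nn : RtoC (lam ^ n) <> 0) by (intros E; injection E; intros E'; assert (H := Hpow n); lra).
  assert (Ea : forall m, (m <= n)%nat -> (RtoC (lam ^ (n - m)) * (dil lam m b))%C = a).
  { intros m Hm. unfold b. rewrite RtoC_inv by (assert (H := Hpow n); lra).
    replace (lam ^ n) with (lam ^ (n - m) * lam ^ m) in * by (rewrite <- pow_add; f_equal; lia).
    rewrite RtoC_mult in *. field. split; intros E; apply Nn; rewrite E; ring. }
  assert (Pb : 0 < Re b) by (unfold b; rewrite Re_scal; apply Rmult_lt_0_compat; auto).
  assert (Hb1 : k1 * Cmod b <= Re b).
  { unfold b. rewrite Re_scal, Cmod_scal by lra. nra. }
  assert (Hps : forall m, (m <= n)%nat -> Cmod (F (dil lam m b) - w m)%C <= eps * Cmod (F (dil lam m b) + Cconj (w m))%C).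
  { intros m Hm. assert (G := iterate_contract eps (n - m) (F a) (w n) (iso_pos F F_iso _ Pa) (orb_pos f k w Hw n) Ha3).
    destruct G as [G _].
    assert (E1 : Nat.iter (n - m) f (F a) = F (dil lam m b)).
    { rewrite <- (Ea m Hm). apply iterate_F. rewrite Re_scal. apply Rmult_lt_0_compat; auto. }
    assert (E2 : Nat.iter (n - m) f (w n) = w m).
    { replace n with (m + (n - m))%nat at 2 by lia. apply (iterate_orbit k); auto. }
    rewrite E1, E2 in G. auto. }
  assert (Hps2 : forall m, (m <= n)%nat -> Cmod (F (dil lam m b)) <= 3 * Cmod (w m) /\ Cmod (w m) <= 3 * Cmod (F (dil lam m b))).
  { intros m Hm. apply Cmod_le_of_pseudo. eapply Rle_trans. apply Hps; auto.
    apply Rmult_le_compat_r. apply Cmod_ge_0. lra. }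
  exists b. split; auto. split; [split|].
  (* Were |b| below lam^(-M0), some lam^(m+1) b with m >= M0 would have modulus between 1 and lam,
     where |F| <= K; but |w (S m)| > 3 K. *)
  - apply Rnot_lt_le. intros Hlt.
    assert (Ex : forall j, 1 <= lam ^ (M0 + j) * Cmod b -> exists m, (M0 <= m < M0 + j)%nat /\ lam ^ m * Cmod b < 1 <= lam ^ (S m) * Cmod b).
    { induction j; intros Hj.
      - exfalso. rewrite Nat.add_0_r in Hj. apply Rmult_lt_compat_l with (r := lam ^ M0) in Hlt; auto.
        rewrite Rinv_r in Hlt. lra. apply Rgt_not_eq, Hpow.
      - destruct (Rle_lt_dec 1 (lam ^ (M0 + j) * Cmod b)) as [H|H].
        + destruct (IHj H) as (m & Hm & Hm'). exists m. split; auto. lia.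
        + exists (M0 + j)%nat. split. lia. rewrite Nat.add_succ_r in Hj. auto. }
    destruct (Ex (n - M0)%nat) as (m & Hm & Hm1 & Hm2).
    { replace (M0 + (n - M0))%nat with n by lia. unfold b. rewrite Cmod_scal by lra.
      rewrite <- Rmult_assoc, Rinv_r by (apply Rgt_not_eq, Hpow). lra. }
    assert (B : Cmod (F (dil lam (S m) b)) <= K).
    { apply HK; rewrite ?Re_scal, Cmod_scal by (left; auto).
      - split; auto. simpl. nra.
      - assert (H := Hpow (S m)). nra. }
    destruct (Hps2 (S m) ltac:(lia)) as [_ B2]. assert (B3 := HM0 (S m) ltac:(lia)). lra.
  - apply Rnot_lt_le. intros Hlt. specialize (HR0 b Hlt Hb1).
    destruct (Hps2 0%nat ltac:(lia)) as [B _]. simpl in B. rewrite Cmult_1_l in B. lra.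
  - intros m Hm. eapply Rle_trans. apply Hps; auto. apply Rmult_le_compat_l. lra.
    eapply Rle_trans. apply Cmod_triangle. rewrite Cmod_conj. destruct (Hps2 m Hm). lra.
Qed.

Lemma orbit_in_image k w : 0 <= k < 1 -> half_orbit f k w ->
  exists b, 0 < Re b /\ forall n, w n = F (dil lam n b).
Proof.
  intros Hk Hw. destruct exists_pulled_in as (v & Hv & Hfv).
  destruct (half_orbit_nontangential f k w v f_diff f_pos Hk Hw Hv Hfv) as (kap & N0 & Hkap & HN0).
  destruct (orbit_shadow_base kap N0 k w Hw Hkap HN0) as (r0 & R0 & Hr0 & Hsh).
  assert (Hpow : forall j, 0 < lam ^ j) by (intros j; apply pow_lt; lra).
  (* The tolerance 1 / (j + 2) tends to 0 and never exceeds the 1/2 allowed by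
     [orbit_shadow_base]. *)
  assert (Hseq : forall j : nat, exists b, kap / 2 * Cmod b <= Re b /\ r0 <= Cmod b <= R0 /\
    forall m, (m <= j)%nat -> Cmod (F (dil lam m b) - w m)%C <= / (INR j + 2) * (4 * Cmod (w m))).
  { intros j. assert (Hj := pos_INR j). destruct (Hsh (/ (INR j + 2))) as [N HN].
    { split. apply Rinv_0_lt_compat; lra. apply Rinv_le_contravar; lra. }
    destruct (HN (N + j)%nat ltac:(lia)) as (b & B1 & B2 & B3). exists b. repeat split; auto; try apply B2.
    intros m Hm. apply B3. lia. }
  set (bb := fun j => proj1_sig (constructive_indefinite_description _ (Hseq j))).
  assert (Hbb : forall j, kap / 2 * Cmod (bb j) <= Re (bb j) /\ r0 <= Cmod (bb j) <= R0 /\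
    forall m, (m <= j)%nat -> Cmod (F (dil lam m (bb j)) - w m)%C <= / (INR j + 2) * (4 * Cmod (w m))).
  { intros j. exact (proj2_sig (constructive_indefinite_description _ (Hseq j))). }
  destruct (bolzano_weierstrass_C bb R0) as [b Hb]. { intros n. apply Hbb. }
  assert (Pb : 0 < Re b).
  { set (q := kap / 2 * r0). assert (Hq : 0 < q) by (unfold q; nra).
    destruct (Hb (q / 2) 0%nat ltac:(lra)) as (n & _ & Hn).
    destruct (Hbb n) as (B1 & B2 & _).
    assert (T := re_le_Cmod (bb n - b)%C). assert (E : Re (bb n - b)%C = Re (bb n) - Re b) by reflexivity.
    rewrite E in T. apply Rabs_le_between in T. assert (q <= Re (bb n)) by (unfold q; nra). lra. }
  exists b. split; auto. intros m.
  assert (Z : Cmod (F (dil lam m b) - w m)%C <= 0).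
  { apply le_epsilon. intros e He. rewrite Rplus_0_l.
    assert (Hc : ccont (fun x => F (dil lam m x)) b).
    { apply (ccont_comp F (fun x => RtoC (lam ^ m) * x)%C). apply ccont_mult. apply ccont_const. apply ccont_id.
      apply cdiff_ccont, (iso_diff F F_iso). rewrite Re_scal. apply Rmult_lt_0_compat; auto. }
    destruct (Hc (e/2) ltac:(lra)) as (d & Hd & HK).
    set (q := e / (2 * (4 * Cmod (w m) + 1))).
    assert (Pw := Cmod_ge_0 (w m)).
    assert (Hq : 0 < q) by (apply Rdiv_lt_0_compat; lra).
    destruct (archimed_cor1 q Hq) as (N & HN & HN1).
    destruct (Hb d (N + m)%nat Hd) as (j & Hj & Hjd).
    specialize (HK _ Hjd). destruct (Hbb j) as (_ & _ & B3). specialize (B3 m ltac:(lia)).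
    assert (HiN : / (INR j + 2) <= q).
    { left. eapply Rlt_trans. 2: exact HN. apply Rinv_lt_contravar.
      - apply Rmult_lt_0_compat. apply lt_0_INR; lia. assert (H := pos_INR j). lra.
      - assert (INR N <= INR j) by (apply le_INR; lia). lra. }
    replace (F (dil lam m b) - w m)%C with
      (- (F (dil lam m (bb j)) - F (dil lam m b)) + (F (dil lam m (bb j)) - w m))%C by ring.
    eapply Rle_trans. apply Cmod_triangle. rewrite Cmod_opp.
    assert (/ (INR j + 2) * (4 * Cmod (w m)) <= q * (4 * Cmod (w m))) by (apply Rmult_le_compat_r; lra).
    assert (q * (4 * Cmod (w m)) <= e / 2).
    { apply Rle_trans with (q * (4 * Cmod (w m) + 1)). apply Rmult_le_compat_l; lra.
      unfold q. right. field. lra. }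
    lra. }
  assert (Z0 := Cmod_ge_0 (F (dil lam m b) - w m)%C).
  assert (Z1 : (F (dil lam m b) - w m)%C = 0) by (apply Cmod_eq_0; lra).
  symmetry. replace (F (dil lam m b)) with ((F (dil lam m b) - w m) + w m)%C by ring. rewrite Z1. ring.
Qed.

End Identification.

(** * Summability of the distortion along orbits *)

Definition psum (a : nat -> R) (n : nat) : R := sum_n a n.

Lemma psum_S (a : nat -> R) n : psum a (S n) = psum a n + a (S n).
Proof. apply (@sum_Sn R_AbelianMonoid). Qed.
Lemma psum_0 (a : nat -> R) : psum a 0%nat = a 0%nat.
Proof. apply (@sum_O R_AbelianMonoid). Qed.
Lemma ex_series_bounded (a : nat -> R) (B : R) : (forall n, 0 <= a n) ->
  (forall n, psum a n <= B) -> ex_series a.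
Proof.
  intros Ha HB. change (ex_finite_lim_seq (psum a)). apply ex_finite_lim_seq_incr with B.
  - intros n. rewrite psum_S. specialize (Ha (S n)). lra.
  - exact HB.
Qed.

Lemma ex_series_telescope (y : nat -> R) : (forall n, 0 <= y n) -> (forall n, y (S n) <= y n) ->
  ex_series (fun n => y n - y (S n)).
Proof.
  intros Hy Hd. apply ex_series_bounded with (y 0%nat).
  - intros n. specialize (Hd n). lra.
  - assert (E : forall n, psum (fun n => y n - y (S n)) n = y 0%nat - y (S n)).
    { induction n. rewrite psum_0; auto. rewrite psum_S, IHn. ring. }
    intros n. rewrite E. specialize (Hy (S n)). lra.
Qed.

Lemma ex_series_le_pos (a b : nat -> R) : (forall n, 0 <= a n <= b n) -> ex_series b -> ex_series a.
Proof.
  intros H Hb. apply (@ex_series_le R_AbsRing R_CompleteNormedModule a b); auto. intros n. specialize (H n).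
  change (Rabs (a n) <= b n). rewrite Rabs_pos_eq; lra.
Qed.

Lemma ex_series_shift (a : nat -> R) N : ex_series a <-> ex_series (fun n => a (N + n)%nat).
Proof. apply (@ex_series_incr_n R_AbsRing R_NormedModule a N). Qed.
Lemma ex_series_scal_R c (a : nat -> R) : ex_series a -> ex_series (fun n => c * a n).
Proof. intros H. apply (@ex_series_scal R_AbsRing R_NormedModule c a H). Qed.
Lemma ex_series_plus_R (a b : nat -> R) : ex_series a -> ex_series b -> ex_series (fun n => a n + b n).
Proof. intros H1 H2. apply (@ex_series_plus R_AbsRing R_NormedModule a b H1 H2). Qed.
Lemma psum_le_series (b : nat -> R) : (forall n, 0 <= b n) -> ex_series b -> exists B, forall n, psum b n <= B.
Proof.
  intros Hb [l Hl]. exists l. intros n.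
  apply (is_lim_seq_incr_compare (psum b) l); auto.
  intros k. rewrite psum_S. specialize (Hb (S k)). lra.
Qed.

(** Summing the recursion from N on bounds c - 1 times each partial sum of a by A plus the sum of b:
    the boundedness of a rules out actual expansion. *)
Lemma expanding_summable (a b : nat -> R) (c A : R) N : 1 < c ->
  (forall n, 0 <= a n <= A) -> (forall n, 0 <= b n) -> ex_series b ->
  (forall n, (N <= n)%nat -> c * a n <= a (S n) + b n) -> ex_series a.
Proof.
  intros Hc Ha Hb Hsb H.
  apply (ex_series_shift a N). apply (ex_series_shift b N) in Hsb.
  destruct (psum_le_series _ (fun n => Hb (N + n)%nat) Hsb) as [B HB].
  assert (P : forall n, (c - 1) * psum (fun n => a (N + n)%nat) n <= a (N + S n)%nat + psum (fun n => b (N + n)%nat) n - a (N + 0)%nat).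
  { induction n.
    - rewrite !psum_0. assert (H1 := H (N + 0)%nat ltac:(lia)). rewrite Nat.add_succ_r. lra.
    - rewrite !psum_S. assert (H1 := H (N + S n)%nat ltac:(lia)).
      rewrite (Nat.add_succ_r N (S n)). lra. }
  apply ex_series_bounded with ((A + B) / (c - 1)). intros n; apply Ha.
  intros n. specialize (P n). specialize (HB n). assert (H1 := Ha (N + S n)%nat). assert (H2 := Ha (N+0)%nat).
  apply Rmult_le_reg_l with (c - 1). lra. replace ((c - 1) * ((A + B) / (c - 1))) with (A + B) by (field; lra). lra.
Qed.

(** Beyond an index M where the tail of d sums to at most 1/2, the product of the 1 - d_i is at
    least 1 minus the sum of the d_i, which keeps y above half of y M. *)
Lemma infinite_product_pos (y d : nat -> R) N : (forall n, 0 < y n) -> (forall n, 0 <= d n) -> ex_series d ->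
  (forall n, (N <= n)%nat -> (1 - d n) * y n <= y (S n)) ->
  exists c M, 0 < c /\ forall n, (M <= n)%nat -> c <= y n.
Proof.
  intros Hy Hd Hs H.
  assert (HM : exists M, (N <= M)%nat /\ forall k, psum (fun n => d (M + n)%nat) k <= / 2).
  { destruct Hs as [l Hl].
    assert (Hl' : is_lim_seq (psum d) l) by exact Hl.
    apply is_lim_seq_spec in Hl'. destruct (Hl' (mkposreal (/2) ltac:(lra))) as [M0 HM0]. simpl in HM0.
    exists (S (M0 + N)). split. lia. intros k.
    assert (E : psum (fun n => d (S (M0 + N) + n)%nat) k = psum d (S (M0 + N) + k) - psum d (M0 + N)).
    { induction k. rewrite psum_0, Nat.add_0_r, psum_S. ring.
      rewrite psum_S, IHk, Nat.add_succ_r, psum_S. ring. }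
    rewrite E.
    assert (L : psum d (S (M0 + N) + k) <= l).
    { apply (is_lim_seq_incr_compare (psum d) l); auto.
      intros j. rewrite psum_S. specialize (Hd (S j)). lra. }
    assert (L2 := HM0 (M0 + N)%nat ltac:(lia)). apply Rabs_def2 in L2. lra. }
  destruct HM as (M & HMN & HM).
  exists (y M / 2), M. split. specialize (Hy M); lra.
  assert (P : forall k, (1 - psum (fun n => d (M + n)%nat) k) * y M <= y (M + S k)%nat).
  { induction k.
    - rewrite psum_0, Nat.add_0_r, Nat.add_succ_r, Nat.add_0_r. apply H. auto.
    - rewrite psum_S. rewrite (Nat.add_succ_r M (S k)).
      set (s := psum (fun n => d (M + n)%nat) k) in *. assert (Hs' := HM k). fold s in Hs'.
      assert (Hs0 : 0 <= s). { unfold s. clear -Hd. induction k. rewrite psum_0; auto. rewrite psum_S. specialize (Hd (M + S k)%nat). lra. }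
      assert (G := H (M + S k)%nat ltac:(lia)). assert (HmSk := HM (S k)). rewrite psum_S in HmSk. fold s in HmSk.
      assert (D := Hd (M + S k)%nat). assert (Y := Hy M).
      eapply Rle_trans. 2: exact G.
      apply Rle_trans with ((1 - d (M + S k)%nat) * ((1 - s) * y M)).
      + assert (0 <= s * d (M + S k)%nat * y M) by (apply Rmult_le_pos; [apply Rmult_le_pos|]; lra). cbv beta. lra.
      + apply Rmult_le_compat_l; lra. }
  intros n Hn. destruct (Nat.eq_dec n M) as [->|Hne]. { specialize (Hy M); lra. }
  replace n with (M + S (n - S M))%nat by lia. eapply Rle_trans. 2: apply P.
  assert (G := HM (n - S M)%nat). assert (Y := Hy M). nra.
Qed.

Section RealOrbit.

Variables (F : C -> C) (lam : R).
Hypothesis lam_gt_1 : 1 < lam.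
Hypothesis F_iso : isogonal_self_map F.

(* Vanishes when F preserves the hyperbolic distance of lam^n b and lam^(n+1) b. *)
Definition hyp_defect (b : C) (n : nat) : R :=
  1 - Cmod (hyp_quot F (dil lam n b) (dil lam (S n) b)).

Lemma lam_pow_pos n : 0 < lam ^ n.
Proof. apply pow_lt; lra. Qed.
Lemma scale_pos n b : 0 < Re b -> 0 < Re (dil lam n b).
Proof. intros. rewrite Re_scal. apply Rmult_lt_0_compat; auto. apply lam_pow_pos. Qed.
Lemma scale_neq n a b : a <> b -> (dil lam n a) <> (dil lam n b).
Proof.
  intros Hab E. assert (H := lam_pow_pos n).
  assert (N : RtoC (lam ^ n) <> 0) by (intros E'; injection E'; lra).
  apply Hab. replace a with (/ RtoC (lam ^ n) * (dil lam n a))%C by (field; auto).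
  rewrite E. field; auto.
Qed.

Lemma scale_lam_neq b : 0 < Re b -> (RtoC lam * b)%C <> b.
Proof.
  intros Hb E. apply (f_equal Re) in E. rewrite Re_scal in E. nra.
Qed.

Lemma scale_S n b : (dil lam (S n) b) = (dil lam n (RtoC lam * b)).
Proof. simpl. rewrite RtoC_mult. ring. Qed.
Lemma hyp_defect_bounds b n : 0 < Re b -> 0 <= hyp_defect b n <= 1.
Proof.
  intros Hb. unfold hyp_defect. assert (H := Cmod_ge_0 (hyp_quot F (dil lam n b) (dil lam (S n) b))).
  assert (Cmod (hyp_quot F (dil lam n b) (dil lam (S n) b)) <= 1).
  { apply hyp_quot_le_1; try apply F_iso; try (apply scale_pos; auto).
    rewrite scale_S. apply scale_neq, scale_lam_neq; auto. }
  lra.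
Qed.

Lemma hyp_quot_sym f a b : (forall z, 0 < Re z -> 0 < Re (f z)) -> 0 < Re a -> 0 < Re b -> a <> b ->
  Cmod (hyp_quot f a b) = Cmod (hyp_quot f b a).
Proof.
  intros Hf Ha Hb Hab. unfold hyp_quot.
  assert (S1 : forall x y, Cmod (x + Cconj y)%C = Cmod (y + Cconj x)%C).
  { intros x y. rewrite <- Cmod_conj. f_equal. destruct x, y. C_coords. f_equal; ring. }
  assert (P1 : forall x y : C, 0 < Re x -> 0 < Re y -> (x + Cconj y)%C <> 0) by (apply half_plus_neq_0).
  assert (P2 : ((b - a) / (b + Cconj a))%C <> 0).
  { apply Cmult_neq_0. apply Cminus_neq_0; auto. intros E. assert (Q := P1 b a Hb Ha). apply C1_nz. rewrite <- (Cinv_r _ Q), E. ring. }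
  assert (P3 : ((a - b) / (a + Cconj b))%C <> 0).
  { apply Cmult_neq_0. apply Cminus_neq_0; auto. intros E. assert (Q := P1 a b Ha Hb). apply C1_nz. rewrite <- (Cinv_r _ Q), E. ring. }
  rewrite !Cmod_div; auto. rewrite (Cmod_minus_sym (f b)), (S1 (f b)), (Cmod_minus_sym b), (S1 b). auto.
Qed.

(** [three_point] at scale lam^n. The pseudo-hyperbolic distance k of a' and a is invariant under
    dilations, so c does not depend on n. *)
Lemma defect_compare a a' b : 0 < Re a -> 0 < Re a' -> 0 < Re b -> a <> b -> a' <> b ->
  exists c, 0 <= c /\ forall n,
    1 - Cmod (hyp_quot F (dil lam n b) (dil lam n a')) <=
    c * (1 - Cmod (hyp_quot F (dil lam n b) (dil lam n a))).
Proof.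
  intros Ha Ha' Hb Hab Ha'b.
  set (k := Cmod (a' - a)%C / Cmod (a' + Cconj a)%C).
  assert (P := Cmod_half_pos a' a Ha' Ha). assert (P0 := Cmod_ge_0 (a' - a)%C).
  assert (Hk : 0 <= k < 1).
  { split. apply Rdiv_le_0_compat; auto.
    assert (E := Cmod_minus_plus_sq a' a). apply Rmult_lt_reg_r with (1 := P). unfold k.
    assert (0 < Re a' * Re a) by (apply Rmult_lt_0_compat; auto).
    field_simplify; [|lra]. nra. }
  exists (2 * k / (1 - k) + 1). split.
  { assert (0 <= 2 * k / (1 - k)). { apply Rdiv_le_0_compat; lra. } lra. }
  intros n. assert (Hn := lam_pow_pos n).
  assert (T := three_point F (iso_diff F F_iso) (iso_pos F F_iso) (dil lam n a) (dil lam n a') (dil lam n b) k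
    (scale_pos n a Ha) (scale_pos n a' Ha') (scale_pos n b Hb) (scale_neq n _ _ Hab) (scale_neq n _ _ Ha'b) Hk).
  assert (G : Cmod (RtoC (lam ^ n) * a' - RtoC (lam ^ n) * a)%C <= k * Cmod (RtoC (lam ^ n) * a' + Cconj (dil lam n a))%C).
  { replace (RtoC (lam ^ n) * a' - RtoC (lam ^ n) * a)%C with (RtoC (lam ^ n) * (a' - a))%C by ring.
    replace (RtoC (lam ^ n) * a' + Cconj (dil lam n a))%C with (RtoC (lam ^ n) * (a' + Cconj a))%C.
    2:{ destruct a, a'. C_coords. f_equal; ring. }
    rewrite !Cmod_scal by lra. unfold k. right. field. lra. }
  specialize (T G).
  set (e := hyp_quot F (dil lam n b) (dil lam n a)) in *.
  set (e' := hyp_quot F (dil lam n b) (dil lam n a')) in *.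
  assert (T2 := Cmod_minus_ge e e'). rewrite Cmod_minus_sym in T2. lra.
Qed.

(** [defect_compare] moves one point of a pair, so the pair (b, lam b) is compared with (a, lam a)
    through (b, lam a), the roles of its points being exchanged by [hyp_quot_sym]. The assumption
    keeps the points of the mixed pair distinct. *)
Lemma defect_transfer a b : 0 < Re a -> 0 < Re b -> (RtoC lam * a)%C <> b ->
  exists c, 0 <= c /\ forall n, hyp_defect b n <= c * hyp_defect a n /\ hyp_defect a n <= c * hyp_defect b n.
Proof.
  intros Ha Hb Hab.
  assert (Hla : 0 < Re (RtoC lam * a)%C) by (rewrite Re_scal; apply Rmult_lt_0_compat; lra).
  assert (Hlb : 0 < Re (RtoC lam * b)%C) by (rewrite Re_scal; apply Rmult_lt_0_compat; lra).
  assert (Na := scale_lam_neq a Ha). assert (Nb := scale_lam_neq b Hb).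
  destruct (defect_compare (RtoC lam * a)%C (RtoC lam * b)%C b Hla Hlb Hb Hab Nb) as (c1 & C1 & D1).
  destruct (defect_compare (RtoC lam * b)%C (RtoC lam * a)%C b Hlb Hla Hb Nb Hab) as (c2 & C2 & D2).
  destruct (defect_compare a b (RtoC lam * a)%C Ha Hb Hla (not_eq_sym Na) (not_eq_sym Hab)) as (c3 & C3 & D3).
  destruct (defect_compare b a (RtoC lam * a)%C Hb Ha Hla (not_eq_sym Hab) (not_eq_sym Na)) as (c4 & C4 & D4).
  assert (Sy : forall n, Cmod (hyp_quot F (dil lam n b) (dil lam n (RtoC lam * a))) = Cmod (hyp_quot F (dil lam n (RtoC lam * a)) (dil lam n b))).
  { intros n. apply hyp_quot_sym; try apply F_iso; try (apply scale_pos; auto). apply scale_neq; auto. }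
  assert (Sa : forall n, Cmod (hyp_quot F (dil lam n a) (dil lam n (RtoC lam * a))) = Cmod (hyp_quot F (dil lam n (RtoC lam * a)) (dil lam n a))).
  { intros n. apply hyp_quot_sym; try apply F_iso; try (apply scale_pos; auto). apply scale_neq; auto. }
  exists (c1 * c3 + c4 * c2). split. nra. intros n.
  assert (Ba := hyp_defect_bounds a n Ha). assert (Bb := hyp_defect_bounds b n Hb).
  unfold hyp_defect in *. rewrite !scale_S in *.
  specialize (D1 n). specialize (D2 n). specialize (D3 n). specialize (D4 n).
  rewrite Sa in *. rewrite Sy in D1, D2.
  set (A := 1 - Cmod (hyp_quot F (dil lam n (RtoC lam * a)) (dil lam n a))) in *.
  set (B := 1 - Cmod (hyp_quot F (dil lam n b) (dil lam n (RtoC lam * b)))) in *.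
  set (M := 1 - Cmod (hyp_quot F (dil lam n (RtoC lam * a)) (dil lam n b))) in *.
  assert (Q1 : c1 * M <= c1 * (c3 * A)) by (apply Rmult_le_compat_l; auto).
  assert (Q2 : c4 * M <= c4 * (c2 * B)) by (apply Rmult_le_compat_l; auto).
  assert (0 <= c4 * c2 * A) by (apply Rmult_le_pos; [apply Rmult_le_pos|]; lra).
  assert (0 <= c1 * c3 * B) by (apply Rmult_le_pos; [apply Rmult_le_pos|]; lra).
  split; lra.
Qed.

(** With p' and p the two values, Schwarz-Pick for real parts reduces on the real axis to (l Re p' -
    Re p) (Re p' - l Re p) <= 0, which confines the ratio of the real parts to the interval from 1/l
    to l. *)
Lemma Re_F_real_decr s l : 0 < s -> 1 < l ->
  Re (F (RtoC (l * s))) <= l * Re (F s).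
Proof.
  intros Hs Hl.
  assert (P1 : 0 < Re (RtoC (l * s))) by (unfold Re; simpl; nra). assert (P2 : 0 < Re s) by (unfold Re; simpl; lra).
  assert (G := schwarz_pick_half_Re F (iso_diff F F_iso) (iso_pos F F_iso) _ _ P1 P2).
  assert (X1 := iso_pos F F_iso _ P1). assert (X2 := iso_pos F F_iso _ P2).
  set (p' := F (RtoC (l * s))) in *. set (p := F s) in *.
  assert (E : Cmod (RtoC (l * s) + Cconj (RtoC s))%C = (l + 1) * s).
  { replace (RtoC (l * s) + Cconj (RtoC s))%C with (RtoC ((l + 1) * s)).
    rewrite Cmod_R, Rabs_pos_eq; nra. C_coords. f_equal; ring. }
  rewrite E in G. assert (T := Cmod_plus_conj_ge p' p).
  replace (Re (RtoC (l * s))) with (l * s) in G by reflexivity. replace (Re s) with s in G by reflexivity.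
  assert (G2 : l * s * s * ((Re p' + Re p) * (Re p' + Re p)) <= Re p' * Re p * ((l + 1) * s * ((l + 1) * s))).
  { eapply Rle_trans. 2: exact G. apply Rmult_le_compat_l. nra. apply Rmult_le_compat; lra. }
  assert (G3 : l * ((Re p' + Re p) * (Re p' + Re p)) <= Re p' * Re p * ((l + 1) * (l + 1))).
  { apply Rmult_le_reg_r with (s * s). nra. lra. }
  apply Rnot_lt_le. intros Hlt.
  assert (0 < (l * Re p' - Re p) * (Re p' - l * Re p)).
  { apply Rmult_lt_0_compat; nra. }
  lra.
Qed.

(** * Radial growth and sideways motion along the real axis *)

Section RealAxis.

Variable t : R.
Hypothesis t_pos : 0 < t.

(** The affine automorphism of the half plane that sends p n to 1 sends p (S n) to q n + i eta n, so
    q is the radial growth and eta the sideways motion of one step. Up to the factor t, y n is Re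
    F(s) / s at s = lam^n t. *)
Let p (n : nat) : C := F (dil lam n (RtoC t)).
Let y (n : nat) : R := Re (p n) / lam ^ n.
Let q (n : nat) : R := Re (p (S n)) / Re (p n).
Let eta (n : nat) : R := (Im (p (S n)) - Im (p n)) / Re (p n).

Lemma p_pos n : 0 < Re (p n).
Proof. apply (iso_pos F F_iso), scale_pos. unfold Re; simpl; auto. Qed.
Lemma p_decr n : Re (p (S n)) <= lam * Re (p n).
Proof.
  unfold p. assert (H := Re_F_real_decr (lam ^ n * t) lam).
  rewrite <- !RtoC_mult. replace (lam ^ S n * t) with (lam * (lam ^ n * t)) by (simpl; ring).
  apply H; auto. apply Rmult_lt_0_compat; auto. apply lam_pow_pos.
Qed.

Lemma y_decr n : y (S n) <= y n.
Proof.
  assert (H := p_decr n). assert (Hn := lam_pow_pos n). unfold y. simpl (lam ^ S n).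
  apply Rmult_le_reg_r with (lam * lam ^ n). apply Rmult_lt_0_compat; lra.
  field_simplify; lra.
Qed.

Lemma y_pos n : 0 < y n.
Proof. apply Rdiv_lt_0_compat. apply p_pos. apply lam_pow_pos. Qed.
Lemma lam_pow_infty M : exists N, forall n, (N <= n)%nat -> M < lam ^ n * t.
Proof.
  destruct (Pow_x_infinity lam) with (b := (Rabs M + 1) / t) as [N HN].
  { rewrite Rabs_pos_eq; lra. }
  exists N. intros n Hn. specialize (HN n Hn). rewrite Rabs_pos_eq in HN by (left; apply lam_pow_pos).
  assert (H := Rle_abs M). apply Rge_le in HN. apply Rmult_le_compat_r with (r := t) in HN; [|lra].
  replace ((Rabs M + 1) / t * t) with (Rabs M + 1) in HN by (field; lra). lra.
Qed.

Lemma ratio_near eps : 0 < eps -> exists N, forall n, (N <= n)%nat ->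
  Rabs (q n - lam) <= eps /\ Rabs (eta n) <= eps.
Proof.
  intros He. set (e := Rmin 1 (eps / (lam + 2))).
  assert (He1 := Rmin_l 1 (eps / (lam + 2))). assert (He2 := Rmin_r 1 (eps / (lam + 2))). fold e in He1, He2.
  assert (He0 : 0 < e). { apply Rmin_pos. lra. apply Rdiv_lt_0_compat; lra. }
  assert (He3 : (lam + 2) * e <= eps).
  { apply Rmult_le_compat_l with (r := lam + 2) in He2; [|lra]. replace ((lam + 2) * (eps / (lam+2))) with eps in He2 by (field; lra). auto. }
  destruct (isogonal_scale F F_iso lam 1 e) as (S1 & _ & H1); [lra|lra|auto|].
  destruct (isogonal_real F F_iso e He0) as (S2 & _ & H2).
  destruct (lam_pow_infty (Rmax S1 S2)) as [N HN]. assert (M1 := Rmax_l S1 S2). assert (M2 := Rmax_r S1 S2).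
  exists N. intros n Hn. specialize (HN n Hn).
  assert (G1 := H1 (lam ^ n * t) (RtoC lam) ltac:(lra)). rewrite Cmod_R, Rabs_pos_eq in G1 by lra.
  specialize (G1 ltac:(lra) ltac:(unfold Re; simpl; lra)).
  assert (G2 := H2 (lam ^ n * t) ltac:(lra)).
  replace (RtoC (lam ^ n * t) * RtoC lam)%C with (dil lam (S n) (RtoC t)) in G1.
  2:{ rewrite <- !RtoC_mult. f_equal. simpl. ring. }
  rewrite RtoC_mult in G1, G2. fold (p n) (p (S n)) in G1, G2.
  assert (P := p_pos n). set (X := Re (p n)) in *.
  assert (L := Cmod_le_Re_Im (p n)). rewrite (Rabs_pos_eq (Re (p n))) in L by (left; auto). fold X in L.
  assert (T1 : Cmod (p (S n) - RtoC lam * p n)%C <= 2 * e * X).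
  { eapply Rle_trans. exact G1. replace (2 * e * X) with (e * (2 * X)) by ring. apply Rmult_le_compat_l. lra. nra. }
  assert (T2 := re_le_Cmod (p (S n) - RtoC lam * p n)%C).
  assert (T3 : Rabs (Im (p (S n) - RtoC lam * p n)%C) <= 2 * e * X).
  { eapply Rle_trans. 2: exact T1. eapply Rle_trans. 2: apply Rmax_Cmod. apply Rmax_r. }
  replace (Re (p (S n) - RtoC lam * p n)%C) with (Re (p (S n)) - lam * X) in T2.
  2:{ unfold X. destruct (p n), (p (S n)). unfold Re; simpl. ring. }
  replace (Im (p (S n) - RtoC lam * p n)%C) with (Im (p (S n)) - lam * Im (p n)) in T3.
  2:{ destruct (p n), (p (S n)). unfold Im; simpl. ring. }
  apply Rabs_le_between in G2. apply Rabs_le_between in T3.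
  assert (T4 : Rabs (Re (p (S n)) - lam * X) <= 2 * e * X) by lra. apply Rabs_le_between in T4.
  assert (Heps : (lam + 2) * e * X <= eps * X) by (apply Rmult_le_compat_r; lra).
  assert (HlX : 0 < lam * e * X) by (apply Rmult_lt_0_compat; nra).
  split; apply Rabs_le.
  - unfold q. fold X. replace (Re (p (S n)) / X - lam) with ((Re (p (S n)) - lam * X) / X) by (field; lra).
    split; [apply Rle_div_r|apply Rle_div_l]; lra.
  - unfold eta. fold X. split; [apply Rle_div_r|apply Rle_div_l]; nra.
Qed.

Let s1 : R := (lam - 1) / (lam + 1).
Let s2 : R := (lam * lam - 1) / (lam * lam + 1).

(** The dilation cancels: lam^(n + j) t and lam^n t have pseudo-hyperbolic distance (lam^j - 1) /
    (lam^j + 1), whatever n and t. *)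
Lemma pseudo_quot n j : (0 < j)%nat ->
  ((p (n + j)%nat - p n) / (p (n + j)%nat + Cconj (p n)))%C =
  (RtoC ((lam ^ j - 1) / (lam ^ j + 1)) * hyp_quot F (dil lam n (RtoC t)) (RtoC (lam ^ (n + j)) * RtoC t))%C.
Proof.
  intros Hj. unfold hyp_quot. fold (p (n + j)%nat) (p n).
  assert (Hn := lam_pow_pos n). assert (Hj1 : 1 < lam ^ j) by (apply Rlt_pow_R1; auto).
  replace ((RtoC (lam ^ (n+j)) * RtoC t - RtoC (lam ^ n) * RtoC t) / (RtoC (lam ^ (n+j)) * RtoC t + Cconj (dil lam n (RtoC t))))%C
    with (RtoC ((lam ^ j - 1) / (lam ^ j + 1))).
  - assert (Q : 0 < (lam ^ j - 1) / (lam ^ j + 1)) by (apply Rdiv_lt_0_compat; lra).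
    assert (N1 : RtoC ((lam ^ j - 1) / (lam ^ j + 1)) <> 0) by (intros E; injection E; lra).
    assert (N2 := half_plus_neq_0 _ _ (p_pos (n + j)) (p_pos n)).
    field. auto.
  - rewrite pow_add.
    assert (Q1 : 0 < lam ^ n * lam ^ j * t) by (repeat apply Rmult_lt_0_compat; lra).
    assert (Q2 : 0 < lam ^ n * t) by (apply Rmult_lt_0_compat; auto).
    replace (Cconj (dil lam n (RtoC t)))%C with (RtoC (lam ^ n * t)) by (C_coords; f_equal; ring).
    rewrite <- !RtoC_mult, <- RtoC_minus, <- RtoC_plus, <- RtoC_div by lra. f_equal. field. lra.
Qed.

Lemma pseudo_step n : Cmod (p (S n) - p n)%C * (lam + 1) =
  (lam - 1) * Cmod (hyp_quot F (dil lam n (RtoC t)) (dil lam (S n) (RtoC t))) * Cmod (p (S n) + Cconj (p n))%C.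
Proof.
  assert (E := pseudo_quot n 1 ltac:(lia)). rewrite pow_1, Nat.add_1_r in E.
  apply (f_equal Cmod) in E. assert (N := half_plus_neq_0 _ _ (p_pos (S n)) (p_pos n)).
  rewrite Cmod_div in E by auto. rewrite Cmod_scal in E by (left; apply Rdiv_lt_0_compat; lra).
  apply Cmod_gt_0 in N. apply Rmult_eq_reg_r with (/ (Cmod (p (S n) + Cconj (p n))%C * (lam + 1))).
  2:{ apply Rinv_neq_0_compat. nra. }
  transitivity (Cmod (p (S n) - p n)%C / Cmod (p (S n) + Cconj (p n))%C). field; lra. rewrite E. field; lra.
Qed.

(** For given real parts x' and x the pseudo-hyperbolic distance is least when the imaginary parts
    agree, hence at least (x' - x) / (x' + x), which is (lam - 1) / (lam + 1) when x' = lam x. *)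
Lemma defect_le_ratio n : hyp_defect (RtoC t) n <= 2 * (lam * Re (p n) - Re (p (S n))) / ((lam - 1) * Re (p n)).
Proof.
  unfold hyp_defect. assert (E2 := pseudo_step n). assert (HP := Cmod_half_pos _ _ (p_pos (S n)) (p_pos n)).
  set (h := Cmod (hyp_quot F (dil lam n (RtoC t)) (dil lam (S n) (RtoC t)))) in *.
  assert (X := p_pos n). assert (X' := p_pos (S n)). assert (D := p_decr n).
  set (P := Cmod (p (S n) + Cconj (p n))%C) in *.
  set (Dl := Cmod (p (S n) - p n)%C) in *. assert (HDl : 0 <= Dl) by apply Cmod_ge_0.
  set (x := Re (p n)) in *. set (x' := Re (p (S n))) in *.
  assert (Low : (x' - x) * P <= Dl * (x' + x)).
  { assert (Sq := Cmod_minus_plus_sq (p (S n)) (p n)). fold P Dl x x' in Sq.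
    assert (T := Cmod_plus_conj_ge (p (S n)) (p n)). fold P x x' in T.
    destruct (Rle_lt_dec x' x) as [Hle|Hlt]. nra.
    assert (Sq2 : ((x' - x) * P) * ((x' - x) * P) <= (Dl * (x' + x)) * (Dl * (x' + x))).
    { replace ((Dl * (x' + x)) * (Dl * (x' + x))) with ((P * P - 4 * x' * x) * ((x' + x) * (x' + x))) by (rewrite <- Sq; ring).
      assert (Z2 : 4 * x' * x * ((x' + x) * (x' + x)) <= 4 * x' * x * (P * P)) by (apply Rmult_le_compat_l; nra).
      lra. }
    apply Rnot_lt_le. intros Hlt2. assert (0 <= Dl * (x' + x)) by nra. nra. }
  assert (Low2 : (x' - x) * (lam + 1) <= (lam - 1) * h * (x' + x)).
  { apply Rmult_le_reg_r with P; auto. nra. }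
  assert (B : (1 - h) * ((lam - 1) * (x' + x)) <= 2 * (lam * x - x')) by lra.
  apply Rle_div_r. apply Rmult_lt_0_compat; lra.
  destruct (Rle_lt_dec h 1) as [Hh1|Hh1].
  - eapply Rle_trans. 2: exact B. apply Rmult_le_compat_l. lra. apply Rmult_le_compat_l; lra.
  - assert (0 < (lam - 1) * x) by (apply Rmult_lt_0_compat; lra). nra.
Qed.

Lemma growth_defect c : 0 < c -> (forall n, c <= y n) -> ex_series (hyp_defect (RtoC t)).
Proof.
  intros Hc Hy.
  apply ex_series_le_pos with (fun n => (2 * lam / ((lam - 1) * c)) * (y n - y (S n))).
  2:{ apply ex_series_scal_R. apply ex_series_telescope. intros; left; apply y_pos. apply y_decr. }
  intros n. split. apply hyp_defect_bounds; unfold Re; simpl; auto.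
  eapply Rle_trans. apply defect_le_ratio.
  assert (D := p_decr n). assert (Hn := lam_pow_pos n). assert (Yn := Hy n).
  assert (Edy : y n - y (S n) = (lam * Re (p n) - Re (p (S n))) / (lam * lam ^ n)).
  { unfold y. simpl (lam ^ S n). field. lra. }
  rewrite Edy.
  assert (Hcl : c * lam ^ n <= Re (p n)).
  { unfold y in Yn. apply Rmult_le_compat_r with (r := lam ^ n) in Yn; [|lra]. field_simplify in Yn; lra. }
  set (x := Re (p n)) in *. set (x' := Re (p (S n))) in *.
  replace (2 * lam / ((lam - 1) * c) * ((lam * x - x') / (lam * lam ^ n))) with (2 * (lam * x - x') / ((lam - 1) * (c * lam ^ n))) by (field; repeat split; lra).
  apply Rmult_le_compat_l. lra. apply Rinv_le_contravar. apply Rmult_lt_0_compat. lra. apply Rmult_lt_0_compat; lra.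
  apply Rmult_le_compat_l; lra.
Qed.

Lemma lim_q : is_lim_seq q lam.
Proof.
  apply is_lim_seq_spec. intros eps. destruct (ratio_near (eps / 2)) as [N HN].
  { assert (H := cond_pos eps). lra. }
  exists N. intros n Hn. destruct (HN n Hn). assert (H' := cond_pos eps). lra.
Qed.

Lemma lim_eta : is_lim_seq eta 0.
Proof.
  apply is_lim_seq_spec. intros eps. destruct (ratio_near (eps / 2)) as [N HN].
  { assert (H := cond_pos eps). lra. }
  exists N. intros n Hn. destruct (HN n Hn). assert (H' := cond_pos eps). rewrite Rminus_0_r. lra.
Qed.

(** A converse to [defect_le_ratio], at the price of the sideways motion. With no defect and eta = 0
    the identity E4 says (lam - q) (lam q - 1) = 0. In general this product is at most lam eta^2
    plus a multiple of the defect, and q >= 1 makes its second factor at least lam - 1. *)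
Lemma ratio_defect n : 1 <= q n -> Rabs (eta n) <= 1 ->
  (lam - 1) * (lam - q n) <=
  lam * Rabs (eta n) + (lam - 1) * (lam - 1) / 2 * ((lam + 1) * (lam + 1) + 1) * hyp_defect (RtoC t) n.
Proof.
  intros Hq He.
  assert (E2 := pseudo_step n).
  assert (Bd := hyp_defect_bounds (RtoC t) n ltac:(unfold Re; simpl; auto)).
  assert (D := p_decr n). assert (X := p_pos n).
  assert (Sq := Cmod_minus_plus_sq (p (S n)) (p n)).
  assert (Sq2 := Cmod_sq (p (S n) + Cconj (p n))%C).
  unfold hyp_defect in *.
  set (h := Cmod (hyp_quot F (dil lam n (RtoC t)) (dil lam (S n) (RtoC t)))) in *.
  set (P := Cmod (p (S n) + Cconj (p n))%C) in *.
  set (Dl := Cmod (p (S n) - p n)%C) in *.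
  replace (Re (p (S n) + Cconj (p n))%C) with ((q n + 1) * Re (p n)) in Sq2.
  2:{ unfold q. destruct (p n), (p (S n)). C_coords_all. field. lra. }
  replace (Im (p (S n) + Cconj (p n))%C) with (eta n * Re (p n)) in Sq2.
  2:{ unfold eta. destruct (p n), (p (S n)). C_coords_all. field. lra. }
  assert (Eq : Re (p (S n)) = q n * Re (p n)) by (unfold q; field; lra).
  rewrite Eq in *. set (x := Re (p n)) in *. set (a := q n) in *. set (b := eta n) in *.
  assert (E3 : (P * P) * ((lam + 1) * (lam + 1) - (lam - 1) * (lam - 1) * (h * h)) = 4 * a * (x * x) * ((lam + 1) * (lam + 1))).
  { replace (4 * a * (x * x)) with (P * P - Dl * Dl) by lra.
    replace ((P * P - Dl * Dl) * ((lam + 1) * (lam + 1))) with (P * P * ((lam + 1) * (lam + 1)) - (Dl * (lam + 1)) * (Dl * (lam + 1))) by ring.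
    rewrite E2. ring. }
  rewrite Sq2 in E3.
  assert (E4 : ((a + 1) * (a + 1) + b * b) * ((lam + 1) * (lam + 1) - (lam - 1) * (lam - 1) * (h * h)) = 4 * a * ((lam + 1) * (lam + 1))).
  { apply Rmult_eq_reg_r with (x * x). 2: apply Rgt_not_eq; nra. lra. }
  set (e := 1 - h) in *. replace h with (1 - e) in E4 by (unfold e; ring).
  set (G := (a + 1) * (a + 1) + b * b) in *.
  assert (Hbb : b * b <= Rabs b). { assert (T := Rsqr_abs b). unfold Rsqr in T. rewrite T. assert (T2 := Rabs_pos b). nra. }
  assert (HG : G <= (lam + 1) * (lam + 1) + 1). { unfold G. nra. }
  assert (HG0 : 0 <= G) by (unfold G; nra).
  assert (E5 : 4 * a * ((lam + 1) * (lam + 1)) <= G * (4 * lam + 2 * ((lam - 1) * (lam - 1)) * e)).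
  { rewrite <- E4. apply Rmult_le_compat_l; auto.
    assert (0 <= (lam - 1) * (lam - 1) * (e * e)) by (apply Rmult_le_pos; nra). lra. }
  assert (E6 : G * ((lam - 1) * (lam - 1) * e) <= ((lam + 1) * (lam + 1) + 1) * ((lam - 1) * (lam - 1) * e)).
  { apply Rmult_le_compat_r; auto. apply Rmult_le_pos; nra. }
  assert (E7 : (lam - a) * (lam - 1) <= (lam - a) * (lam * a - 1)) by (apply Rmult_le_compat_l; nra).
  assert (E8 : lam * (b * b) <= lam * Rabs b) by (apply Rmult_le_compat_l; lra).
  unfold G in E5 at 1.
  assert (E9 : ((a + 1) * (a + 1) + b * b) * (4 * lam + 2 * ((lam - 1) * (lam - 1)) * e) = 4 * lam * ((a + 1) * (a + 1)) + 4 * (lam * (b * b)) + 2 * (G * ((lam - 1) * (lam - 1) * e))) by (unfold G; ring).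
  lra.
Qed.

(* kap is the factor by which the pseudo-hyperbolic distance from 1 grows from
   lam to lam^2. *)
Let kap : R := (lam + 1) * (lam + 1) / (lam * lam + 1).
(** For m = q n + i eta n and B = kap (m - 1) / (m + 1), the point (1 + B) / (1 - B) lies further
    out on the geodesic from 1 through m, and its imaginary part is J n times eta n. *)
Let J (n : nat) : R := 4 * kap /
  (((q n + 1) - kap * (q n - 1)) * ((q n + 1) - kap * (q n - 1)) + (1 - kap) * eta n * ((1 - kap) * eta n)).

Lemma lim_J : is_lim_seq J (lam * lam + 1).
Proof.
  assert (Hl := lim_q). assert (He := lim_eta).
  set (D := (((lam + 1) - kap * (lam - 1)) * ((lam + 1) - kap * (lam - 1)) + (1 - kap) * 0 * ((1 - kap) * 0))).
  assert (E1 : (lam + 1) - kap * (lam - 1) = 2 * (lam + 1) / (lam * lam + 1)) by (unfold kap; field; nra).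
  assert (ED : D = 4 * ((lam + 1) * (lam + 1)) / ((lam * lam + 1) * (lam * lam + 1))).
  { unfold D. rewrite E1. field. nra. }
  assert (HD : 0 < D). { rewrite ED. apply Rdiv_lt_0_compat; nra. }
  replace (lam * lam + 1) with (4 * kap / D).
  2:{ rewrite ED. unfold kap. field. split; nra. }
  assert (L1 : is_lim_seq (fun n => (q n + 1) - kap * (q n - 1)) (lam + 1 - kap * (lam - 1))).
  { apply is_lim_seq_minus'. apply is_lim_seq_plus'; auto. apply is_lim_seq_const.
    apply is_lim_seq_mult'. apply is_lim_seq_const. apply is_lim_seq_minus'; auto. apply is_lim_seq_const. }
  assert (L2 : is_lim_seq (fun n => (1 - kap) * eta n) ((1 - kap) * 0)).
  { apply is_lim_seq_mult'; auto. apply is_lim_seq_const. }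
  apply is_lim_seq_div'; [apply is_lim_seq_const| |lra].
  apply is_lim_seq_plus'; apply is_lim_seq_mult'; auto.
Qed.

(* The three images F(lam^n t), F(lam^(n+1) t), F(lam^(n+2) t) lie almost on an
   isometric image of the real half line, so the slope of this image relative to
   the real direction is multiplied by lam at each step. *)
Lemma eta_recursion : exists c, 0 <= c /\ forall n,
  Rabs (q n * eta (S n) + eta n - J n * eta n) <= c * hyp_defect (RtoC t) n.
Proof.
  set (s := (lam ^ 2 - 1) / (lam ^ 2 + 1)).
  assert (Hll : 1 < lam ^ 2) by nra.
  assert (Hs : 0 < s < 1).
  { split. apply Rdiv_lt_0_compat; lra. apply Rmult_lt_reg_r with (lam ^ 2 + 1). lra. unfold s. field_simplify; lra. }
  set (k := (lam - 1) / (lam + 1)).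
  assert (Hk : 0 <= k < 1).
  { split. left; apply Rdiv_lt_0_compat; lra. apply Rmult_lt_reg_r with (lam + 1). lra. unfold k. field_simplify; lra. }
  (* On the disk of radius s, where A and B will lie, the map from A to (1 + A) / (1 - A) has
     Lipschitz constant 2 / (1 - s)^2; the other factor bounds s |e2 - e1| through [three_point]. *)
  set (c := 2 / ((1 - s) * (1 - s)) * (s * (2 * k / (1 - k)))).
  assert (Hi : 0 < / ((1 - s) * (1 - s))) by (apply Rinv_0_lt_compat; nra).
  assert (Hk2 : 0 <= 2 * k / (1 - k)). { apply Rdiv_le_0_compat; lra. }
  exists c. split. { unfold c, Rdiv at 1. apply Rmult_le_pos. lra. apply Rmult_le_pos; lra. }
  intros n.
  assert (E1 := pseudo_quot n 1 ltac:(lia)). rewrite pow_1, Nat.add_1_r in E1. fold k in E1.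
  assert (E2 := pseudo_quot n 2 ltac:(lia)). fold s in E2. replace (n + 2)%nat with (S (S n)) in E2 by lia.
  set (e1 := hyp_quot F (dil lam n (RtoC t)) (dil lam (S n) (RtoC t))) in *.
  set (e2 := hyp_quot F (dil lam n (RtoC t)) (dil lam (S (S n)) (RtoC t))) in *.
  assert (Hd0 : 0 <= hyp_defect (RtoC t) n <= 1) by (apply hyp_defect_bounds; auto).
  assert (T : Cmod (e2 - e1)%C <= 2 * k / (1 - k) * hyp_defect (RtoC t) n /\ Cmod e2 <= 1).
  { assert (N1 : (dil lam (S n) (RtoC t)) <> (dil lam n (RtoC t))).
    { rewrite scale_S. apply scale_neq, scale_lam_neq; auto. }
    assert (N2 : (dil lam (S (S n)) (RtoC t)) <> (dil lam n (RtoC t))).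
    { rewrite !scale_S. apply scale_neq. intros E. apply (f_equal Re) in E. rewrite !Re_scal in E.
      unfold Re in E; simpl in E. assert (0 < (lam ^ 2 - 1) * t) by (apply Rmult_lt_0_compat; lra). lra. }
    split.
    - apply (three_point F (iso_diff F F_iso) (iso_pos F F_iso)); auto; try (apply scale_pos; auto).
      rewrite <- !RtoC_mult. replace (Cconj (RtoC (lam ^ S n * t))) with (RtoC (lam ^ S n * t)) by (C_coords; f_equal; ring).
      assert (Q : 0 < lam ^ n * t) by (apply Rmult_lt_0_compat; auto; apply lam_pow_pos).
      rewrite <- RtoC_minus, <- RtoC_plus, !Cmod_R. simpl pow.
      replace (lam * (lam * lam ^ n) * t - lam * lam ^ n * t) with (lam * (lam - 1) * (lam ^ n * t)) by ring.
      replace (lam * (lam * lam ^ n) * t + lam * lam ^ n * t) with (lam * (lam + 1) * (lam ^ n * t)) by ring.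
      rewrite !Rabs_pos_eq by (left; apply Rmult_lt_0_compat; [nra|auto]). right. unfold k. field. lra.
    - apply hyp_quot_le_1; try apply F_iso; try (apply scale_pos; auto). auto. }
  destruct T as [T T2].
  assert (He1 : Cmod e1 <= 1). { unfold hyp_defect in Hd0. fold e1 in Hd0. lra. }
  set (A := ((p (S (S n)) - p n) / (p (S (S n)) + Cconj (p n)))%C) in *.
  set (E := ((p (S n) - p n) / (p (S n) + Cconj (p n)))%C) in *.
  (* The position that A would have if the quotient e2 were equal to e1. *)
  set (B := (RtoC kap * E)%C).
  assert (EB : B = (RtoC s * e1)%C).
  { unfold B. rewrite E1. rewrite Cmult_assoc, <- RtoC_mult. f_equal. f_equal. unfold kap, k, s. field. split; nra. }
  assert (HAB : Cmod (A - B)%C <= s * (2 * k / (1 - k) * hyp_defect (RtoC t) n)).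
  { rewrite E2, EB. replace (RtoC s * e2 - RtoC s * e1)%C with (RtoC s * (e2 - e1))%C by ring.
    rewrite Cmod_scal by lra. apply Rmult_le_compat_l; lra. }
  assert (HA : 1 - s <= Cmod (1 - A)%C).
  { assert (Q := Cmod_minus_ge 1 A). rewrite Cmod_1, E2, Cmod_scal in Q by lra. rewrite E2. nra. }
  assert (HB : 1 - s <= Cmod (1 - B)%C).
  { assert (Q := Cmod_minus_ge 1 B). rewrite Cmod_1, EB, Cmod_scal in Q by lra. rewrite EB. nra. }
  assert (NA : (1 - A)%C <> 0) by (apply Cmod_gt_0; lra).
  assert (NB : (1 - B)%C <> 0) by (apply Cmod_gt_0; lra).
  assert (Diff : Cmod ((1 + A) / (1 - A) - (1 + B) / (1 - B))%C <= c * hyp_defect (RtoC t) n).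
  { replace ((1 + A) / (1 - A) - (1 + B) / (1 - B))%C with (RtoC 2 * (A - B) / ((1 - A) * (1 - B)))%C by (field; auto).
    rewrite Cmod_div, !Cmod_mult, Cmod_R, Rabs_pos_eq by (try apply Cmult_neq_0; auto; lra).
    unfold c. apply Rle_trans with (2 * (s * (2 * k / (1 - k) * hyp_defect (RtoC t) n)) / ((1 - s) * (1 - s))).
    - apply Rmult_le_compat. assert (Q := Cmod_ge_0 (A - B)%C); lra. left; apply Rinv_0_lt_compat; nra. lra.
      apply Rinv_le_contravar; nra.
    - right. unfold Rdiv. ring. }
  assert (X := p_pos n).
  assert (X1 := p_pos (S n)). assert (X2 := p_pos (S (S n))).
  (* (1 + A) / (1 - A) is the image of p (S (S n)) under the automorphism that sends p n to 1; its
     imaginary part adds up the two sideways motions. *)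
  assert (IA : Im ((1 + A) / (1 - A))%C = q n * eta (S n) + eta n).
  { assert (NN := half_plus_neq_0 _ _ X2 X).
    assert (N3 : (p n + Cconj (p n))%C <> 0) by (apply half_plus_neq_0; auto).
    replace ((1 + A) / (1 - A))%C with ((2 * p (S (S n)) + (Cconj (p n) - p n)) / (p n + Cconj (p n)))%C.
    2:{ unfold A. field. repeat split; auto.
        replace (p (S (S n)) + Cconj (p n) - (p (S (S n)) - p n))%C with (p n + Cconj (p n))%C by ring. auto. }
    unfold q, eta. destruct (p n), (p (S n)), (p (S (S n))). C_coords_all. field. repeat split; nra. }
  assert (IB : Im ((1 + B) / (1 - B))%C = J n * eta n).
  { assert (NN := half_plus_neq_0 _ _ X1 X).
    set (m := (q n, eta n) : C).
    assert (Em : E = ((m - 1) / (m + 1))%C).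
    { unfold E. assert (Nm : (m + 1)%C <> 0).
      { apply half_plus1. unfold m, Re, q; simpl. apply Rdiv_lt_0_compat; auto. }
      assert (Ex : RtoC (Re (p n)) <> 0) by (intros Q; injection Q; lra).
      replace (p (S n) - p n)%C with (RtoC (Re (p n)) * (m - 1))%C.
      2:{ unfold m, q, eta. destruct (p n), (p (S n)). C_coords_all. f_equal; field; lra. }
      replace (p (S n) + Cconj (p n))%C with (RtoC (Re (p n)) * (m + 1))%C.
      2:{ unfold m, q, eta. destruct (p n), (p (S n)). C_coords_all. f_equal; field; lra. }
      field. auto. }
    assert (Nm : (m + 1)%C <> 0).
    { apply half_plus1. unfold m, Re, q; simpl. apply Rdiv_lt_0_compat; auto. }
    assert (Nd : ((m + 1) - RtoC kap * (m - 1))%C <> 0).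
    { intros Q. apply NB. unfold B. rewrite Em.
      replace (1 - RtoC kap * ((m - 1) / (m + 1)))%C with (((m + 1) - RtoC kap * (m - 1)) / (m + 1))%C by (field; auto).
      rewrite Q. unfold Cdiv. ring. }
    replace ((1 + B) / (1 - B))%C with (((m + 1) + RtoC kap * (m - 1)) / ((m + 1) - RtoC kap * (m - 1)))%C.
    2:{ unfold B. rewrite Em. field. repeat split; auto. }
    assert (Pd := proj1 (Cmod_gt_0 _) Nd).
    assert (Pd2 := Rmult_lt_0_compat _ _ Pd Pd). rewrite Cmod_sq in Pd2.
    unfold J. unfold m in *. C_coords_all. field. lra. }
  rewrite <- IA, <- IB.
  replace (Im ((1 + A) / (1 - A))%C - Im ((1 + B) / (1 - B))%C) with (Im ((1 + A) / (1 - A) - (1 + B) / (1 - B))%C) by reflexivity.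
  eapply Rle_trans. 2: exact Diff. eapply Rle_trans. 2: apply Rmax_Cmod. apply Rmax_r.
Qed.

Lemma defect_growth : ex_series (hyp_defect (RtoC t)) -> exists c, 0 < c /\ forall n, c <= y n.
Proof.
  intros Hs.
  assert (Hd0 : forall n, 0 <= hyp_defect (RtoC t) n) by (intros; apply hyp_defect_bounds; auto).
  destruct eta_recursion as (c & Hc & Hrec).
  (* Only 1 < r < lam matters: J tends to lam^2 + 1 > lam r + 1 and q <= lam, so |eta| is multiplied
     by at least r at each step, up to the defect. *)
  set (r := (1 + lam) / 2).
  assert (HJ : exists N, forall n, (N <= n)%nat -> lam * r + 1 <= J n).
  { assert (L := lim_J). apply is_lim_seq_spec in L.
    assert (Hg : 0 < lam * (lam - 1) / 2) by (apply Rdiv_lt_0_compat; nra).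
    destruct (L (mkposreal _ Hg)) as [N HN]. exists N. intros n Hn. specialize (HN n Hn). simpl in HN.
    apply Rabs_def2 in HN. unfold r. lra. }
  destruct HJ as [N1 HN1].
  assert (Hq0 : forall n, 0 < q n) by (intros n; apply Rdiv_lt_0_compat; apply p_pos).
  assert (Hql : forall n, q n <= lam).
  { intros n. unfold q. apply Rle_div_l. apply p_pos. apply p_decr. }
  destruct (ratio_near (Rmin 1 (lam - 1))) as [N2 HN2]. { apply Rmin_pos; lra. }
  assert (M1 := Rmin_l 1 (lam - 1)). assert (M2 := Rmin_r 1 (lam - 1)).
  set (N := (N1 + N2)%nat).
  assert (Hse : ex_series (fun n => Rabs (eta (N + n)%nat))).
  { apply (expanding_summable _ (fun n => c / lam * hyp_defect (RtoC t) (N + n)%nat) r 1 0%nat).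
    - unfold r; lra.
    - intros n. split. apply Rabs_pos. destruct (HN2 (N + n)%nat ltac:(unfold N; lia)). lra.
    - intros n. apply Rmult_le_pos; auto. apply Rmult_le_pos; auto. left; apply Rinv_0_lt_compat; lra.
    - apply (ex_series_scal_R (c / lam) (fun n => hyp_defect (RtoC t) (N + n)%nat)).
      apply (ex_series_shift (hyp_defect (RtoC t)) N). auto.
    - intros n _. rewrite Nat.add_succ_r. set (i := (N + n)%nat).
      assert (HJi := HN1 i ltac:(unfold i, N; lia)). assert (R := Hrec i).
      assert (Z : J i * Rabs (eta i) <= q i * Rabs (eta (S i)) + Rabs (eta i) + c * hyp_defect (RtoC t) i).
      { assert (J0 : 0 <= J i). { assert (0 < lam * r) by (unfold r; nra). lra. }
        rewrite <- (Rabs_pos_eq (J i)) at 1 by auto. rewrite <- (Rabs_pos_eq (q i)) by (left; auto). rewrite <- !Rabs_mult.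
        replace (J i * eta i) with (- (q i * eta (S i) + eta i - J i * eta i) + (q i * eta (S i) + eta i)) by ring.
        eapply Rle_trans. apply Rabs_triang. rewrite Rabs_Ropp.
        assert (T := Rabs_triang (q i * eta (S i)) (eta i)). lra. }
      assert (Z2 : q i * Rabs (eta (S i)) <= lam * Rabs (eta (S i))) by (apply Rmult_le_compat_r; auto; apply Rabs_pos).
      assert (Z3 : (lam * r + 1) * Rabs (eta i) <= J i * Rabs (eta i)) by (apply Rmult_le_compat_r; auto; apply Rabs_pos).
      apply Rmult_le_reg_l with lam. lra.
      replace (lam * (Rabs (eta (S i)) + c / lam * hyp_defect (RtoC t) i)) with (lam * Rabs (eta (S i)) + c * hyp_defect (RtoC t) i) by (field; lra).
      lra. }
  apply (ex_series_shift (fun n => Rabs (eta n)) N) in Hse.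
  (* The coefficients of [ratio_defect] after division by lam (lam - 1); they bound q / lam, the
     ratio of consecutive terms of y, from below. *)
  set (a := 1 / (lam - 1)). set (b := (lam - 1) / 2 * ((lam + 1) * (lam + 1) + 1) / lam).
  assert (Ha : 0 < a) by (apply Rdiv_lt_0_compat; lra).
  assert (Hb : 0 < b). { unfold b. apply Rdiv_lt_0_compat; [|lra]. apply Rmult_lt_0_compat; [lra|nra]. }
  destruct (infinite_product_pos y (fun n => a * Rabs (eta n) + b * hyp_defect (RtoC t) n) N) as (c0 & M & Hc0 & HM).
  - intros; apply y_pos.
  - intros n. assert (0 <= a * Rabs (eta n)). { apply Rmult_le_pos. lra. apply Rabs_pos. }
    assert (0 <= b * hyp_defect (RtoC t) n) by (apply Rmult_le_pos; auto; lra). lra.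
  - apply ex_series_plus_R; apply ex_series_scal_R; auto.
  - intros n Hn. destruct (HN2 n ltac:(unfold N in Hn; lia)) as [Q1 Q2].
    apply Rabs_le_between in Q1.
    assert (R := ratio_defect n ltac:(lra) ltac:(lra)).
    assert (Y : y (S n) = q n / lam * y n).
    { unfold y, q. simpl (lam ^ S n). field. assert (H1 := p_pos n). assert (H2 := lam_pow_pos n). lra. }
    rewrite Y. apply Rmult_le_compat_r. left; apply y_pos.
    apply Rmult_le_reg_l with (lam * (lam - 1)). nra.
    replace (lam * (lam - 1) * (q n / lam)) with ((lam - 1) * q n) by (field; lra).
    replace (lam * (lam - 1) * (1 - (a * Rabs (eta n) + b * hyp_defect (RtoC t) n))) with
      (lam * (lam - 1) - (lam * Rabs (eta n) + (lam - 1) * (lam - 1) / 2 * ((lam + 1) * (lam + 1) + 1) * hyp_defect (RtoC t) n)).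
    2:{ unfold a, b. field. lra. }
    lra.
  - exists c0. split; auto. intros n.
    assert (Mo : forall j, y (n + j)%nat <= y n).
    { induction j. rewrite Nat.add_0_r; lra. rewrite Nat.add_succ_r. eapply Rle_trans. apply y_decr. auto. }
    eapply Rle_trans. 2: apply (Mo M). apply HM. lia.
Qed.

Lemma lim_defect_real : is_lim_seq (hyp_defect (RtoC t)) 0.
Proof.
  apply is_lim_seq_le_le with (fun _ => 0) (fun n => 2 / (lam - 1) * (lam - q n)).
  - intros n. split. apply hyp_defect_bounds; unfold Re; simpl; auto.
    eapply Rle_trans. apply defect_le_ratio. right. unfold q. assert (H := p_pos n). field. repeat split; lra.
  - apply is_lim_seq_const.
  - replace (Finite 0) with (Finite (2 / (lam - 1) * (lam - lam))) by (f_equal; ring).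
    apply is_lim_seq_mult'. apply is_lim_seq_const. apply is_lim_seq_minus'. apply is_lim_seq_const. apply lim_q.
Qed.

Lemma summable_defect_iff_growth :
  ex_series (hyp_defect (RtoC t)) <->
  exists c, 0 < c /\ forall n, c * lam ^ n <= Re (F (dil lam n (RtoC t))).
Proof.
  split.
  - intros H. destruct (defect_growth H) as (c & Hc & Hy). exists c. split; auto. intros n.
    specialize (Hy n). unfold y, p in Hy. apply Rle_div_r in Hy; auto. apply lam_pow_pos.
  - intros (c & Hc & H). apply (growth_defect c); auto. intros n. apply Rle_div_r. apply lam_pow_pos. apply H.
Qed.

End RealAxis.

(** The modulus is a convenient real base point: lam |b| and b have different moduli, so
    [defect_transfer] applies. *)
Lemma hyp_defect_summable_iff b : 0 < Re b ->
  ex_series (hyp_defect b) <-> ex_series (hyp_defect (RtoC (Cmod b))).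
Proof.
  intros Hb. assert (Hm : 0 < Cmod b) by (apply Rlt_le_trans with (1 := Hb); apply Cmod_Re_le).
  assert (Pt : 0 < Re (RtoC (Cmod b))) by (unfold Re; simpl; auto).
  destruct (defect_transfer (RtoC (Cmod b)) b Pt Hb) as (c & Hc & H).
  { intros E. apply (f_equal Cmod) in E. rewrite Cmod_scal, Cmod_R, Rabs_pos_eq in E by lra. nra. }
  split; intros Hs.
  - apply ex_series_le_pos with (fun n => c * hyp_defect b n). 2: apply ex_series_scal_R; auto.
    intros n. split. apply hyp_defect_bounds; auto. apply H.
  - apply ex_series_le_pos with (fun n => c * hyp_defect (RtoC (Cmod b)) n). 2: apply ex_series_scal_R; auto.
    intros n. split. apply hyp_defect_bounds; auto. apply H.
Qed.

Lemma lim_defect b : 0 < Re b -> is_lim_seq (hyp_defect b) 0.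
Proof.
  intros Hb. assert (Hm : 0 < Cmod b) by (apply Rlt_le_trans with (1 := Hb); apply Cmod_Re_le).
  assert (Pt : 0 < Re (RtoC (Cmod b))) by (unfold Re; simpl; auto).
  destruct (defect_transfer (RtoC (Cmod b)) b Pt Hb) as (c & Hc & H).
  { intros E. apply (f_equal Cmod) in E. rewrite Cmod_scal, Cmod_R, Rabs_pos_eq in E by lra. nra. }
  apply is_lim_seq_le_le with (fun _ => 0) (fun n => c * hyp_defect (RtoC (Cmod b)) n).
  - intros n. split. apply hyp_defect_bounds; auto. apply H.
  - apply is_lim_seq_const.
  - replace (Finite 0) with (Finite (c * 0)) by (f_equal; ring).
    apply is_lim_seq_mult'. apply is_lim_seq_const. apply lim_defect_real; auto.
Qed.

(** F (lam^n) can be replaced by its real part because its argument tends to 0. A positive real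
    scaling factor preserves arguments, so that of F (lam^n b) tends to that of b. *)
Lemma scaled_limit b : 0 < Re b -> forall eps, 0 < eps -> exists N, forall n, (N <= n)%nat ->
  Cmod (F (dil lam n b) - RtoC (Re (F (RtoC (lam ^ n)))) * b)%C <= eps * Re (F (RtoC (lam ^ n))).
Proof.
  intros Hb eps He.
  assert (Hm := Cmod_ge_0 b).
  set (e := Rmin 1 (eps / (2 + Cmod b))).
  assert (He1 := Rmin_l 1 (eps / (2 + Cmod b))). assert (He2 := Rmin_r 1 (eps / (2 + Cmod b))). fold e in He1, He2.
  assert (He0 : 0 < e). { apply Rmin_pos. lra. apply Rdiv_lt_0_compat; lra. }
  assert (He3 : e * (2 + Cmod b) <= eps). { apply Rle_div_r in He2; lra. }
  destruct (isogonal_scale F F_iso (Rmax 1 (Cmod b)) (Rmin 1 (Re b)) e) as (S1 & _ & H1); auto.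
  { split. apply Rmin_pos; lra. apply Rmin_l. } { apply Rmax_l. }
  destruct (isogonal_real F F_iso e He0) as (S2 & _ & H2).
  destruct (lam_pow_infty 1 ltac:(lra) (Rmax S1 S2)) as [N HN]. assert (M1 := Rmax_l S1 S2). assert (M2 := Rmax_r S1 S2).
  exists N. intros n Hn. specialize (HN n Hn). rewrite Rmult_1_r in HN.
  assert (G1 := H1 (lam ^ n) b ltac:(lra) (Rmax_r _ _) (Rmin_r _ _)).
  assert (G2 := H2 (lam ^ n) ltac:(lra)).
  assert (X : 0 < Re (F (RtoC (lam ^ n)))). { apply (iso_pos F F_iso). unfold Re; simpl. apply lam_pow_pos. }
  set (f := F (RtoC (lam ^ n))) in *.
  assert (L := Cmod_le_Re_Im f). rewrite (Rabs_pos_eq (Re f)) in L by lra.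
  replace (F (dil lam n b) - RtoC (Re f) * b)%C with ((F (dil lam n b) - b * f) + b * (0, Im f))%C.
  2:{ destruct f as [x y], b as [b1 b2]. destruct (F (RtoC (lam ^ n) * (b1, b2))%C). C_coords. f_equal; ring. }
  eapply Rle_trans. apply Cmod_triangle. rewrite Cmod_mult.
  assert (Z : Cmod (0, Im f) = Rabs (Im f)).
  { unfold Cmod; simpl. rewrite <- sqrt_Rsqr_abs. f_equal. unfold Rsqr. ring. }
  rewrite Z.
  assert (Z1 : e * Cmod f <= e * (2 * Re f)). { apply Rmult_le_compat_l. lra. nra. }
  assert (Z2 : Cmod b * Rabs (Im f) <= Cmod b * (e * Re f)) by (apply Rmult_le_compat_l; auto).
  assert (Z3 : e * (2 + Cmod b) * Re f <= eps * Re f) by (apply Rmult_le_compat_r; lra). lra.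
Qed.

Lemma Re_F_infty M : exists N, forall n, (N <= n)%nat -> M < Re (F (RtoC (lam ^ n))).
Proof.
  destruct (iso_infty F F_iso 1 (2 * M) ltac:(lra)) as [S1 H1].
  destruct (isogonal_real F F_iso 1 ltac:(lra)) as (S2 & HS2 & H2).
  destruct (lam_pow_infty 1 ltac:(lra) (Rmax S1 S2)) as [N HN]. assert (M1 := Rmax_l S1 S2). assert (M2 := Rmax_r S1 S2).
  exists N. intros n Hn. specialize (HN n Hn). rewrite Rmult_1_r in HN.
  assert (Hn0 := lam_pow_pos n).
  assert (Em : Cmod (RtoC (lam ^ n)) = lam ^ n) by (rewrite Cmod_R; apply Rabs_pos_eq; lra).
  assert (G1 := H1 (RtoC (lam ^ n)) ltac:(lra) ltac:(rewrite Em; unfold Re; simpl; lra)).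
  assert (G2 := H2 (lam ^ n) ltac:(lra)).
  assert (X : 0 < Re (F (RtoC (lam ^ n)))). { apply (iso_pos F F_iso). unfold Re; simpl. auto. }
  assert (L := Cmod_le_Re_Im (F (RtoC (lam ^ n)))). rewrite (Rabs_pos_eq (Re _)) in L by lra. lra.
Qed.

End RealOrbit.

(** * Regularity of the pre-model *)

Lemma Re_ratio_bounds (z : C) : z <> 0 -> -1 <= Re z / Cmod z <= 1.
Proof.
  intros Hz. assert (H : 0 < Cmod z) by (apply Cmod_gt_0; auto).
  assert (H1 := re_le_Cmod z). apply Rabs_le_between in H1.
  split; [apply Rle_div_r|apply Rle_div_l]; lra.
Qed.

Lemma sqrt_one_minus_ratio (z : C) : z <> 0 -> sqrt (1 - (Re z / Cmod z)²) = Rabs (Im z) / Cmod z.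
Proof.
  intros Hz. assert (H : 0 < Cmod z) by (apply Cmod_gt_0; auto).
  replace (1 - (Re z / Cmod z)²) with ((Im z / Cmod z)²).
  - rewrite sqrt_Rsqr_abs. unfold Rdiv. rewrite Rabs_mult, (Rabs_pos_eq (/ Cmod z)); auto.
    left; apply Rinv_0_lt_compat; auto.
  - assert (E := Cmod_sq z). unfold Rsqr. apply Rmult_eq_reg_r with (Cmod z * Cmod z); [|nra].
    replace ((1 - Re z / Cmod z * (Re z / Cmod z)) * (Cmod z * Cmod z)) with (Cmod z * Cmod z - Re z * Re z) by (field; lra).
    rewrite E at 2. field. lra.
Qed.

Lemma cos_Carg (z : C) : z <> 0 -> cos (Carg z) = Re z / Cmod z.
Proof.
  intros Hz. unfold Carg. destruct (Rle_dec 0 (Im z)).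
  - apply cos_acos. apply Re_ratio_bounds; auto.
  - rewrite cos_neg. apply cos_acos. apply Re_ratio_bounds; auto.
Qed.

Lemma sin_Carg (z : C) : z <> 0 -> sin (Carg z) = Im z / Cmod z.
Proof.
  intros Hz. unfold Carg. destruct (Rle_dec 0 (Im z)) as [H|H].
  - rewrite sin_acos by (apply Re_ratio_bounds; auto). rewrite sqrt_one_minus_ratio, Rabs_pos_eq; auto.
  - rewrite sin_neg, sin_acos by (apply Re_ratio_bounds; auto). rewrite sqrt_one_minus_ratio, Rabs_left by (auto; lra).
    unfold Rdiv. ring.
Qed.

Lemma Carg_atan (z : C) : 0 < Re z -> Carg z = atan (Im z / Re z).
Proof.
  intros Hz. assert (Hn := half_neq_0 z Hz). assert (H : 0 < Cmod z) by (apply Cmod_gt_0; auto).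
  assert (E : acos (Re z / Cmod z) = atan (Rabs (Im z) / Re z)).
  { rewrite acos_atan by (apply Rdiv_lt_0_compat; auto). rewrite sqrt_one_minus_ratio by auto. f_equal. field. lra. }
  unfold Carg. rewrite E. destruct (Rle_dec 0 (Im z)) as [H1|H1].
  - rewrite Rabs_pos_eq; auto.
  - rewrite <- atan_opp. f_equal. rewrite Rabs_left by lra. field. lra.
Qed.

Lemma Carg_small (z : C) (theta : R) : 0 < theta < PI / 2 -> z <> 0 -> Rabs (Carg z) < theta ->
  cos theta * Cmod z <= Re z.
Proof.
  intros Ht Hz H. assert (Hp : 0 < Cmod z) by (apply Cmod_gt_0; auto).
  apply Rabs_def2 in H.
  assert (Hc : cos theta <= cos (Carg z)).
  { assert (Hc : cos (Carg z) = cos (Rabs (Carg z))).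
    { unfold Rabs. destruct (Rcase_abs (Carg z)); auto. rewrite cos_neg; auto. }
    rewrite Hc. apply cos_decr_1; try lra; try apply Rabs_pos. apply Rabs_le; lra.
    left. apply Rabs_def1; lra. }
  rewrite cos_Carg in Hc by auto. apply Rle_div_r in Hc; auto.
Qed.

Lemma Carg_slope (z : C) (eps : R) : 0 < eps -> z <> 0 -> Rabs (Carg z) < atan eps ->
  0 < Re z /\ Rabs (Im z) <= eps * Re z.
Proof.
  intros He Hz H. assert (Hb := atan_bound eps). assert (Hp : 0 < Cmod z) by (apply Cmod_gt_0; auto).
  assert (Ha : 0 < atan eps) by (rewrite <- atan_0; apply atan_increasing; auto).
  assert (Hc := Carg_small z (atan eps) ltac:(lra) Hz H).
  assert (0 < cos (atan eps)) by (apply cos_gt_0; lra).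
  assert (HR : 0 < Re z) by nra. split; auto.
  rewrite Carg_atan in H by auto. apply Rabs_def2 in H.
  assert (A : forall x, atan x < atan eps -> x < eps).
  { intros x Hx. apply Rnot_le_lt. intros [Hle|Heq]. apply atan_increasing in Hle. lra. subst. lra. }
  assert (H1 := A _ (proj1 H)).
  assert (H2 : - (Im z / Re z) < eps). { apply A. rewrite atan_opp. lra. }
  apply Rabs_le. assert (E : Im z = Im z / Re z * Re z) by (field; lra).
  split; rewrite E; nra.
Qed.

(** In the sector |Im z| <= |z| <= Re z / k; the added 1 makes the inequality strict. *)
Lemma Carg_sector (z : C) (k : R) : 0 < k -> z <> 0 -> k * Cmod z <= Re z -> Rabs (Carg z) < atan (/ k + 1).
Proof.
  intros Hk Hz H. assert (Hp : 0 < Cmod z) by (apply Cmod_gt_0; auto).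
  assert (HR : 0 < Re z) by nra. rewrite Carg_atan by auto.
  assert (L : Rabs (Im z / Re z) < / k + 1).
  { unfold Rdiv. rewrite Rabs_mult, (Rabs_pos_eq (/ Re z)) by (left; apply Rinv_0_lt_compat; auto).
    apply Rle_lt_trans with (/ k); [|lra]. apply Rle_div_l; auto.
    assert (Rabs (Im z) <= Cmod z) by (eapply Rle_trans; [|apply Rmax_Cmod]; apply Rmax_r).
    apply Rmult_le_reg_l with k; auto. rewrite <- Rmult_assoc, Rinv_r by lra. nra. }
  apply Rabs_def2 in L. apply Rabs_def1. apply atan_increasing; lra.
  rewrite <- atan_opp. apply atan_increasing; lra.
Qed.

Lemma Cexp_i_Carg_double (z : C) : z <> 0 -> Cexp_i (2 * Carg z) = ((z * z) / RtoC (Cmod z * Cmod z))%C.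
Proof.
  intros Hz. assert (Hp : 0 < Cmod z) by (apply Cmod_gt_0; auto).
  unfold Cexp_i. rewrite cos_2a, sin_2a, cos_Carg, sin_Carg by auto.
  unfold Cdiv. rewrite <- RtoC_inv by nra.
  destruct z as [x y]. set (m := Cmod (x,y)) in *. C_coords. f_equal; field; lra.
Qed.

Lemma locally_Cmod (l : C) (P : C -> Prop) : locally l P <-> near l P.
Proof.
  split.
  - intros [d Hd]. exists d. split. apply cond_pos. intros w Hw. apply Hd.
    apply C_NormedModule_mixin_compat1. exact Hw.
  - intros (d & Hd & K). assert (Hs := sqrt_lt_R0 2 ltac:(lra)).
    exists (mkposreal _ (Rdiv_lt_0_compat _ _ Hd Hs)). intros w Hw. apply K.
    apply C_NormedModule_mixin_compat2 in Hw. simpl in Hw.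
    replace (sqrt 2 * (d / sqrt 2)) with d in Hw by (field; lra). exact Hw.
Qed.

Lemma ang_lim_infty_sector {T} (g : C -> T) (G : (T -> Prop) -> Prop) (P : T -> Prop) k :
  ang_lim_infty g G -> 0 < k -> G P -> exists S, forall z, S < Cmod z -> k * Cmod z <= Re z -> P (g z).
Proof.
  intros H Hk HP. assert (Hb := atan_bound (/ k + 1)).
  assert (Hi : 0 < / k) by (apply Rinv_0_lt_compat; auto).
  assert (Ha : 0 < atan (/ k + 1)) by (rewrite <- atan_0; apply atan_increasing; lra).
  destruct (H (atan (/ k + 1)) ltac:(lra) P HP) as [S HS].
  exists (Rmax 0 S). intros z Hz Hzk. assert (M1 := Rmax_l 0 S). assert (M2 := Rmax_r 0 S).
  apply HS. lra. apply Carg_sector; auto. apply Cmod_gt_0. lra.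
Qed.

Lemma pre_model_isogonal f mu F : is_pre_model_infty f mu F -> isogonal_self_map F.
Proof.
  intros (Hd & Hm & _ & Hi & Ha). constructor.
  - intros z Hz. apply ex_derive_cdiff, Hd, Hz.
  - exact Hm.
  - intros k M Hk. apply (ang_lim_infty_sector F C_infty (fun w => M < Cmod w) k Hi Hk). exists M. auto.
  - intros k eps Hk He.
    assert (Hae : 0 < atan eps) by (rewrite <- atan_0; apply atan_increasing; lra).
    destruct (ang_lim_infty_sector _ _ (fun x => Rabs x < atan eps) k Ha Hk) as [S HS].
    { exists (mkposreal _ Hae). intros x Hx. unfold ball in Hx; simpl in Hx. unfold AbsRing_ball, abs, minus, plus, opp in Hx; simpl in Hx.
      rewrite Ropp_0, Rplus_0_r in Hx. exact Hx. }
    exists (Rmax 0 S). intros z Hz Hzk. assert (M1 := Rmax_l 0 S). assert (M2 := Rmax_r 0 S).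
    assert (HR : 0 < Re z) by nra.
    apply Carg_slope; auto. apply Cmult_neq_0. apply half_neq_0. apply Hm; auto.
    intros E. apply C1_nz. rewrite <- (Cinv_r z), E. ring. apply half_neq_0; auto.
    apply HS; auto. lra.
Qed.

Section Regular.

Variables (F : C -> C) (lam : R).
Hypothesis lam_gt_1 : 1 < lam.
Hypothesis F_iso : isogonal_self_map F.

Lemma Re_F_over_decr s s' : 0 < s <= s' -> Re (F s') / s' <= Re (F s) / s.
Proof.
  intros [Hs [Hlt| ->]]; [|lra].
  assert (H := Re_F_real_decr F F_iso s (s' / s) Hs).
  replace (s' / s * s) with s' in H by (field; lra).
  assert (Hl : 1 < s' / s). { apply Rlt_div_r; lra. }
  specialize (H Hl). apply Rle_div_l. lra. eapply Rle_trans. exact H. right. field. lra.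
Qed.

(** Regularity gives the lower bound only far out; the monotonicity of Re F(s) / s carries it back
    to every s. *)
Lemma regular_growth t : 0 < t -> regular_pre_model F ->
  exists c, 0 < c /\ forall n, c * lam ^ n <= Re (F (dil lam n (RtoC t))).
Proof.
  intros Ht (c & Hc & Hl).
  destruct (ang_lim_infty_sector _ _ (fun w => Cmod (w - RtoC c)%C < c / 2) 1 Hl ltac:(lra)) as [S HS].
  { apply locally_Cmod. apply near_ball. lra. }
  exists (c / 2 * t). split. nra.
  intros n. assert (Hn := lam_pow_pos lam lam_gt_1 n).
  set (s := lam ^ n * t). assert (Hs : 0 < s) by (apply Rmult_lt_0_compat; auto).
  set (s' := Rmax s (S + 1)). assert (M1 := Rmax_l s (S + 1)). assert (M2 := Rmax_r s (S + 1)). fold s' in M1, M2.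
  assert (Em : Cmod s' = s') by (rewrite Cmod_R; apply Rabs_pos_eq; lra).
  specialize (HS (RtoC s') ltac:(lra) ltac:(rewrite Em; unfold Re; simpl; lra)).
  assert (T := re_le_Cmod (F s' / RtoC s' - RtoC c)%C).
  assert (E : Re (F s' / RtoC s' - RtoC c)%C = Re (F s') / s' - c).
  { unfold Cdiv. rewrite <- RtoC_inv by lra. destruct (F s'). unfold Re; simpl. field. lra. }
  rewrite E in T. apply Rabs_le_between in T.
  assert (D := Re_F_over_decr s s' ltac:(lra)).
  assert (G : c / 2 <= Re (F s) / s) by lra. apply Rle_div_r in G; auto.
  rewrite <- RtoC_mult. fold s. apply Rle_trans with (c / 2 * s); [right; unfold s; ring|exact G].
Qed.

(** By monotonicity Re F(s) / s has a limit L >= c / t on the real axis. Small arguments turn it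
    into a limit of F(s) / s, and [isogonal_flat] spreads this over every sector. *)
Lemma growth_regular t c : 0 < t -> 0 < c ->
  (forall n, c * lam ^ n <= Re (F (dil lam n (RtoC t)))) -> regular_pre_model F.
Proof.
  intros Ht Hc Hg.
  assert (Low : forall s, 0 < s -> c / t <= Re (F s) / s).
  { intros s Hs. destruct (lam_pow_infty lam lam_gt_1 t Ht s) as [N HN]. specialize (HN N (le_n N)).
    assert (HnN := lam_pow_pos lam lam_gt_1 N).
    eapply Rle_trans. 2: apply (Re_F_over_decr s (lam ^ N * t)); lra.
    apply (Rle_div_r (c / t) _ (lam ^ N * t)). lra. rewrite RtoC_mult. eapply Rle_trans. 2: apply Hg. right. field. lra. }
  (* The infimum L of Re F(s) / s is obtained as minus a supremum. *)
  destruct (completeness (fun x => exists s, 0 < s /\ x = - (Re (F s) / s))) as [m [Hm1 Hm2]].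
  { exists (- (c / t)). intros x (s & Hs & ->). specialize (Low s Hs). lra. }
  { exists (- (Re (F (RtoC 1)) / 1)), 1. split; [lra|auto]. }
  set (L := - m).
  assert (HL : forall s, 0 < s -> L <= Re (F s) / s).
  { intros s Hs. assert (H := Hm1 (- (Re (F s) / s)) (ex_intro _ s (conj Hs eq_refl))). unfold L. lra. }
  assert (HLc : c / t <= L).
  { unfold L. assert (m <= - (c / t)); [|lra]. apply Hm2. intros x (s & Hs & ->). specialize (Low s Hs). lra. }
  assert (HL0 : 0 < L). { apply Rlt_le_trans with (2 := HLc). apply Rdiv_lt_0_compat; auto. }
  assert (HLe : forall e, 0 < e -> exists s0, 0 < s0 /\ forall s, s0 <= s -> Re (F s) / s <= L + e).
  { intros e He. apply NNPP. intros Hn. assert (m <= m - e); [|lra]. apply Hm2.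
    intros x (s & Hs & ->). apply Rnot_lt_le. intros Hlt. apply Hn. exists s. split; auto.
    intros s' Hs'. eapply Rle_trans. apply (Re_F_over_decr s s'); lra. unfold L. lra. }
  exists L. split; auto. intros theta Hth P HP. apply locally_Cmod in HP. destruct HP as (d & Hd & K).
  set (k := cos theta). assert (Hk : 0 < k) by (apply cos_gt_0; lra).
  assert (Hk1 : k <= 1) by (apply COS_bound).
  (* The errors add up to e (2 (L + 1) + 1 + (L + 1)) = e (3 L + 4); the larger constant makes the
     final inequality strict. *)
  set (e := Rmin 1 (d / (3 * L + 8))).
  assert (He1 := Rmin_l 1 (d / (3 * L + 8))). assert (He2 := Rmin_r 1 (d / (3 * L + 8))). fold e in He1, He2.
  assert (He0 : 0 < e). { apply Rmin_pos. lra. apply Rdiv_lt_0_compat; lra. }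
  assert (He3 : e * (3 * L + 8) <= d) by (apply Rle_div_r in He2; lra).
  destruct (HLe e He0) as (s0 & Hs0 & H0).
  destruct (isogonal_flat F F_iso 1 k e) as (S1 & HS1 & H1); [lra|lra|auto|].
  destruct (isogonal_real F F_iso e He0) as (S2 & HS2 & H2).
  exists (Rmax s0 (Rmax S1 S2)). assert (M0 := Rmax_l s0 (Rmax S1 S2)). assert (M0' := Rmax_r s0 (Rmax S1 S2)).
  assert (M1 := Rmax_l S1 S2). assert (M2 := Rmax_r S1 S2).
  intros z Hz Harg. apply K.
  set (s := Cmod z) in *. assert (Hs : 0 < s) by lra.
  assert (Hzn : z <> 0) by (apply Cmod_gt_0; auto).
  assert (Hzk : k * s <= Re z) by (apply Carg_small; auto).
  set (u := (RtoC (/ s) * z)%C).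
  assert (Hi : 0 < / s) by (apply Rinv_0_lt_compat; auto).
  assert (Eu : (RtoC s * u)%C = z).
  { unfold u. rewrite RtoC_inv by lra. field. intros E; injection E; lra. }
  assert (Hu : Cmod u = 1). { unfold u. rewrite Cmod_scal by lra. fold s. field. lra. }
  assert (Huk : k <= Re u).
  { unfold u. rewrite Re_scal. apply Rmult_le_reg_l with s; auto. rewrite <- Rmult_assoc, Rinv_r by lra. lra. }
  assert (G1 := H1 s u ltac:(lra) ltac:(lra) Huk). rewrite Eu in G1.
  assert (G2 := H2 s ltac:(lra)). assert (G3 := HL s Hs). assert (G4 := H0 s ltac:(lra)).
  set (h := (F s / RtoC s)%C) in *.
  assert (Rh : Re h = Re (F s) / s).
  { unfold h, Cdiv. rewrite <- RtoC_inv by lra. destruct (F s). unfold Re; simpl. field. lra. }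
  assert (Ih : Im h = Im (F s) / s).
  { unfold h, Cdiv. rewrite <- RtoC_inv by lra. destruct (F s). unfold Im; simpl. field. lra. }
  rewrite <- Rh in G3, G4.
  assert (Ihb : Rabs (Im h) <= e * Re h).
  { rewrite Ih, Rh. unfold Rdiv. rewrite Rabs_mult, (Rabs_pos_eq (/ s)) by lra.
    rewrite <- Rmult_assoc. apply Rmult_le_compat_r; lra. }
  assert (Lh := Cmod_le_Re_Im h). rewrite (Rabs_pos_eq (Re h)) in Lh by lra.
  assert (Q : Cmod (h - RtoC L)%C <= e + e * Re h).
  { eapply Rle_trans. apply Cmod_le_Re_Im.
    replace (Re (h - RtoC L)%C) with (Re h - L) by reflexivity.
    replace (Im (h - RtoC L)%C) with (Im h) by (destruct h; unfold Im; simpl; ring).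
    apply Rplus_le_compat; auto. apply Rabs_le; lra. }
  replace (F z / z - RtoC L)%C with ((F z / z - h) + (h - RtoC L))%C by ring.
  eapply Rle_lt_trans. apply Cmod_triangle.
  assert (Q2 : Re h <= L + 1) by lra.
  assert (Q3 : Cmod h <= 2 * (L + 1)) by nra.
  assert (Q4 : e * Cmod h <= e * (2 * (L + 1))) by (apply Rmult_le_compat_l; lra).
  assert (Q5 : e * Re h <= e * (L + 1)) by (apply Rmult_le_compat_l; lra).
  assert (0 < e * L) by (apply Rmult_lt_0_compat; auto).
  lra.
Qed.

Lemma regular_iff_summable b : 0 < Re b -> regular_pre_model F <-> ex_series (hyp_defect F lam b).
Proof.
  intros Hb. assert (Hm : 0 < Cmod b) by (apply Rlt_le_trans with (1 := Hb); apply Cmod_Re_le).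
  rewrite (hyp_defect_summable_iff F lam lam_gt_1 F_iso b Hb).
  rewrite (summable_defect_iff_growth F lam lam_gt_1 F_iso (Cmod b) Hm).
  split.
  - apply regular_growth; auto.
  - intros (c & Hc & H). apply (growth_regular (Cmod b) c); auto.
Qed.

End Regular.

(* The hyperbolic distance as a function of the pseudo-hyperbolic distance. *)
Definition hyp_of (x : R) : R := ln ((1 + x) / (1 - x)).

(** Both bounds come from ln v <= v - 1, applied to the quotient v of the arguments of the two
    logarithms and to its inverse. For fixed r they make defects of distance and of pseudo-distance
    comparable. *)
Lemma hyp_of_bounds x r : 0 <= x <= r -> r < 1 ->
  r - x <= hyp_of r - hyp_of x <= 2 * (r - x) / (1 - r).
Proof.
  intros Hx Hr.
  assert (P1 : 0 < (1 + r) / (1 - r)) by (apply Rdiv_lt_0_compat; lra).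
  assert (P2 : 0 < (1 + x) / (1 - x)) by (apply Rdiv_lt_0_compat; lra).
  assert (L : forall v, 0 < v -> ln v <= v - 1).
  { intros v Hv. assert (H := exp_ineq1_le (ln v)). rewrite exp_ln in H by auto. lra. }
  unfold hyp_of. rewrite <- ln_div by auto.
  set (v := (1 + r) / (1 - r) / ((1 + x) / (1 - x))).
  assert (Hv : 0 < v) by (apply Rdiv_lt_0_compat; auto).
  split.
  - assert (H := L (/ v) ltac:(apply Rinv_0_lt_compat; auto)). rewrite ln_Rinv in H by auto.
    assert (E : 1 - / v = 2 * (r - x) / ((1 + r) * (1 - x))) by (unfold v; field; repeat split; lra).
    assert (r - x <= 2 * (r - x) / ((1 + r) * (1 - x))).
    { apply Rle_div_r. apply Rmult_lt_0_compat; lra.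
      rewrite (Rmult_comm 2). apply Rmult_le_compat_l; nra. }
    lra.
  - assert (H := L v Hv).
    assert (E : v - 1 = 2 * (r - x) / ((1 - r) * (1 + x))) by (unfold v; field; repeat split; lra).
    eapply Rle_trans. exact H. rewrite E. apply Rmult_le_compat_l. lra.
    apply Rinv_le_contravar; nra.
Qed.

Lemma hyp_of_le x B : 0 <= x < 1 -> hyp_of x <= B -> x <= (exp B - 1) / (exp B + 1).
Proof.
  intros Hx H. assert (HB := exp_pos B). apply Rle_div_r. lra.
  assert (P : 0 < (1 + x) / (1 - x)) by (apply Rdiv_lt_0_compat; lra).
  assert (E : (1 + x) / (1 - x) <= exp B).
  { rewrite <- (exp_ln _ P). unfold hyp_of in H. destruct H as [H|H]. left; apply exp_increasing; auto. rewrite H; lra. }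
  apply Rle_div_l in E; lra.
Qed.

(** * Transport to the disk *)

Definition pseudo_half (a b : C) : R := Cmod (a - b)%C / Cmod (a + Cconj b)%C.

Lemma pseudo_half_lt_1 a b : 0 < Re a -> 0 < Re b -> 0 <= pseudo_half a b < 1.
Proof.
  intros Ha Hb. assert (P := Cmod_half_pos a b Ha Hb). assert (Q := Cmod_ge_0 (a - b)%C).
  assert (E := Cmod_minus_plus_sq a b). assert (0 < Re a * Re b) by (apply Rmult_lt_0_compat; auto).
  unfold pseudo_half. split.
  - apply Rdiv_le_0_compat; auto.
  - apply Rlt_div_l; auto. nra.
Qed.

Section Transport.

Variable sigma : C.
Hypothesis sigma_unit : Cmod sigma = 1.

Lemma sigma_conj : (sigma * Cconj sigma)%C = 1.
Proof. rewrite <- Cmod2_conj, sigma_unit. f_equal. ring. Qed.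
Lemma sigma_neq_0 : sigma <> 0.
Proof. apply Cmod_gt_0. lra. Qed.
Lemma conj_sigma_disk z : Cmod z < 1 -> Cmod (Cconj sigma * z)%C < 1.
Proof. intros H. rewrite Cmod_mult, Cmod_conj, sigma_unit. lra. Qed.
Lemma sigma_minus_neq_0 z : Cmod z < 1 -> (sigma - z)%C <> 0.
Proof. intros H. apply Cminus_neq_0. intros E. rewrite <- E in H. lra. Qed.
Lemma cayley_inv_to_half z : Cmod z < 1 -> cayley_inv sigma z = to_half (Cconj sigma * z)%C.
Proof.
  intros Hz. assert (N := one_minus_neq_0 _ (conj_sigma_disk z Hz)). assert (N2 := sigma_minus_neq_0 z Hz).
  unfold cayley_inv, to_half.
  assert (E1 : (sigma + z = sigma * (1 + Cconj sigma * z))%C).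
  { replace (sigma * (1 + Cconj sigma * z))%C with (sigma + (sigma * Cconj sigma) * z)%C by ring. rewrite sigma_conj. ring. }
  assert (E2 : (sigma - z = sigma * (1 - Cconj sigma * z))%C).
  { replace (sigma * (1 - Cconj sigma * z))%C with (sigma - (sigma * Cconj sigma) * z)%C by ring. rewrite sigma_conj. ring. }
  rewrite E1, E2. field. split; auto. apply sigma_neq_0.
Qed.

Lemma cayley_inv_pos z : Cmod z < 1 -> 0 < Re (cayley_inv sigma z).
Proof.
  intros Hz. rewrite cayley_inv_to_half by auto. apply to_half_pos, conj_sigma_disk; auto.
Qed.

Lemma cayley_disk w : 0 < Re w -> Cmod (cayley sigma w) < 1.
Proof.
  intros Hw. unfold cayley. rewrite Cmod_mult, sigma_unit, Rmult_1_l. apply half_to_disk; auto.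
Qed.

Lemma to_half_left_inv u : Cmod u < 1 -> ((to_half u - 1) / (to_half u + 1))%C = u.
Proof.
  intros Hu. assert (N := one_minus_neq_0 u Hu). assert (P := half_plus1 _ (to_half_pos u Hu)).
  unfold to_half in *. field. split; auto.
  intros E. apply P. replace ((1 + u) / (1 - u) + 1)%C with ((1 + u + (1 - u)) / (1 - u))%C by (field; auto).
  rewrite E. unfold Cdiv. ring.
Qed.

Lemma cayley_cayley_inv z : Cmod z < 1 -> cayley sigma (cayley_inv sigma z) = z.
Proof.
  intros Hz. rewrite cayley_inv_to_half by auto. unfold cayley.
  rewrite to_half_left_inv by (apply conj_sigma_disk; auto).
  rewrite Cmult_assoc, sigma_conj. ring.
Qed.

Lemma pseudo_hyp_dist_half z z' : Cmod z < 1 -> Cmod z' < 1 ->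
  pseudo_hyp_dist z z' = pseudo_half (cayley_inv sigma z) (cayley_inv sigma z').
Proof.
  intros Hz Hz'.
  assert (Pz := cayley_inv_pos z Hz). assert (Pz' := cayley_inv_pos z' Hz').
  assert (G := half_cayley _ _ Pz Pz'). assert (P := Cmod_half_pos _ _ Pz Pz').
  assert (N := disk_denominator z' z ltac:(lra) Hz). assert (PN := proj1 (Cmod_gt_0 _) N).
  unfold pseudo_hyp_dist, pseudo_half. rewrite Cmod_div by auto.
  rewrite (cayley_inv_to_half z), (cayley_inv_to_half z') in G at 1 2 3 4 by auto.
  rewrite !cayley_inv_to_half in * by auto.
  rewrite !to_half_left_inv in G by (apply conj_sigma_disk; auto).
  replace (Cconj sigma * z - Cconj sigma * z')%C with (Cconj sigma * (z - z'))%C in G by ring.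
  rewrite Cmod_mult, Cmod_conj, sigma_unit, Rmult_1_l in G.
  replace (Cconj (Cconj sigma * z') * (Cconj sigma * z))%C with ((sigma * Cconj sigma) * (Cconj z' * z))%C in G.
  2:{ rewrite Cmult_conj, Cconj_conj. ring. }
  rewrite sigma_conj, Cmult_1_l in G.
  set (X := Cmod (to_half (Cconj sigma * z) + Cconj (to_half (Cconj sigma * z')))%C) in *.
  apply Rmult_eq_reg_r with (X * Cmod (1 - Cconj z' * z)%C); [|nra].
  field_simplify; lra.
Qed.

Variable phi : C -> C.
Hypothesis phi_hol : holomorphic_on in_disk phi.
Hypothesis phi_maps : maps_to in_disk in_disk phi.

Let f : C -> C := half_plane_conj phi sigma.

Lemma half_plane_conj_pos w : 0 < Re w -> 0 < Re (f w).
Proof. intros Hw. apply cayley_inv_pos. apply phi_maps. apply cayley_disk; auto. Qed.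
Lemma half_plane_conj_diff w : 0 < Re w -> cdiff f w.
Proof.
  intros Hw. assert (Hc := cayley_disk w Hw). assert (Hp := phi_maps _ Hc).
  assert (D1 : cdiff (cayley sigma) w).
  { apply cdiff_mult. apply cdiff_const. apply cdiff_to_disk; auto. apply cdiff_id. }
  assert (D2 : cdiff (fun w => phi (cayley sigma w)) w).
  { apply cdiff_comp; auto. apply ex_derive_cdiff, phi_hol, Hc. }
  apply cdiff_div.
  - apply cdiff_plus; auto. apply cdiff_const.
  - apply cdiff_minus; auto. apply cdiff_const.
  - apply sigma_minus_neq_0. exact Hp.
Qed.

Lemma regular_orbit_half z : regular_backward_orbit_to phi sigma z ->
  exists k, 0 <= k < 1 /\ half_orbit f k (fun n => cayley_inv sigma (z n)).
Proof.
  intros [[[Hd Hb] [_ [B HB]]] Hl].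
  (* A nonnegative bound on the steps makes k = tanh (B' / 2) nonnegative. *)
  set (B' := Rmax 0 B). assert (M1 := Rmax_l 0 B). assert (M2 := Rmax_r 0 B). fold B' in M1, M2.
  assert (E1 : 1 <= exp B'). { rewrite <- exp_0. destruct M1 as [H|H]. left; apply exp_increasing; auto. rewrite <- H; lra. }
  set (k := (exp B' - 1) / (exp B' + 1)).
  assert (Hk : 0 <= k < 1).
  { split. apply Rle_div_r; lra. apply Rlt_div_l; lra. }
  exists k. split; auto. constructor.
  - intros n. apply cayley_inv_pos, Hd.
  - intros n. unfold f, half_plane_conj. rewrite cayley_cayley_inv by apply Hd. rewrite Hb. auto.
  - intros n. assert (P1 := cayley_inv_pos _ (Hd n)). assert (P2 := cayley_inv_pos _ (Hd (S n))).
    assert (Q := pseudo_half_lt_1 _ _ P1 P2).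
    assert (H : pseudo_half (cayley_inv sigma (z n)) (cayley_inv sigma (z (S n))) <= k).
    { apply hyp_of_le; auto. eapply Rle_trans. 2: exact M2. eapply Rle_trans. 2: apply (HB n).
      unfold hyp_step, hyp_dist. rewrite pseudo_hyp_dist_half by apply Hd. unfold hyp_of. lra. }
    assert (HP := Cmod_half_pos _ _ P1 P2). unfold pseudo_half in H. clearbody k.
    apply Rle_div_l in H; auto.
  - intros M.
    assert (Hm : 0 < Rabs M + 1) by (assert (H := Rabs_pos M); lra).
    assert (Hn : near sigma (fun x => Cmod (x - sigma)%C < / (Rabs M + 1))).
    { apply near_ball. apply Rinv_0_lt_compat; auto. }
    destruct (Hl _ (proj2 (locally_Cmod _ _) Hn)) as [N HN]. exists N. intros n Hn'. specialize (HN n Hn'). simpl in HN.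
    assert (Nz := sigma_minus_neq_0 _ (Hd n)). unfold cayley_inv. rewrite Cmod_div by auto.
    assert (P := proj1 (Cmod_gt_0 _) Nz).
    rewrite Cmod_minus_sym in HN.
    assert (T : 2 - Cmod (sigma - z n)%C <= Cmod (sigma + z n)%C).
    { assert (T := Cmod_minus_ge (2 * sigma) (sigma - z n)%C).
      replace (2 * sigma - (sigma - z n))%C with (sigma + z n)%C in T by ring.
      rewrite Cmod_mult, Cmod_R, Rabs_pos_eq, sigma_unit in T by lra. lra. }
    apply Rlt_div_r; auto.
    assert (HM := Rle_abs M).
    assert (Z : (Rabs M + 1) * Cmod (sigma - z n)%C < 1).
    { apply Rmult_lt_compat_l with (r := Rabs M + 1) in HN; auto. rewrite Rinv_r in HN; lra. }
    nra.
Qed.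

(** In half plane coordinates theta thus becomes the limit of minus the argument of w n + 1. *)
Lemma one_minus_conj_sigma z : Cmod z < 1 ->
  (1 - Cconj sigma * z)%C = (2 / (cayley_inv sigma z + 1))%C.
Proof.
  intros Hz. assert (P := half_plus1 _ (cayley_inv_pos z Hz)).
  rewrite cayley_inv_to_half in * by auto. assert (N := one_minus_neq_0 _ (conj_sigma_disk z Hz)).
  set (u := (Cconj sigma * z)%C) in *.
  assert (E : (1 - u)%C = (1 - (to_half u - 1) / (to_half u + 1))%C) by (rewrite to_half_left_inv; auto; apply conj_sigma_disk; auto).
  rewrite E. field. auto.
Qed.

End Transport.

(** * Limits of the hyperbolic step and of the argument along an orbit *)

Section OrbitLimits.

Variables (F : C -> C) (lam : R).
Hypothesis lam_gt_1 : 1 < lam.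
Hypothesis F_iso : isogonal_self_map F.
Variable b : C.
Hypothesis b_pos : 0 < Re b.

Let w (n : nat) : C := F (dil lam n b).
Let r : R := pseudo_half b (RtoC lam * b)%C.

Lemma image_pos n : 0 < Re (w n).
Proof. apply (iso_pos F F_iso), scale_pos; auto. Qed.
Lemma lam_b_pos : 0 < Re (RtoC lam * b)%C.
Proof. rewrite Re_scal. apply Rmult_lt_0_compat; lra. Qed.
Lemma pseudo_half_sym x y : pseudo_half x y = pseudo_half y x.
Proof.
  unfold pseudo_half. rewrite Cmod_minus_sym. f_equal. rewrite <- Cmod_conj. f_equal.
  destruct x, y. C_coords. f_equal; ring.
Qed.

Lemma r_bounds : 0 < r < 1.
Proof.
  assert (H := pseudo_half_lt_1 _ _ b_pos lam_b_pos). split; [|apply H].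
  unfold r, pseudo_half. apply Rdiv_lt_0_compat.
  - apply Cmod_gt_0, Cminus_neq_0. apply not_eq_sym, scale_lam_neq; auto.
  - apply Cmod_half_pos; auto. apply lam_b_pos.
Qed.

Lemma image_step n : pseudo_half (w n) (w (S n)) = r * (1 - hyp_defect F lam b n).
Proof.
  unfold hyp_defect, hyp_quot. fold (w n) (w (S n)).
  assert (P := half_plus_neq_0 _ _ (image_pos (S n)) (image_pos n)).
  assert (P1 := scale_pos lam lam_gt_1 n b b_pos). assert (P2 := scale_pos lam lam_gt_1 (S n) b b_pos).
  assert (N1 : (RtoC (lam ^ S n) * b - RtoC (lam ^ n) * b)%C <> 0).
  { apply Cminus_neq_0. rewrite scale_S. apply scale_neq; auto. apply scale_lam_neq; auto. }
  assert (N2 := half_plus_neq_0 _ _ P2 P1).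
  assert (N3 : ((RtoC (lam ^ S n) * b - RtoC (lam ^ n) * b) / (RtoC (lam ^ S n) * b + Cconj (dil lam n b)))%C <> 0).
  { apply Cmult_neq_0; auto. intros E. apply C1_nz. rewrite <- (Cinv_r _ N2), E. ring. }
  rewrite !Cmod_div by auto.
  assert (Er : Cmod (RtoC (lam ^ S n) * b - RtoC (lam ^ n) * b)%C / Cmod (RtoC (lam ^ S n) * b + Cconj (dil lam n b))%C = r).
  { unfold r. rewrite pseudo_half_sym. unfold pseudo_half.
    assert (Hn := lam_pow_pos lam lam_gt_1 n).
    replace (RtoC (lam ^ S n) * b - RtoC (lam ^ n) * b)%C with (RtoC (lam ^ n) * (RtoC lam * b - b))%C by (rewrite scale_S; ring).
    replace (RtoC (lam ^ S n) * b + Cconj (dil lam n b))%C with (RtoC (lam ^ n) * (RtoC lam * b + Cconj b))%C.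
    2:{ rewrite scale_S. destruct b. C_coords. f_equal; ring. }
    rewrite !Cmod_scal by lra. assert (Q := Cmod_half_pos _ _ lam_b_pos b_pos). field. lra. }
  rewrite Er, pseudo_half_sym. unfold pseudo_half. assert (R0 := r_bounds).
  apply Cmod_gt_0 in P. field. lra.
Qed.

Lemma step_defect n : r * hyp_defect F lam b n <= hyp_of r - hyp_of (pseudo_half (w n) (w (S n))) <= 2 * r / (1 - r) * hyp_defect F lam b n.
Proof.
  rewrite image_step. assert (R0 := r_bounds). assert (D := hyp_defect_bounds F lam lam_gt_1 F_iso b n b_pos).
  assert (H := hyp_of_bounds (r * (1 - hyp_defect F lam b n)) r ltac:(nra) ltac:(lra)).
  replace (2 * r / (1 - r) * hyp_defect F lam b n) with (2 * (r - r * (1 - hyp_defect F lam b n)) / (1 - r)) by (field; lra). lra.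
Qed.

Lemma lim_step : is_lim_seq (fun n => hyp_of (pseudo_half (w n) (w (S n)))) (hyp_of r).
Proof.
  assert (L := lim_defect F lam lam_gt_1 F_iso b b_pos).
  apply is_lim_seq_le_le with (fun n => hyp_of r - 2 * r / (1 - r) * hyp_defect F lam b n) (fun n => hyp_of r - r * hyp_defect F lam b n).
  - intros n. assert (H := step_defect n). lra.
  - replace (Finite (hyp_of r)) with (Finite (hyp_of r - 2 * r / (1 - r) * 0)) by (f_equal; ring).
    apply is_lim_seq_minus'. apply is_lim_seq_const. apply is_lim_seq_mult'; auto. apply is_lim_seq_const.
  - replace (Finite (hyp_of r)) with (Finite (hyp_of r - r * 0)) by (f_equal; ring).
    apply is_lim_seq_minus'. apply is_lim_seq_const. apply is_lim_seq_mult'; auto. apply is_lim_seq_const.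
Qed.

Lemma summable_step_iff :
  ex_series (fun n => hyp_of r - hyp_of (pseudo_half (w (S n)) (w (S (S n))))) <-> ex_series (hyp_defect F lam b).
Proof.
  assert (R0 := r_bounds). assert (D := fun n => hyp_defect_bounds F lam lam_gt_1 F_iso b n b_pos).
  (* The series of steps starts at n = 1, hence the shift in the series of defects. *)
  rewrite (ex_series_shift (hyp_defect F lam b) 1). simpl (1 + _)%nat. split; intros H.
  - apply ex_series_le_pos with (fun n => / r * (hyp_of r - hyp_of (pseudo_half (w (S n)) (w (S (S n)))))).
    + intros n. split. apply D. assert (Q := step_defect (S n)).
      apply Rmult_le_reg_l with r. lra. rewrite <- Rmult_assoc, Rinv_r by lra. lra.
    + apply ex_series_scal_R. auto.
  - apply ex_series_le_pos with (fun n => 2 * r / (1 - r) * hyp_defect F lam b (S n)).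
    + intros n. assert (Q := step_defect (S n)). assert (Q2 := D (S n)). assert (0 <= r * hyp_defect F lam b (S n)) by nra. lra.
    + apply (ex_series_scal_R (2 * r / (1 - r)) (fun n => hyp_defect F lam b (S n))). auto.
Qed.

(** Divided by x n = Re (F (lam^n)), the points w n tend to b and the summand 1 tends to 0;
    inversion reverses the argument, whence the conjugate. In the right half plane [Carg] is an
    arctangent, hence continuous. *)
Lemma lim_Carg : is_lim_seq (fun n => Carg (2 / (w n + 1))%C) (Carg (Cconj b)).
Proof.
  set (x := fun n => Re (F (RtoC (lam ^ n)))).
  assert (Hx : forall n, 0 < x n).
  { intros n. apply (iso_pos F F_iso). unfold Re; simpl. apply lam_pow_pos; auto. }
  assert (Lx : is_lim_seq (fun n => / x n) 0).
  { apply is_lim_seq_spec. intros eps. assert (He := cond_pos eps).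
    destruct (Re_F_infty F lam lam_gt_1 F_iso (/ eps)) as [N HN]. exists N. intros n Hn. specialize (HN n Hn). fold (x n) in HN.
    rewrite Rminus_0_r, Rabs_pos_eq by (left; apply Rinv_0_lt_compat; auto).
    rewrite <- (Rinv_inv eps). apply Rinv_lt_contravar; auto. apply Rmult_lt_0_compat; auto. apply Rinv_0_lt_compat; auto. }
  assert (Near : forall eps : posreal, exists N, forall n, (N <= n)%nat ->
     Rabs (Re (w n) / x n - Re b) < eps /\ Rabs (Im (w n) / x n - Im b) < eps).
  { intros eps. assert (He := cond_pos eps).
    destruct (scaled_limit F lam lam_gt_1 F_iso b b_pos (eps / 2) ltac:(lra)) as [N HN].
    exists N. intros n Hn. specialize (HN n Hn). fold (x n) (w n) in HN. assert (Hxn := Hx n).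
    assert (T1 := re_le_Cmod (w n - RtoC (x n) * b)%C).
    assert (T2 : Rabs (Im (w n - RtoC (x n) * b)%C) <= Cmod (w n - RtoC (x n) * b)%C).
    { eapply Rle_trans. 2: apply Rmax_Cmod. apply Rmax_r. }
    replace (Re (w n - RtoC (x n) * b)%C) with (x n * (Re (w n) / x n - Re b)) in T1.
    2:{ destruct (w n), b. unfold Re; simpl. field. lra. }
    replace (Im (w n - RtoC (x n) * b)%C) with (x n * (Im (w n) / x n - Im b)) in T2.
    2:{ destruct (w n), b. unfold Im; simpl. field. lra. }
    rewrite Rabs_mult, (Rabs_pos_eq (x n)) in T1, T2 by lra.
    split; apply Rmult_lt_reg_l with (x n); nra. }
  assert (LR : is_lim_seq (fun n => Re (w n) / x n) (Re b)).
  { apply is_lim_seq_spec. intros eps. destruct (Near eps) as [N HN]. exists N. intros n Hn. apply HN; auto. }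
  assert (LI : is_lim_seq (fun n => Im (w n) / x n) (Im b)).
  { apply is_lim_seq_spec. intros eps. destruct (Near eps) as [N HN]. exists N. intros n Hn. apply HN; auto. }
  assert (Hcb : 0 < Re (Cconj b)) by (destruct b; C_coords_all; auto).
  rewrite (Carg_atan (Cconj b)) by auto.
  apply is_lim_seq_ext with (fun n => atan (- (Im (w n) / x n) / (Re (w n) / x n + / x n))).
  { intros n. assert (W := image_pos n). assert (Hxn := Hx n).
    assert (Ew : (2 / (w n + 1))%C = (2 * (Re (w n) + 1) / ((Re (w n) + 1) * (Re (w n) + 1) + Im (w n) * Im (w n)),
        - 2 * Im (w n) / ((Re (w n) + 1) * (Re (w n) + 1) + Im (w n) * Im (w n)))).
    { destruct (w n) as [p q]. C_coords_all. unfold Cdiv, Cinv, Cmult, Cplus, RtoC; simpl. f_equal; field; nra. }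
    assert (PD : 0 < (Re (w n) + 1) * (Re (w n) + 1) + Im (w n) * Im (w n)) by nra.
    rewrite Carg_atan.
    - f_equal. rewrite Ew. unfold Re at 3, Im at 2. simpl. field. repeat split; try lra.
    - rewrite Ew. unfold Re at 1; simpl. apply Rdiv_lt_0_compat; lra. }
  replace (Im (Cconj b) / Re (Cconj b)) with (- Im b / (Re b + 0)).
  2:{ destruct b; C_coords_all. field. lra. }
  apply (is_lim_seq_continuous atan).
  - apply derivable_continuous_pt, derivable_pt_atan.
  - apply is_lim_seq_div'.
    + apply is_lim_seq_opp in LI. exact LI.
    + apply is_lim_seq_plus'; auto.
    + lra.
Qed.

(** For theta = arg (conj b) one has exp (2 i theta) = conj b / b, so the denominator is |lam conj b
    + b| / |b| and the fraction is the pseudo-hyperbolic distance of b and lam b. *)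
Lemma limit_step_formula :
  hyp_of r = 2 * arctanh ((lam - 1) / Cmod (Cexp_i (2 * Carg (Cconj b)) * RtoC lam + 1)%C).
Proof.
  assert (Hb := half_neq_0 b b_pos).
  assert (Hm : 0 < Cmod b) by (apply Cmod_gt_0; auto).
  assert (Hcb : Cconj b <> 0) by (apply Cmod_gt_0; rewrite Cmod_conj; auto).
  assert (E : (lam - 1) / Cmod (Cexp_i (2 * Carg (Cconj b)) * RtoC lam + 1)%C = r).
  { rewrite Cexp_i_Carg_double, Cmod_conj by auto.
    unfold r. rewrite pseudo_half_sym. unfold pseudo_half.
    replace (Cconj b * Cconj b / RtoC (Cmod b * Cmod b))%C with (Cconj b / b)%C.
    2:{ replace (RtoC (Cmod b * Cmod b)) with (b * Cconj b)%C. field. auto.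
        rewrite <- Cmod2_conj. f_equal. ring. }
    replace (Cconj b / b * RtoC lam + 1)%C with ((Cconj (RtoC lam * b) + b) / b)%C.
    2:{ rewrite Cmult_conj. replace (Cconj (RtoC lam)) with (RtoC lam) by (C_coords; f_equal; ring). field. auto. }
    replace (RtoC lam * b - b)%C with (RtoC (lam - 1) * b)%C by (rewrite RtoC_minus; ring).
    rewrite Cmod_div, Cmod_scal by (auto; lra).
    replace (Cmod (RtoC lam * b + Cconj b)%C) with (Cmod (Cconj (RtoC lam * b) + b)%C).
    2:{ rewrite <- Cmod_conj. f_equal. rewrite Cplus_conj, Cconj_conj. auto. }
    assert (Q : 0 < Cmod (Cconj (RtoC lam * b) + b)%C).
    { rewrite Cplus_comm. apply Cmod_half_pos; auto. apply lam_b_pos. }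
    field. lra. }
  rewrite E. unfold hyp_of, arctanh. field.
Qed.

End OrbitLimits.

(** * Regularity of the pre-model and summability along backward orbits *)

Theorem corollary4 :
  forall (phi : C -> C) (sigma : C) (lam : R) (F : C -> C),
    holomorphic_on in_disk phi ->
    maps_to in_disk in_disk phi ->
    repulsive_fixed_point phi sigma lam ->
    (exists z : nat -> C, regular_backward_orbit_to phi sigma z) ->
    is_pre_model phi sigma lam F ->
    (forall z : nat -> C, regular_backward_orbit_to phi sigma z ->
       exists theta rho : R,
         is_lim_seq (fun n => Carg (1 - Cconj sigma * z n)%C) theta /\
         is_lim_seq (hyp_step z) rho /\
         rho = 2 * arctanh ((lam - 1) /
                            Cmod (Cexp_i (2 * theta) * RtoC lam + 1)%C)) /\
    (regular_pre_model F <->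
       exists z : nat -> C,
         regular_backward_orbit_to phi sigma z /\ summable_step_defect z) /\
    (regular_pre_model F <->
       forall z : nat -> C,
         regular_backward_orbit_to phi sigma z -> summable_step_defect z).
Proof.
  intros phi sigma lam F phi_hol phi_maps [[sigma_unit _] [_ lam_gt_1]] [z0 Hz0] HF.
  assert (F_iso := pre_model_isogonal _ _ _ HF).
  assert (fF : forall w, 0 < Re w -> half_plane_conj phi sigma (F (RtoC lam * w)%C) = F w).
  { intros w Hw. destruct HF as (_ & _ & H & _). rewrite H.
    - f_equal. rewrite Cmult_assoc, <- RtoC_mult, Rinv_l by lra. ring.
    - unfold in_half_plane. rewrite Re_scal. apply Rmult_lt_0_compat; lra. }
  assert (Rep : forall z, regular_backward_orbit_to phi sigma z -> exists b, 0 < Re b /\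
     (forall n, Cmod (z n) < 1) /\ forall n, cayley_inv sigma (z n) = F (RtoC (lam ^ n) * b)%C).
  { intros z Hz. destruct (regular_orbit_half sigma sigma_unit phi z Hz) as (k & Hk & Ho).
    destruct (orbit_in_image (half_plane_conj phi sigma) F lam
      (half_plane_conj_diff sigma sigma_unit phi phi_hol phi_maps)
      (half_plane_conj_pos sigma sigma_unit phi phi_maps) lam_gt_1 F_iso fF k _ Hk Ho) as (b & Hb & Hw).
    exists b. split; auto. split; auto. apply Hz. }
  assert (Step : forall z b, (forall n, Cmod (z n) < 1) -> (forall n, cayley_inv sigma (z n) = F (RtoC (lam ^ n) * b)%C) ->
     forall n, hyp_of (pseudo_half (F (RtoC (lam ^ n) * b)%C) (F (RtoC (lam ^ S n) * b)%C)) = hyp_step z n).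
  { intros z b Hd Hw n. unfold hyp_step, hyp_dist. rewrite (pseudo_hyp_dist_half sigma sigma_unit) by auto.
    rewrite !Hw. auto. }
  assert (Lim : forall z b, 0 < Re b -> (forall n, Cmod (z n) < 1) -> (forall n, cayley_inv sigma (z n) = F (RtoC (lam ^ n) * b)%C) ->
     is_lim_seq (hyp_step z) (hyp_of (pseudo_half b (RtoC lam * b)%C))).
  { intros z b Hb Hd Hw. apply is_lim_seq_ext with (2 := lim_step F lam lam_gt_1 F_iso b Hb). apply Step; auto. }
  assert (Main : forall z, regular_backward_orbit_to phi sigma z -> regular_pre_model F <-> summable_step_defect z).
  { intros z Hz. destruct (Rep z Hz) as (b & Hb & Hd & Hw). assert (L := Lim z b Hb Hd Hw). assert (St := Step z b Hd Hw).
    rewrite (regular_iff_summable F lam lam_gt_1 F_iso b Hb).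
    rewrite <- (summable_step_iff F lam lam_gt_1 F_iso b Hb).
    split.
    - intros H. exists (hyp_of (pseudo_half b (RtoC lam * b)%C)). split; auto.
      revert H. apply ex_series_ext. intros n. rewrite St. auto.
    - intros (rho & Hrho & Hs).
      (* The rho of [summable_step_defect] is a limit of the same sequence of steps, so it is the
         explicit one. *)
      assert (E : hyp_of (pseudo_half b (RtoC lam * b)%C) = rho).
      { apply is_lim_seq_unique in L. apply is_lim_seq_unique in Hrho. rewrite L in Hrho. injection Hrho. auto. }
      rewrite E. revert Hs. apply ex_series_ext. intros n. rewrite St. auto. }
  split; [|split].
  - intros z Hz. destruct (Rep z Hz) as (b & Hb & Hd & Hw).
    exists (Carg (Cconj b)), (hyp_of (pseudo_half b (RtoC lam * b)%C)). split; [|split].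
    + apply is_lim_seq_ext with (2 := lim_Carg F lam lam_gt_1 F_iso b Hb).
      intros n. cbv beta. rewrite (one_minus_conj_sigma sigma sigma_unit) by auto. rewrite Hw. auto.
    + apply Lim; auto.
    + apply limit_step_formula; auto.
  - split.
    + intros H. exists z0. split; auto. apply Main; auto.
    + intros (z & Hz & Hs). apply (Main z Hz). auto.
  - split.
    + intros H z Hz. apply (Main z Hz). auto.
    (* The given orbit [z0] keeps the universal condition from being vacuous. *)
    + intros H. apply (Main z0 Hz0). auto.
Qed.
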